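(* (1) Let $\mathcal C$ be a connected Cartan scheme of rank three with $I=\{1,2,3\}$. Assume that $\mathcal R^{\mathrm{re}}(\mathcal C)$ is a finite irreducible root system of type $\mathcal C$. Then there exist an object $a\in A$ and a linear map $\tau\in\mathrm{Aut}(\mathbb Z^I)$ such that $\tau(\alpha_i)\in\{\alpha_1,\alpha_2,\alpha_3\}$ for all $i\in I$ and $\tau(R^a_+)$ is one of the $55$ subsets of $\mathbb Z^3$ listed (Nr. 1 to Nr. 55) in the context. Moreover, $\tau(R^a_+)$ with this property is uniquely determined. (2) Let $R$ be one of the $55$ subsets of $\mathbb Z^3$ listed in the context. There exists, up to equivalence, a unique connected simply connected Cartan scheme $\mathcal C(I,A,(\rho_i)_{i\in I},(C^a)_{a\in A})$ (with $I=\{1,2,3\}$) such that $R\cup -R$ is the set of real roots $R^a$ at an object $a\in A$. Moreover, $\mathcal R^{\mathrm{re}}(\mathcal C)$ is a finite irreducible root system of type $\mathcal C$.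
   Context: Notation: $\mathbb N=\{1,2,3,\dots\}$, $\mathbb N_0=\mathbb N\cup\{0\}$. Let $I$ be a non-empty finite set and $\{\alpha_i\mid i\in I\}$ the standard basis of $\mathbb Z^I$ (the $\alpha_i$ are the simple roots). A generalized Cartan matrix is $C=(c_{ij})_{i,j\in I}\in\mathbb Z^{I\times I}$ with $c_{ii}=2$, $c_{jk}\le 0$ for $j\ne k$, and $c_{ij}=0\Rightarrow c_{ji}=0$. A Cartan scheme $\mathcal C=\mathcal C(I,A,(\rho_i)_{i\in I},(C^a)_{a\in A})$ consists of a non-empty set $A$ (the objects), maps $\rho_i:A\to A$ ($i\in I$), and generalized Cartan matrices $C^a=(c^a_{jk})_{j,k\in I}$ ($a\in A$) such that $\rho_i^2=\mathrm{id}$ and $c^a_{ij}=c^{\rho_i(a)}_{ij}$ for all $a\in A$, $i,j\in I$. Its rank is $\#I$. Define $\sigma_i^a\in\mathrm{Aut}(\mathbb Z^I)$ by $\sigma_i^a(\alpha_j)=\alpha_j-c^a_{ij}\alpha_i$ for all $j\in I$. The Weyl groupoid $\mathcal W(\mathcal C)$ is the category with object set $A$ whose morphisms are the compositions of the maps $\sigma_i^a$, where $\sigma_i^a$ is regarded as an element of $\mathrm{Hom}(a,\rho_i(a))$; so each $w\in\mathrm{Hom}(a,b)$ is an automorphism of $\mathbb Z^I$. The set of real roots at $a$ is $R^a=\{w(\alpha_j)\mid b\in A,\ w\in\mathrm{Hom}(b,a),\ j\in I\}$, and $R^a_+=R^a\cap\mathbb N_0^I$ is the set of positive real roots. Put $m^a_{i,j}=\#(R^a\cap(\mathbb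 N_0\alpha_i+\mathbb N_0\alpha_j))$. The pair $\mathcal R^{\mathrm{re}}(\mathcal C)=(\mathcal C,(R^a)_{a\in A})$ is called a root system of type $\mathcal C$ if for all $a\in A$ and $i,j\in I$: (R1) $R^a=R^a_+\cup -R^a_+$; (R2) $R^a\cap\mathbb Z\alpha_i=\{\alpha_i,-\alpha_i\}$; (R3) $\sigma_i^a(R^a)=R^{\rho_i(a)}$; (R4) if $i\ne j$ and $m^a_{i,j}$ is finite then $(\rho_i\rho_j)^{m^a_{i,j}}(a)=a$. It is finite if $R^a$ is finite for all $a\in A$. A finite root system $\mathcal R^{\mathrm{re}}(\mathcal C)$ of type $\mathcal C$ is irreducible if and only if the matrix $C^a$ is indecomposable for every $a\in A$ (this may be taken as the definition). $\mathcal C$ is connected if $\mathrm{Hom}(a,b)\neq\emptyset$ for all $a,b\in A$, and simply connected if $\mathrm{Hom}(a,a)=\{\mathrm{id}_a\}$ for all $a\in A$. Two Cartan schemes $\mathcal C(I,A,(\rho_i),(C^a))$ and $\mathcal C'(I',A',(\rho'_i),(C'^a))$ are equivalent if there are bijections $\varphi_0:I\to I'$ and $\varphi_1:A\to A'$ with $\varphi_1(\rho_i(a))=\rho'_{\varphi_0(i)}(\varphi_1(a))$ and $c'^{\varphi_1(a)}_{\varphi_0(i)\varphi_0(j)}=c^a_{ij}$ for all $i,j\in I$, $a\in A$. The list of $55$ subsets of $\mathbb Z^3$ (sets of positive roots). Elements are written multiplicatively: the word $1^x2^y3^z$ denotes the vector $x\alpha_3+y\alpha_2+z\alpha_1$ (an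 omitted exponent is $1$, an omitted letter has exponent $0$; e.g. $12$ means $\alpha_3+\alpha_2$). Nr. 1 (6 roots): $1, 2, 3, 12, 13, 123$ Nr. 2 (7 roots): $1, 2, 3, 12, 13, 23, 123$ Nr. 3 (8 roots): $1, 2, 3, 12, 13, 1^{2}2, 123, 1^{2}23$ Nr. 4 (9 roots): $1, 2, 3, 12, 13, 1^{2}2, 123, 1^{2}23, 1^{2}23^{2}$ Nr. 5 (9 roots): $1, 2, 3, 12, 23, 1^{2}2, 123, 1^{2}23, 1^{2}2^{2}3$ Nr. 6 (10 roots): $1, 2, 3, 12, 13, 1^{2}2, 1^{2}3, 123, 1^{2}23, 1^{3}23$ Nr. 7 (10 roots): $1, 2, 3, 12, 13, 23, 1^{2}2, 123, 1^{2}23, 1^{2}2^{2}3$ Nr. 8 (11 roots): $1, 2, 3, 12, 13, 1^{2}2, 1^{2}3, 123, 1^{2}23, 1^{3}23, 1^{3}2^{2}3$ Nr. 9 (12 roots): $1, 2, 3, 12, 13, 1^{2}2, 123, 1^{3}2, 1^{2}23, 1^{3}23, 1^{3}2^{2}3, 1^{4}2^{2}3$ Nr. 10 (12 roots): $1, 2, 3, 12, 13, 1^{2}2, 1^{2}3, 123, 1^{2}23, 1^{3}23, 1^{2}2^{2}3, 1^{3}2^{2}3$ Nr. 11 (13 roots): $1, 2, 3, 12, 13, 1^{2}2, 123, 1^{3}2, 1^{2}23, 1^{3}2^{2}, 1^{3}23, 1^{3}2^{2}3, 1^{4}2^{2}3$ Nr. 12 (13 roots): $1, 2, 3, 12, 13,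 1^{2}2, 1^{2}3, 123, 1^{3}2, 1^{2}23, 1^{3}23, 1^{4}23, 1^{4}2^{2}3$ Nr. 13 (13 roots): $1, 2, 3, 12, 13, 1^{2}2, 1^{2}3, 123, 1^{2}23, 1^{3}23, 1^{2}2^{2}3, 1^{3}2^{2}3, 1^{4}2^{2}3$ Nr. 14 (13 roots): $1, 2, 3, 12, 13, 1^{2}2, 123, 13^{2}, 1^{2}23, 123^{2}, 1^{2}23^{2}, 1^{3}23^{2}, 1^{3}2^{2}3^{2}$ Nr. 15 (14 roots): $1, 2, 3, 12, 13, 1^{2}2, 1^{2}3, 123, 1^{3}2, 1^{2}23, 1^{3}23, 1^{4}23, 1^{3}2^{2}3, 1^{4}2^{2}3$ Nr. 16 (15 roots): $1, 2, 3, 12, 13, 1^{2}2, 1^{2}3, 123, 1^{3}2, 1^{2}23, 1^{3}23, 1^{4}23, 1^{3}2^{2}3, 1^{4}2^{2}3, 1^{5}2^{2}3$ Nr. 17 (16 roots): $1, 2, 3, 12, 13, 1^{2}2, 1^{2}3, 123, 1^{3}2, 1^{2}23, 1^{3}2^{2}, 1^{3}23, 1^{4}23, 1^{3}2^{2}3, 1^{4}2^{2}3, 1^{5}2^{2}3$ Nr. 18 (16 roots): $1, 2, 3, 12, 23, 1^{2}2, 123, 1^{3}2, 1^{2}23, 12^{2}3, 1^{3}23, 1^{2}2^{2}3, 1^{3}2^{2}3, 1^{4}2^{2}3, 1^{4}2^{3}3, 1^{4}2^{3}3^{2}$ Nr. 19 (17 roots): $1, 2, 3, 12, 13, 1^{2}2,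 1^{2}3, 123, 1^{3}2, 1^{2}23, 1^{4}2, 1^{3}23, 1^{4}23, 1^{5}23, 1^{4}2^{2}3, 1^{5}2^{2}3, 1^{6}2^{2}3$ Nr. 20 (17 roots): $1, 2, 3, 12, 13, 1^{2}2, 1^{2}3, 123, 1^{3}2, 1^{2}23, 1^{3}2^{2}, 1^{3}23, 1^{4}23, 1^{3}2^{2}3, 1^{4}2^{2}3, 1^{5}2^{2}3, 1^{5}2^{2}3^{2}$ Nr. 21 (17 roots): $1, 2, 3, 12, 13, 1^{2}2, 123, 1^{3}2, 1^{2}23, 1^{3}23, 1^{2}2^{2}3, 1^{3}2^{2}3, 1^{4}2^{2}3, 1^{5}2^{2}3, 1^{5}2^{3}3, 1^{5}2^{3}3^{2}, 1^{6}2^{3}3^{2}$ Nr. 22 (18 roots): $1, 2, 3, 12, 13, 1^{2}2, 1^{2}3, 123, 1^{3}2, 1^{2}23, 1^{3}2^{2}, 1^{3}23, 1^{4}23, 1^{3}2^{2}3, 1^{4}2^{2}3, 1^{5}2^{2}3, 1^{5}2^{3}3, 1^{6}2^{3}3$ Nr. 23 (18 roots): $1, 2, 3, 12, 13, 23, 1^{2}2, 123, 1^{3}2, 1^{2}23, 12^{2}3, 1^{3}23, 1^{2}2^{2}3, 1^{3}2^{2}3, 1^{4}2^{2}3, 1^{3}2^{3}3, 1^{4}2^{3}3, 1^{4}2^{3}3^{2}$ Nr. 24 (19 roots): $1, 2, 3, 12, 13, 1^{2}2, 123, 1^{3}2, 1^{2}23, 1^{4}2, 1^{3}23, 1^{4}23,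 1^{3}2^{2}3, 1^{4}2^{2}3, 1^{5}2^{2}3, 1^{6}2^{2}3, 1^{6}2^{3}3, 1^{7}2^{3}3, 1^{7}2^{3}3^{2}$ Nr. 25 (19 roots): $1, 2, 3, 12, 23, 1^{2}2, 123, 1^{3}2, 1^{2}23, 1^{4}2, 1^{3}23, 1^{2}2^{2}3, 1^{4}23, 1^{3}2^{2}3, 1^{4}2^{2}3, 1^{5}2^{2}3, 1^{6}2^{2}3, 1^{6}2^{3}3, 1^{6}2^{3}3^{2}$ Nr. 26 (19 roots): $1, 2, 3, 12, 13, 23, 1^{2}2, 12^{2}, 123, 1^{3}2, 1^{2}23, 12^{2}3, 1^{3}23, 1^{2}2^{2}3, 1^{3}2^{2}3, 1^{4}2^{2}3, 1^{3}2^{3}3, 1^{4}2^{3}3, 1^{4}2^{3}3^{2}$ Nr. 27 (19 roots): $1, 2, 3, 12, 13, 23, 1^{2}2, 123, 1^{3}2, 1^{2}23, 12^{2}3, 1^{3}2^{2}, 1^{3}23, 1^{2}2^{2}3, 1^{3}2^{2}3, 1^{4}2^{2}3, 1^{3}2^{3}3, 1^{4}2^{3}3, 1^{4}2^{3}3^{2}$ Nr. 28 (19 roots): $1, 2, 3, 12, 23, 1^{2}2, 123, 1^{3}2, 1^{2}23, 1^{3}2^{2}, 1^{3}23, 1^{2}2^{2}3, 1^{3}2^{2}3, 1^{4}2^{2}3, 1^{3}2^{3}3, 1^{4}2^{3}3, 1^{5}2^{3}3, 1^{6}2^{3}3, 1^{6}2^{4}3$ Nr. 29 (20 roots): $1,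 2, 3, 12, 13, 1^{2}2, 123, 1^{3}2, 1^{2}23, 1^{4}2, 1^{3}2^{2}, 1^{3}23, 1^{4}23, 1^{3}2^{2}3, 1^{5}2^{2}, 1^{4}2^{2}3, 1^{5}2^{2}3, 1^{6}2^{2}3, 1^{6}2^{3}3, 1^{7}2^{3}3$ Nr. 30 (20 roots): $1, 2, 3, 12, 13, 1^{2}2, 123, 1^{3}2, 1^{2}23, 1^{4}2, 1^{3}2^{2}, 1^{3}23, 1^{4}23, 1^{3}2^{2}3, 1^{4}2^{2}3, 1^{5}2^{2}3, 1^{6}2^{2}3, 1^{6}2^{3}3, 1^{7}2^{3}3, 1^{7}2^{3}3^{2}$ Nr. 31 (20 roots): $1, 2, 3, 12, 13, 1^{2}2, 1^{2}3, 123, 1^{3}2, 1^{2}23, 1^{3}2^{2}, 1^{3}23, 1^{2}2^{2}3, 1^{4}23, 1^{3}2^{2}3, 1^{4}2^{2}3, 1^{5}2^{2}3, 1^{4}2^{3}3, 1^{5}2^{3}3, 1^{6}2^{3}3^{2}$ Nr. 32 (21 roots): $1, 2, 3, 12, 13, 1^{2}2, 123, 1^{3}2, 1^{2}23, 1^{4}2, 1^{3}2^{2}, 1^{3}23, 1^{4}23, 1^{3}2^{2}3, 1^{5}2^{2}, 1^{4}2^{2}3, 1^{5}2^{2}3, 1^{6}2^{2}3, 1^{6}2^{3}3, 1^{7}2^{3}3, 1^{7}2^{3}3^{2}$ Nr. 33 (21 roots): $1, 2, 3, 12, 13, 1^{2}2, 1^{2}3, 123, 1^{3}2, 1^{2}23,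 1^{3}2^{2}, 1^{3}23, 1^{2}2^{2}3, 1^{4}23, 1^{3}2^{2}3, 1^{4}2^{2}3, 1^{5}2^{2}3, 1^{4}2^{3}3, 1^{5}2^{3}3, 1^{6}2^{3}3, 1^{6}2^{3}3^{2}$ Nr. 34 (21 roots): $1, 2, 3, 12, 13, 1^{2}2, 1^{2}3, 123, 1^{3}2, 1^{2}23, 1^{3}2^{2}, 1^{3}23, 1^{4}23, 1^{3}2^{2}3, 1^{4}2^{2}3, 1^{5}2^{2}3, 1^{5}2^{3}3, 1^{5}2^{2}3^{2}, 1^{6}2^{3}3, 1^{6}2^{3}3^{2}, 1^{7}2^{3}3^{2}$ Nr. 35 (22 roots): $1, 2, 3, 12, 13, 1^{2}2, 1^{2}3, 123, 1^{3}2, 1^{2}23, 1^{3}2^{2}, 1^{3}23, 1^{2}2^{2}3, 1^{4}23, 1^{3}2^{2}3, 1^{4}2^{2}3, 1^{5}2^{2}3, 1^{4}2^{3}3, 1^{5}2^{3}3, 1^{5}2^{2}3^{2}, 1^{5}2^{3}3^{2}, 1^{6}2^{3}3^{2}$ Nr. 36 (25 roots): $1, 2, 3, 12, 13, 1^{2}2, 1^{2}3, 123, 1^{3}2, 1^{2}23, 1^{4}2, 1^{3}2^{2}, 1^{3}23, 1^{4}23, 1^{3}2^{2}3, 1^{5}2^{2}, 1^{5}23, 1^{4}2^{2}3, 1^{5}2^{2}3, 1^{6}2^{2}3, 1^{7}2^{2}3, 1^{6}2^{3}3, 1^{7}2^{3}3, 1^{8}2^{3}3, 1^{8}2^{3}3^{2}$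 Nr. 37 (25 roots): $1, 2, 3, 12, 13, 1^{2}2, 1^{2}3, 123, 1^{3}2, 1^{2}23, 1^{4}2, 1^{3}23, 1^{4}23, 1^{3}2^{2}3, 1^{5}23, 1^{4}2^{2}3, 1^{5}2^{2}3, 1^{6}2^{2}3, 1^{7}2^{2}3, 1^{6}2^{3}3, 1^{7}2^{3}3, 1^{8}2^{3}3, 1^{7}2^{3}3^{2}, 1^{8}2^{3}3^{2}, 1^{9}2^{3}3^{2}$ Nr. 38 (25 roots): $1, 2, 3, 12, 13, 1^{2}2, 1^{2}3, 12^{2}, 123, 1^{3}2, 1^{2}23, 12^{2}3, 1^{3}23, 1^{2}2^{2}3, 1^{4}23, 1^{3}2^{2}3, 1^{4}2^{2}3, 1^{3}2^{3}3, 1^{3}2^{2}3^{2}, 1^{4}2^{3}3, 1^{5}2^{3}3, 1^{4}2^{3}3^{2}, 1^{5}2^{3}3^{2}, 1^{6}2^{3}3^{2}, 1^{7}2^{4}3^{2}$ Nr. 39 (25 roots): $1, 2, 3, 12, 13, 1^{2}2, 1^{2}3, 123, 1^{3}2, 1^{2}23, 1^{3}2^{2}, 1^{3}23, 1^{2}2^{2}3, 1^{4}23, 1^{3}2^{2}3, 1^{4}2^{2}3, 1^{5}2^{2}3, 1^{4}2^{3}3, 1^{5}2^{3}3, 1^{5}2^{2}3^{2}, 1^{6}2^{3}3, 1^{5}2^{3}3^{2}, 1^{6}2^{3}3^{2}, 1^{7}2^{3}3^{2}, 1^{7}2^{4}3^{2}$ Nr. 40 (26 roots): $1, 2, 3,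 12, 13, 1^{2}2, 1^{2}3, 123, 1^{3}2, 1^{2}23, 1^{4}2, 1^{3}2^{2}, 1^{3}23, 1^{4}23, 1^{3}2^{2}3, 1^{5}2^{2}, 1^{5}23, 1^{4}2^{2}3, 1^{5}2^{2}3, 1^{6}2^{2}3, 1^{7}2^{2}3, 1^{6}2^{3}3, 1^{7}2^{3}3, 1^{8}2^{3}3, 1^{7}2^{3}3^{2}, 1^{8}2^{3}3^{2}$ Nr. 41 (26 roots): $1, 2, 3, 12, 13, 1^{2}2, 1^{2}3, 123, 1^{3}2, 1^{2}23, 1^{4}2, 1^{3}2^{2}, 1^{3}23, 1^{4}23, 1^{3}2^{2}3, 1^{5}23, 1^{4}2^{2}3, 1^{5}2^{2}3, 1^{6}2^{2}3, 1^{7}2^{2}3, 1^{6}2^{3}3, 1^{7}2^{3}3, 1^{8}2^{3}3, 1^{7}2^{3}3^{2}, 1^{8}2^{3}3^{2}, 1^{9}2^{3}3^{2}$ Nr. 42 (27 roots): $1, 2, 3, 12, 13, 1^{2}2, 1^{2}3, 123, 1^{3}2, 1^{2}23, 1^{4}2, 1^{3}2^{2}, 1^{3}23, 1^{4}23, 1^{3}2^{2}3, 1^{5}2^{2}, 1^{5}23, 1^{4}2^{2}3, 1^{5}2^{2}3, 1^{6}2^{2}3, 1^{7}2^{2}3, 1^{6}2^{3}3, 1^{7}2^{3}3, 1^{8}2^{3}3, 1^{7}2^{3}3^{2}, 1^{8}2^{3}3^{2}, 1^{9}2^{3}3^{2}$ Nr. 43 (27 roots): $1, 2, 3, 12, 13,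 1^{2}2, 1^{2}3, 123, 1^{3}2, 1^{2}23, 1^{4}2, 1^{3}2^{2}, 1^{3}23, 1^{4}23, 1^{3}2^{2}3, 1^{5}23, 1^{4}2^{2}3, 1^{5}2^{2}3, 1^{6}2^{2}3, 1^{5}2^{2}3^{2}, 1^{7}2^{2}3, 1^{6}2^{3}3, 1^{7}2^{3}3, 1^{8}2^{3}3, 1^{7}2^{3}3^{2}, 1^{8}2^{3}3^{2}, 1^{9}2^{3}3^{2}$ Nr. 44 (27 roots): $1, 2, 3, 12, 13, 1^{2}2, 1^{2}3, 123, 1^{3}2, 1^{2}23, 1^{4}2, 1^{3}2^{2}, 1^{3}23, 1^{4}23, 1^{3}2^{2}3, 1^{5}23, 1^{4}2^{2}3, 1^{5}2^{2}3, 1^{6}2^{2}3, 1^{7}2^{2}3, 1^{6}2^{3}3, 1^{7}2^{3}3, 1^{7}2^{2}3^{2}, 1^{8}2^{3}3, 1^{7}2^{3}3^{2}, 1^{8}2^{3}3^{2}, 1^{9}2^{3}3^{2}$ Nr. 45 (28 roots): $1, 2, 3, 12, 13, 1^{2}2, 1^{2}3, 123, 1^{3}2, 1^{2}23, 1^{4}2, 1^{3}2^{2}, 1^{3}23, 1^{4}23, 1^{3}2^{2}3, 1^{5}2^{2}, 1^{5}23, 1^{4}2^{2}3, 1^{5}2^{2}3, 1^{6}2^{2}3, 1^{5}2^{2}3^{2}, 1^{7}2^{2}3, 1^{6}2^{3}3, 1^{7}2^{3}3, 1^{8}2^{3}3, 1^{7}2^{3}3^{2}, 1^{8}2^{3}3^{2},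 1^{9}2^{3}3^{2}$ Nr. 46 (28 roots): $1, 2, 3, 12, 13, 1^{2}2, 1^{2}3, 123, 1^{3}2, 1^{2}23, 1^{4}2, 1^{3}2^{2}, 1^{3}23, 1^{4}23, 1^{3}2^{2}3, 1^{5}23, 1^{4}2^{2}3, 1^{5}2^{2}3, 1^{6}2^{2}3, 1^{5}2^{2}3^{2}, 1^{7}2^{2}3, 1^{6}2^{3}3, 1^{7}2^{3}3, 1^{8}2^{3}3, 1^{7}2^{3}3^{2}, 1^{8}2^{3}3^{2}, 1^{9}2^{3}3^{2}, 1^{9}2^{4}3^{2}$ Nr. 47 (28 roots): $1, 2, 3, 12, 13, 1^{2}2, 1^{2}3, 123, 1^{3}2, 1^{2}23, 1^{4}2, 1^{3}2^{2}, 1^{3}23, 1^{4}23, 1^{3}2^{2}3, 1^{5}23, 1^{4}2^{2}3, 1^{5}2^{2}3, 1^{6}2^{2}3, 1^{5}2^{2}3^{2}, 1^{7}2^{2}3, 1^{6}2^{3}3, 1^{7}2^{3}3, 1^{8}2^{3}3, 1^{7}2^{3}3^{2}, 1^{8}2^{3}3^{2}, 1^{9}2^{3}3^{2}, 1^{11}2^{4}3^{2}$ Nr. 48 (29 roots): $1, 2, 3, 12, 13, 1^{2}2, 1^{2}3, 123, 1^{3}2, 1^{2}23, 1^{4}2, 1^{3}2^{2}, 1^{3}23, 1^{4}23, 1^{3}2^{2}3, 1^{5}2^{2}, 1^{5}23, 1^{4}2^{2}3, 1^{5}2^{2}3, 1^{6}2^{2}3, 1^{5}2^{2}3^{2}, 1^{7}2^{2}3,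 1^{6}2^{3}3, 1^{7}2^{3}3, 1^{7}2^{2}3^{2}, 1^{8}2^{3}3, 1^{7}2^{3}3^{2}, 1^{8}2^{3}3^{2}, 1^{9}2^{3}3^{2}$ Nr. 49 (29 roots): $1, 2, 3, 12, 13, 1^{2}2, 1^{2}3, 123, 1^{3}2, 1^{2}23, 1^{4}2, 1^{3}2^{2}, 1^{3}23, 1^{4}23, 1^{3}2^{2}3, 1^{5}2^{2}, 1^{5}23, 1^{4}2^{2}3, 1^{5}2^{2}3, 1^{6}2^{2}3, 1^{5}2^{2}3^{2}, 1^{7}2^{2}3, 1^{6}2^{3}3, 1^{7}2^{3}3, 1^{8}2^{3}3, 1^{7}2^{3}3^{2}, 1^{8}2^{3}3^{2}, 1^{9}2^{3}3^{2}, 1^{9}2^{4}3^{2}$ Nr. 50 (29 roots): $1, 2, 3, 12, 13, 1^{2}2, 1^{2}3, 123, 1^{3}2, 1^{2}23, 1^{4}2, 1^{3}2^{2}, 1^{3}23, 1^{4}23, 1^{3}2^{2}3, 1^{5}2^{2}, 1^{5}23, 1^{4}2^{2}3, 1^{5}2^{2}3, 1^{6}2^{2}3, 1^{5}2^{2}3^{2}, 1^{7}2^{2}3, 1^{6}2^{3}3, 1^{7}2^{3}3, 1^{8}2^{3}3, 1^{7}2^{3}3^{2}, 1^{8}2^{3}3^{2}, 1^{9}2^{3}3^{2}, 1^{11}2^{4}3^{2}$ Nr. 51 (30 roots): $1, 2, 3, 12, 13, 1^{2}2, 1^{2}3, 123, 1^{3}2, 1^{2}23, 1^{4}2, 1^{3}2^{2},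 1^{3}23, 1^{4}23, 1^{3}2^{2}3, 1^{5}2^{2}, 1^{5}23, 1^{4}2^{2}3, 1^{5}2^{2}3, 1^{6}2^{2}3, 1^{5}2^{2}3^{2}, 1^{7}2^{2}3, 1^{6}2^{3}3, 1^{7}2^{3}3, 1^{7}2^{2}3^{2}, 1^{8}2^{3}3, 1^{7}2^{3}3^{2}, 1^{8}2^{3}3^{2}, 1^{9}2^{3}3^{2}, 1^{9}2^{4}3^{2}$ Nr. 52 (31 roots): $1, 2, 3, 12, 13, 1^{2}2, 1^{2}3, 123, 1^{3}2, 1^{2}23, 1^{4}2, 1^{3}23, 1^{5}2, 1^{4}23, 1^{6}2, 1^{5}23, 1^{4}2^{2}3, 1^{6}23, 1^{5}2^{2}3, 1^{7}23, 1^{6}2^{2}3, 1^{7}2^{2}3, 1^{8}2^{2}3, 1^{9}2^{2}3, 1^{10}2^{2}3, 1^{9}2^{3}3, 1^{10}2^{3}3, 1^{11}2^{3}3, 1^{10}2^{3}3^{2}, 1^{11}2^{3}3^{2}, 1^{12}2^{3}3^{2}$ Nr. 53 (31 roots): $1, 2, 3, 12, 13, 1^{2}2, 1^{2}3, 123, 1^{3}2, 1^{2}23, 1^{4}2, 1^{3}2^{2}, 1^{3}23, 1^{4}23, 1^{3}2^{2}3, 1^{5}2^{2}, 1^{5}23, 1^{4}2^{2}3, 1^{5}2^{2}3, 1^{6}2^{2}3, 1^{5}2^{2}3^{2}, 1^{7}2^{2}3, 1^{6}2^{3}3, 1^{7}2^{3}3, 1^{7}2^{2}3^{2}, 1^{8}2^{3}3,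 1^{7}2^{3}3^{2}, 1^{8}2^{3}3^{2}, 1^{9}2^{3}3^{2}, 1^{9}2^{4}3^{2}, 1^{11}2^{4}3^{2}$ Nr. 54 (34 roots): $1, 2, 3, 12, 13, 1^{2}2, 1^{2}3, 123, 1^{3}2, 1^{2}23, 1^{4}2, 1^{3}2^{2}, 1^{3}23, 1^{4}23, 1^{3}2^{2}3, 1^{5}2^{2}, 1^{5}23, 1^{4}2^{2}3, 1^{5}2^{2}3, 1^{6}2^{2}3, 1^{5}2^{3}3, 1^{7}2^{2}3, 1^{6}2^{3}3, 1^{7}2^{3}3, 1^{8}2^{3}3, 1^{7}2^{3}3^{2}, 1^{8}2^{4}3, 1^{8}2^{3}3^{2}, 1^{9}2^{4}3, 1^{9}2^{3}3^{2}, 1^{9}2^{4}3^{2}, 1^{11}2^{4}3^{2}, 1^{11}2^{5}3^{2}, 1^{12}2^{5}3^{2}$ Nr. 55 (37 roots): $1, 2, 3, 12, 13, 1^{2}2, 1^{2}3, 123, 1^{3}2, 1^{2}23, 1^{4}2, 1^{3}2^{2}, 1^{3}23, 1^{4}23, 1^{3}2^{2}3, 1^{5}2^{2}, 1^{5}23, 1^{4}2^{2}3, 1^{5}2^{2}3, 1^{6}2^{2}3, 1^{5}2^{3}3, 1^{7}2^{2}3, 1^{6}2^{3}3, 1^{7}2^{3}3, 1^{8}2^{3}3, 1^{7}2^{3}3^{2}, 1^{9}2^{3}3, 1^{8}2^{4}3, 1^{8}2^{3}3^{2}, 1^{9}2^{4}3, 1^{9}2^{3}3^{2}, 1^{10}2^{4}3,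 1^{9}2^{4}3^{2}, 1^{11}2^{4}3^{2}, 1^{11}2^{5}3^{2}, 1^{12}2^{5}3^{2}, 1^{13}2^{5}3^{2}$
   Formalization: In (2), uniqueness up to equivalence is stated among connected simply connected Cartan schemes whose real roots form a root system of that type; without (R4) it fails, e.g. for Nr. 1 with A the free product of three groups of order 2 and constant Cartan matrix of type A_3. *)

(* Defs.v *)
From HB Require Import structures.
From mathcomp Require Import all_boot all_order all_algebra.
From mathcomp Require Import boolp classical_sets functions cardinality.

Set Implicit Arguments.
Unset Strict Implicit.
Unset Printing Implicit Defensive.

Import Order.TTheory GRing.Theory Num.Theory.

Local Open Scope classical_set_scope.
Local Open Scope ring_scope.

(* Sets of lattice vectors are classical sets, so that equality of two of them
   is extensional. *)
Notation lattice I := {ffun I -> int}.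

Section CartanScheme.

Variable I : finType.

Definition simple_root (i : I) : lattice I := [ffun j => (j == i)%:R].

Definition generalized_cartan_matrix (M : I -> I -> int) : Prop :=
  [/\ forall i, M i i = 2,
      forall j k, j != k -> M j k <= 0 &
      forall i j, M i j = 0 -> M j i = 0].

Definition decomposable (M : I -> I -> int) : Prop :=
  exists J : {set I},
    [/\ exists i, i \in J,
        exists j, j \notin J &
        forall i j, i \in J -> j \notin J -> M i j = 0 /\ M j i = 0].

Record cartan_scheme := CartanScheme {
  object : Type;
  rho : I -> object -> object;
  cartan : object -> I -> I -> int;
  index_nonempty : (0 < #|I|)%N;
  object_nonempty : inhabited object;
  cartan_gcm : forall a, generalized_cartan_matrix (cartan a);
  rhoK : forall i, involutive (rho i);
  cartan_rho : forall a i j, cartan a i j = cartan (rho i a) i j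
}.

Variable C : cartan_scheme.

Implicit Types a b : object C.

(* The additive extension of alpha_j |-> alpha_j - c^a_ij alpha_i. *)
Definition sigma (i : I) a (v : lattice I) : lattice I :=
  \sum_j (simple_root j - simple_root i *~ cartan a i j) *~ v j.

(* weyl_hom a b w: the map w is a morphism from a to b. *)
Inductive weyl_hom a : object C -> (lattice I -> lattice I) -> Prop :=
| weyl_hom_id : weyl_hom a a id
| weyl_hom_sigma i b w :
    weyl_hom a b w -> weyl_hom a (rho i b) (sigma i b \o w).

Definition real_roots a : set (lattice I) :=
  [set v | exists b w j, weyl_hom b a w /\ v = w (simple_root j)].

Definition positive_roots a : set (lattice I) :=
  real_roots a `&` [set v | forall k, 0 <= v k].

Definition rank2_cone (i j : I) : set (lattice I) :=
  [set v | exists m n : nat, v = simple_root i *+ m + simple_root j *+ n].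

(* In the last clause m runs over the naturals that are the cardinality of the
   rank two part of the roots: there is none when that part is infinite. *)
Definition is_root_system : Prop :=
  forall a (i j : I),
    [/\ real_roots a = positive_roots a `|` -%R @` positive_roots a,
        real_roots a `&` [set simple_root i *~ n | n in [set: int]] =
          [set simple_root i; - simple_root i],
        sigma i a @` real_roots a = real_roots (rho i a) &
        i != j ->
        forall m : nat, (real_roots a `&` rank2_cone i j #= `I_m)%card ->
          iter m (rho i \o rho j) a = a].

Definition finite_root_system : Prop :=
  is_root_system /\ forall a, finite_set (real_roots a).

Definition irreducible_scheme : Prop := forall a, ~ decomposable (cartan a).

Definition connected_scheme : Prop := forall a b, exists w, weyl_hom a b w.

Definition simply_connected_scheme : Prop :=
  forall a w, weyl_hom a a w -> w =1 id.

End CartanScheme.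

Definition equivalent_schemes (I I' : finType)
    (C : cartan_scheme I) (C' : cartan_scheme I') : Prop :=
  exists (f0 : I -> I') (f1 : object C -> object C'),
    [/\ bijective f0, bijective f1,
        forall i a, f1 (rho i a) = rho (f0 i) (f1 a) &
        forall i j a, cartan (f1 a) (f0 i) (f0 j) = cartan a i j].

(* The index set {1, 2, 3} is 'I_3, with i standing for the ordinal i - 1. *)
Definition alpha1 : lattice 'I_3 := simple_root (inord 0).
Definition alpha2 : lattice 'I_3 := simple_root (inord 1).
Definition alpha3 : lattice 'I_3 := simple_root (inord 2).

(* The triple (x, y, z) is the word 1^x 2^y 3^z; the letter 1 denotes alpha_3
   and the letter 3 denotes alpha_1. *)
Definition word_root (t : nat * nat * nat) : lattice 'I_3 :=
  let: (x, y, z) := t in alpha3 *+ x + alpha2 *+ y + alpha1 *+ z.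

Definition root_list : seq (seq (nat * nat * nat)) := [::
  [:: (1,0,0); (0,1,0); (0,0,1); (1,1,0); (1,0,1); (1,1,1)];
  [:: (1,0,0); (0,1,0); (0,0,1); (1,1,0); (1,0,1); (0,1,1); (1,1,1)];
  [:: (1,0,0); (0,1,0); (0,0,1); (1,1,0); (1,0,1); (2,1,0); (1,1,1); (2,1,1)];
  [:: (1,0,0); (0,1,0); (0,0,1); (1,1,0); (1,0,1); (2,1,0); (1,1,1); (2,1,1);
      (2,1,2)];
  [:: (1,0,0); (0,1,0); (0,0,1); (1,1,0); (0,1,1); (2,1,0); (1,1,1); (2,1,1);
      (2,2,1)];
  [:: (1,0,0); (0,1,0); (0,0,1); (1,1,0); (1,0,1); (2,1,0); (2,0,1); (1,1,1);
      (2,1,1); (3,1,1)];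
  [:: (1,0,0); (0,1,0); (0,0,1); (1,1,0); (1,0,1); (0,1,1); (2,1,0); (1,1,1);
      (2,1,1); (2,2,1)];
  [:: (1,0,0); (0,1,0); (0,0,1); (1,1,0); (1,0,1); (2,1,0); (2,0,1); (1,1,1);
      (2,1,1); (3,1,1); (3,2,1)];
  [:: (1,0,0); (0,1,0); (0,0,1); (1,1,0); (1,0,1); (2,1,0); (1,1,1); (3,1,0);
      (2,1,1); (3,1,1); (3,2,1); (4,2,1)];
  [:: (1,0,0); (0,1,0); (0,0,1); (1,1,0); (1,0,1); (2,1,0); (2,0,1); (1,1,1);
      (2,1,1); (3,1,1); (2,2,1); (3,2,1)];
  [:: (1,0,0); (0,1,0); (0,0,1); (1,1,0); (1,0,1); (2,1,0); (1,1,1); (3,1,0);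
      (2,1,1); (3,2,0); (3,1,1); (3,2,1); (4,2,1)];
  [:: (1,0,0); (0,1,0); (0,0,1); (1,1,0); (1,0,1); (2,1,0); (2,0,1); (1,1,1);
      (3,1,0); (2,1,1); (3,1,1); (4,1,1); (4,2,1)];
  [:: (1,0,0); (0,1,0); (0,0,1); (1,1,0); (1,0,1); (2,1,0); (2,0,1); (1,1,1);
      (2,1,1); (3,1,1); (2,2,1); (3,2,1); (4,2,1)];
  [:: (1,0,0); (0,1,0); (0,0,1); (1,1,0); (1,0,1); (2,1,0); (1,1,1); (1,0,2);
      (2,1,1); (1,1,2); (2,1,2); (3,1,2); (3,2,2)];
  [:: (1,0,0); (0,1,0); (0,0,1); (1,1,0); (1,0,1); (2,1,0); (2,0,1); (1,1,1);
      (3,1,0); (2,1,1); (3,1,1); (4,1,1); (3,2,1); (4,2,1)];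
  [:: (1,0,0); (0,1,0); (0,0,1); (1,1,0); (1,0,1); (2,1,0); (2,0,1); (1,1,1);
      (3,1,0); (2,1,1); (3,1,1); (4,1,1); (3,2,1); (4,2,1); (5,2,1)];
  [:: (1,0,0); (0,1,0); (0,0,1); (1,1,0); (1,0,1); (2,1,0); (2,0,1); (1,1,1);
      (3,1,0); (2,1,1); (3,2,0); (3,1,1); (4,1,1); (3,2,1); (4,2,1); (5,2,1)];
  [:: (1,0,0); (0,1,0); (0,0,1); (1,1,0); (0,1,1); (2,1,0); (1,1,1); (3,1,0);
      (2,1,1); (1,2,1); (3,1,1); (2,2,1); (3,2,1); (4,2,1); (4,3,1); (4,3,2)];
  [:: (1,0,0); (0,1,0); (0,0,1); (1,1,0); (1,0,1); (2,1,0); (2,0,1); (1,1,1);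
      (3,1,0); (2,1,1); (4,1,0); (3,1,1); (4,1,1); (5,1,1); (4,2,1); (5,2,1);
      (6,2,1)];
  [:: (1,0,0); (0,1,0); (0,0,1); (1,1,0); (1,0,1); (2,1,0); (2,0,1); (1,1,1);
      (3,1,0); (2,1,1); (3,2,0); (3,1,1); (4,1,1); (3,2,1); (4,2,1); (5,2,1);
      (5,2,2)];
  [:: (1,0,0); (0,1,0); (0,0,1); (1,1,0); (1,0,1); (2,1,0); (1,1,1); (3,1,0);
      (2,1,1); (3,1,1); (2,2,1); (3,2,1); (4,2,1); (5,2,1); (5,3,1); (5,3,2);
      (6,3,2)];
  [:: (1,0,0); (0,1,0); (0,0,1); (1,1,0); (1,0,1); (2,1,0); (2,0,1); (1,1,1);
      (3,1,0); (2,1,1); (3,2,0); (3,1,1); (4,1,1); (3,2,1); (4,2,1); (5,2,1);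
      (5,3,1); (6,3,1)];
  [:: (1,0,0); (0,1,0); (0,0,1); (1,1,0); (1,0,1); (0,1,1); (2,1,0); (1,1,1);
      (3,1,0); (2,1,1); (1,2,1); (3,1,1); (2,2,1); (3,2,1); (4,2,1); (3,3,1);
      (4,3,1); (4,3,2)];
  [:: (1,0,0); (0,1,0); (0,0,1); (1,1,0); (1,0,1); (2,1,0); (1,1,1); (3,1,0);
      (2,1,1); (4,1,0); (3,1,1); (4,1,1); (3,2,1); (4,2,1); (5,2,1); (6,2,1);
      (6,3,1); (7,3,1); (7,3,2)];
  [:: (1,0,0); (0,1,0); (0,0,1); (1,1,0); (0,1,1); (2,1,0); (1,1,1); (3,1,0);
      (2,1,1); (4,1,0); (3,1,1); (2,2,1); (4,1,1); (3,2,1); (4,2,1); (5,2,1);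
      (6,2,1); (6,3,1); (6,3,2)];
  [:: (1,0,0); (0,1,0); (0,0,1); (1,1,0); (1,0,1); (0,1,1); (2,1,0); (1,2,0);
      (1,1,1); (3,1,0); (2,1,1); (1,2,1); (3,1,1); (2,2,1); (3,2,1); (4,2,1);
      (3,3,1); (4,3,1); (4,3,2)];
  [:: (1,0,0); (0,1,0); (0,0,1); (1,1,0); (1,0,1); (0,1,1); (2,1,0); (1,1,1);
      (3,1,0); (2,1,1); (1,2,1); (3,2,0); (3,1,1); (2,2,1); (3,2,1); (4,2,1);
      (3,3,1); (4,3,1); (4,3,2)];
  [:: (1,0,0); (0,1,0); (0,0,1); (1,1,0); (0,1,1); (2,1,0); (1,1,1); (3,1,0);
      (2,1,1); (3,2,0); (3,1,1); (2,2,1); (3,2,1); (4,2,1); (3,3,1); (4,3,1);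
      (5,3,1); (6,3,1); (6,4,1)];
  [:: (1,0,0); (0,1,0); (0,0,1); (1,1,0); (1,0,1); (2,1,0); (1,1,1); (3,1,0);
      (2,1,1); (4,1,0); (3,2,0); (3,1,1); (4,1,1); (3,2,1); (5,2,0); (4,2,1);
      (5,2,1); (6,2,1); (6,3,1); (7,3,1)];
  [:: (1,0,0); (0,1,0); (0,0,1); (1,1,0); (1,0,1); (2,1,0); (1,1,1); (3,1,0);
      (2,1,1); (4,1,0); (3,2,0); (3,1,1); (4,1,1); (3,2,1); (4,2,1); (5,2,1);
      (6,2,1); (6,3,1); (7,3,1); (7,3,2)];
  [:: (1,0,0); (0,1,0); (0,0,1); (1,1,0); (1,0,1); (2,1,0); (2,0,1); (1,1,1);
      (3,1,0); (2,1,1); (3,2,0); (3,1,1); (2,2,1); (4,1,1); (3,2,1); (4,2,1);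
      (5,2,1); (4,3,1); (5,3,1); (6,3,2)];
  [:: (1,0,0); (0,1,0); (0,0,1); (1,1,0); (1,0,1); (2,1,0); (1,1,1); (3,1,0);
      (2,1,1); (4,1,0); (3,2,0); (3,1,1); (4,1,1); (3,2,1); (5,2,0); (4,2,1);
      (5,2,1); (6,2,1); (6,3,1); (7,3,1); (7,3,2)];
  [:: (1,0,0); (0,1,0); (0,0,1); (1,1,0); (1,0,1); (2,1,0); (2,0,1); (1,1,1);
      (3,1,0); (2,1,1); (3,2,0); (3,1,1); (2,2,1); (4,1,1); (3,2,1); (4,2,1);
      (5,2,1); (4,3,1); (5,3,1); (6,3,1); (6,3,2)];
  [:: (1,0,0); (0,1,0); (0,0,1); (1,1,0); (1,0,1); (2,1,0); (2,0,1); (1,1,1);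
      (3,1,0); (2,1,1); (3,2,0); (3,1,1); (4,1,1); (3,2,1); (4,2,1); (5,2,1);
      (5,3,1); (5,2,2); (6,3,1); (6,3,2); (7,3,2)];
  [:: (1,0,0); (0,1,0); (0,0,1); (1,1,0); (1,0,1); (2,1,0); (2,0,1); (1,1,1);
      (3,1,0); (2,1,1); (3,2,0); (3,1,1); (2,2,1); (4,1,1); (3,2,1); (4,2,1);
      (5,2,1); (4,3,1); (5,3,1); (5,2,2); (5,3,2); (6,3,2)];
  [:: (1,0,0); (0,1,0); (0,0,1); (1,1,0); (1,0,1); (2,1,0); (2,0,1); (1,1,1);
      (3,1,0); (2,1,1); (4,1,0); (3,2,0); (3,1,1); (4,1,1); (3,2,1); (5,2,0);
      (5,1,1); (4,2,1); (5,2,1); (6,2,1); (7,2,1); (6,3,1); (7,3,1); (8,3,1);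
      (8,3,2)];
  [:: (1,0,0); (0,1,0); (0,0,1); (1,1,0); (1,0,1); (2,1,0); (2,0,1); (1,1,1);
      (3,1,0); (2,1,1); (4,1,0); (3,1,1); (4,1,1); (3,2,1); (5,1,1); (4,2,1);
      (5,2,1); (6,2,1); (7,2,1); (6,3,1); (7,3,1); (8,3,1); (7,3,2); (8,3,2);
      (9,3,2)];
  [:: (1,0,0); (0,1,0); (0,0,1); (1,1,0); (1,0,1); (2,1,0); (2,0,1); (1,2,0);
      (1,1,1); (3,1,0); (2,1,1); (1,2,1); (3,1,1); (2,2,1); (4,1,1); (3,2,1);
      (4,2,1); (3,3,1); (3,2,2); (4,3,1); (5,3,1); (4,3,2); (5,3,2); (6,3,2);
      (7,4,2)];
  [:: (1,0,0); (0,1,0); (0,0,1); (1,1,0); (1,0,1); (2,1,0); (2,0,1); (1,1,1);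
      (3,1,0); (2,1,1); (3,2,0); (3,1,1); (2,2,1); (4,1,1); (3,2,1); (4,2,1);
      (5,2,1); (4,3,1); (5,3,1); (5,2,2); (6,3,1); (5,3,2); (6,3,2); (7,3,2);
      (7,4,2)];
  [:: (1,0,0); (0,1,0); (0,0,1); (1,1,0); (1,0,1); (2,1,0); (2,0,1); (1,1,1);
      (3,1,0); (2,1,1); (4,1,0); (3,2,0); (3,1,1); (4,1,1); (3,2,1); (5,2,0);
      (5,1,1); (4,2,1); (5,2,1); (6,2,1); (7,2,1); (6,3,1); (7,3,1); (8,3,1);
      (7,3,2); (8,3,2)];
  [:: (1,0,0); (0,1,0); (0,0,1); (1,1,0); (1,0,1); (2,1,0); (2,0,1); (1,1,1);
      (3,1,0); (2,1,1); (4,1,0); (3,2,0); (3,1,1); (4,1,1); (3,2,1); (5,1,1);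
      (4,2,1); (5,2,1); (6,2,1); (7,2,1); (6,3,1); (7,3,1); (8,3,1); (7,3,2);
      (8,3,2); (9,3,2)];
  [:: (1,0,0); (0,1,0); (0,0,1); (1,1,0); (1,0,1); (2,1,0); (2,0,1); (1,1,1);
      (3,1,0); (2,1,1); (4,1,0); (3,2,0); (3,1,1); (4,1,1); (3,2,1); (5,2,0);
      (5,1,1); (4,2,1); (5,2,1); (6,2,1); (7,2,1); (6,3,1); (7,3,1); (8,3,1);
      (7,3,2); (8,3,2); (9,3,2)];
  [:: (1,0,0); (0,1,0); (0,0,1); (1,1,0); (1,0,1); (2,1,0); (2,0,1); (1,1,1);
      (3,1,0); (2,1,1); (4,1,0); (3,2,0); (3,1,1); (4,1,1); (3,2,1); (5,1,1);
      (4,2,1); (5,2,1); (6,2,1); (5,2,2); (7,2,1); (6,3,1); (7,3,1); (8,3,1);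
      (7,3,2); (8,3,2); (9,3,2)];
  [:: (1,0,0); (0,1,0); (0,0,1); (1,1,0); (1,0,1); (2,1,0); (2,0,1); (1,1,1);
      (3,1,0); (2,1,1); (4,1,0); (3,2,0); (3,1,1); (4,1,1); (3,2,1); (5,1,1);
      (4,2,1); (5,2,1); (6,2,1); (7,2,1); (6,3,1); (7,3,1); (7,2,2); (8,3,1);
      (7,3,2); (8,3,2); (9,3,2)];
  [:: (1,0,0); (0,1,0); (0,0,1); (1,1,0); (1,0,1); (2,1,0); (2,0,1); (1,1,1);
      (3,1,0); (2,1,1); (4,1,0); (3,2,0); (3,1,1); (4,1,1); (3,2,1); (5,2,0);
      (5,1,1); (4,2,1); (5,2,1); (6,2,1); (5,2,2); (7,2,1); (6,3,1); (7,3,1);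
      (8,3,1); (7,3,2); (8,3,2); (9,3,2)];
  [:: (1,0,0); (0,1,0); (0,0,1); (1,1,0); (1,0,1); (2,1,0); (2,0,1); (1,1,1);
      (3,1,0); (2,1,1); (4,1,0); (3,2,0); (3,1,1); (4,1,1); (3,2,1); (5,1,1);
      (4,2,1); (5,2,1); (6,2,1); (5,2,2); (7,2,1); (6,3,1); (7,3,1); (8,3,1);
      (7,3,2); (8,3,2); (9,3,2); (9,4,2)];
  [:: (1,0,0); (0,1,0); (0,0,1); (1,1,0); (1,0,1); (2,1,0); (2,0,1); (1,1,1);
      (3,1,0); (2,1,1); (4,1,0); (3,2,0); (3,1,1); (4,1,1); (3,2,1); (5,1,1);
      (4,2,1); (5,2,1); (6,2,1); (5,2,2); (7,2,1); (6,3,1); (7,3,1); (8,3,1);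
      (7,3,2); (8,3,2); (9,3,2); (11,4,2)];
  [:: (1,0,0); (0,1,0); (0,0,1); (1,1,0); (1,0,1); (2,1,0); (2,0,1); (1,1,1);
      (3,1,0); (2,1,1); (4,1,0); (3,2,0); (3,1,1); (4,1,1); (3,2,1); (5,2,0);
      (5,1,1); (4,2,1); (5,2,1); (6,2,1); (5,2,2); (7,2,1); (6,3,1); (7,3,1);
      (7,2,2); (8,3,1); (7,3,2); (8,3,2); (9,3,2)];
  [:: (1,0,0); (0,1,0); (0,0,1); (1,1,0); (1,0,1); (2,1,0); (2,0,1); (1,1,1);
      (3,1,0); (2,1,1); (4,1,0); (3,2,0); (3,1,1); (4,1,1); (3,2,1); (5,2,0);
      (5,1,1); (4,2,1); (5,2,1); (6,2,1); (5,2,2); (7,2,1); (6,3,1); (7,3,1);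
      (8,3,1); (7,3,2); (8,3,2); (9,3,2); (9,4,2)];
  [:: (1,0,0); (0,1,0); (0,0,1); (1,1,0); (1,0,1); (2,1,0); (2,0,1); (1,1,1);
      (3,1,0); (2,1,1); (4,1,0); (3,2,0); (3,1,1); (4,1,1); (3,2,1); (5,2,0);
      (5,1,1); (4,2,1); (5,2,1); (6,2,1); (5,2,2); (7,2,1); (6,3,1); (7,3,1);
      (8,3,1); (7,3,2); (8,3,2); (9,3,2); (11,4,2)];
  [:: (1,0,0); (0,1,0); (0,0,1); (1,1,0); (1,0,1); (2,1,0); (2,0,1); (1,1,1);
      (3,1,0); (2,1,1); (4,1,0); (3,2,0); (3,1,1); (4,1,1); (3,2,1); (5,2,0);
      (5,1,1); (4,2,1); (5,2,1); (6,2,1); (5,2,2); (7,2,1); (6,3,1); (7,3,1);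
      (7,2,2); (8,3,1); (7,3,2); (8,3,2); (9,3,2); (9,4,2)];
  [:: (1,0,0); (0,1,0); (0,0,1); (1,1,0); (1,0,1); (2,1,0); (2,0,1); (1,1,1);
      (3,1,0); (2,1,1); (4,1,0); (3,1,1); (5,1,0); (4,1,1); (6,1,0); (5,1,1);
      (4,2,1); (6,1,1); (5,2,1); (7,1,1); (6,2,1); (7,2,1); (8,2,1); (9,2,1);
      (10,2,1); (9,3,1); (10,3,1); (11,3,1); (10,3,2); (11,3,2); (12,3,2)];
  [:: (1,0,0); (0,1,0); (0,0,1); (1,1,0); (1,0,1); (2,1,0); (2,0,1); (1,1,1);
      (3,1,0); (2,1,1); (4,1,0); (3,2,0); (3,1,1); (4,1,1); (3,2,1); (5,2,0);
      (5,1,1); (4,2,1); (5,2,1); (6,2,1); (5,2,2); (7,2,1); (6,3,1); (7,3,1);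
      (7,2,2); (8,3,1); (7,3,2); (8,3,2); (9,3,2); (9,4,2); (11,4,2)];
  [:: (1,0,0); (0,1,0); (0,0,1); (1,1,0); (1,0,1); (2,1,0); (2,0,1); (1,1,1);
      (3,1,0); (2,1,1); (4,1,0); (3,2,0); (3,1,1); (4,1,1); (3,2,1); (5,2,0);
      (5,1,1); (4,2,1); (5,2,1); (6,2,1); (5,3,1); (7,2,1); (6,3,1); (7,3,1);
      (8,3,1); (7,3,2); (8,4,1); (8,3,2); (9,4,1); (9,3,2); (9,4,2); (11,4,2);
      (11,5,2); (12,5,2)];
  [:: (1,0,0); (0,1,0); (0,0,1); (1,1,0); (1,0,1); (2,1,0); (2,0,1); (1,1,1);
      (3,1,0); (2,1,1); (4,1,0); (3,2,0); (3,1,1); (4,1,1); (3,2,1); (5,2,0);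
      (5,1,1); (4,2,1); (5,2,1); (6,2,1); (5,3,1); (7,2,1); (6,3,1); (7,3,1);
      (8,3,1); (7,3,2); (9,3,1); (8,4,1); (8,3,2); (9,4,1); (9,3,2); (10,4,1);
      (9,4,2); (11,4,2); (11,5,2); (12,5,2); (13,5,2)]
]%N.

Definition listed (R : set (lattice 'I_3)) : Prop :=
  exists2 l, l \in root_list & R = [set word_root t | t in [set` l]].

(* tau is an automorphism of the lattice because it is additive (that is,
   Z-linear) and bijective. *)
Definition normalizes (C : cartan_scheme 'I_3) (a : object C)
    (tau : {additive lattice 'I_3 -> lattice 'I_3}) : Prop :=
  [/\ bijective tau,
      forall i : 'I_3,
        [\/ tau (simple_root i) = alpha1, tau (simple_root i) = alpha2
          | tau (simple_root i) = alpha3] &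
      listed (tau @` positive_roots a)].

(* Main.v *)
(* At an object of a finite root system of rank three the real roots and the bases
   obtained from the simple roots along the groupoid form an arrangement in Z^3:
   each basis is unimodular, every root has coordinates of constant sign in it, and
   crossing a wall a replaces b by b + m a, where m is the length of the a-string
   through b.

   Classification.  Look at a basis where a Cartan entry - q is extremal, and let
   - n be the other entry of that row, chosen as small as possible in absolute value.
   From q >= 4 on, some (k, 2, 1) with k <= 4 is a root at the basis and also at its
   neighbour; these two roots lie on one line, whose length bounds q by 8.  For the
   remaining pairs (q, n) one reconstructs the roots by a search: reflect a known
   chamber once the ends of its strings are settled, otherwise split on whether the
   next vector of a string is a root.  A root set is closed under the Hirzebruch-Jung
   points of any two roots, which together with the sign condition kills the bad
   branches; a branch is complete when no sum or difference of two roots spanning a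
   primitive plane lattice is left undecided.  The search trees are recorded as
   certificates that are checked by computation.

   The root lists.  The chambers of each of the 55 lists are enumerated level by
   level, every level being obtained by crossing walls from their positive side.
   At each chamber no other list of the same length is visible in any order of the
   simple roots, which gives the uniqueness in part one.  If two walls of a chamber
   are negative, the two descending walks around their intersection have as many
   steps as there are positive roots in the plane and end in the same chamber.  This
   is axiom (R4) for the scheme whose objects are the chambers; and in any other
   connected simply connected scheme with these roots it shows, by induction on the
   level, that the object attached to a chamber does not depend on the gallery. *)
From Stdlib Require Import String Ascii ZArith List Bool Lia Classical.
Import ListNotations.
Local Open Scope Z_scope.

(** * The certificate checker *)

(** An arrangement forgets the objects and keeps the bases seen from one of them. This makes
    everything invariant under change of basis: a chamber with an extremal entry can be taken as the
    standard one, and extremality then bounds all strings during the search. Finiteness gives no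
    explicit bound on the entries in advance, so q has to be bounded before a finite search over the
    pairs (q, n) makes sense; the case q >= 4 gets a search of its own, which assumes no bound and
    can be used on both sides of the wall. The certificates carry no logical weight: a token only
    selects the next inference, which the checker performs itself, and soundness holds for every
    list of tokens. For a root list the chambers serve as objects. A morphism is then the change of
    basis between two chambers, hence trivial from a chamber to itself, and (R4) becomes a statement
    about closed walks around a plane. The passage between galleries by moves in rank two planes is
    the argument known from Coxeter groups, where the level plays the part of the length of a
    reduced word. *)

Definition vec := (Z * Z * Z)%type.
Definition vadd (u v : vec) : vec :=
  let '(a, b, c) := u in let '(d, e, f) := v in (a + d, b + e, c + f).
Definition vopp (u : vec) : vec := let '(a, b, c) := u in (- a, - b, - c).
Definition vsub (u v : vec) : vec := vadd u (vopp v).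
Definition vscal (k : Z) (u : vec) : vec :=
  let '(a, b, c) := u in (k * a, k * b, k * c).
Definition dot (u v : vec) : Z :=
  let '(a, b, c) := u in let '(d, e, f) := v in a * d + b * e + c * f.
Definition cross (u v : vec) : vec :=
  let '(a, b, c) := u in let '(d, e, f) := v in
  (b * f - c * e, c * d - a * f, a * e - b * d).
Definition veq (u v : vec) : bool :=
  let '(a, b, c) := u in let '(d, e, f) := v in (a =? d) && (b =? e) && (c =? f).
Definition nneg (u : vec) : bool :=
  let '(a, b, c) := u in (0 <=? a) && (0 <=? b) && (0 <=? c).
(** For coordinates of constant sign this picks one vector of the pair u, - u. On mixed signs it
    merely returns the opposite; soundness of the search uses no more than that the result is u or -
    u. *)
Definition canon (u : vec) : vec := if nneg u then u else vopp u.
(** On [cross u v] this is the index of the lattice spanned by u and v in the lattice of their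
    plane, and 0 if u and v are dependent. *)
Definition content (u : vec) : Z := let '(a, b, c) := u in Z.gcd a (Z.gcd b c).

Definition basis := (vec * vec * vec)%type.
Definition det (B : basis) : Z := let '(a, b, c) := B in dot (cross a b) c.
(** The inverse matrix by cofactors. Multiplying by the determinant replaces the division, which is
    correct because it is only applied to determinants 1 and -1. *)
Definition dual_basis (B : basis) : basis :=
  let '(a, b, c) := B in
  let e := det B in
  (vscal e (cross b c), vscal e (cross c a), vscal e (cross a b)).
Definition coords (D : basis) (v : vec) : vec :=
  let '(x, y, z) := D in (dot x v, dot y v, dot z v).
Definition coherent (D : basis) (v : vec) : bool :=
  let c := coords D v in nneg c || nneg (vopp c).

Definition vmem (v : vec) (T : list vec) : bool := existsb (veq v) T.
(* Lists of roots contain one root of each pair v, - v. *)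
Definition rmem (v : vec) (T : list vec) : bool := vmem (canon v) T.

(* A chamber is stored with its dual basis. *)
Record state := State {
  roots : list vec; nonroots : list vec; chambers : list (basis * basis) }.

(* The first Hirzebruch-Jung point g = (k u + v) / d of the cone of u and v, where d
   is the index of the lattice spanned by u and v in its plane, and u - g. *)
Definition hj (u v : vec) (d : Z) : list vec :=
  let fix go (n : nat) (k : Z) : list vec :=
    match n with
    | O => []
    | S n =>
      let '(x, y, z) := vadd (vscal k u) v in
      if (x mod d =? 0) && (y mod d =? 0) && (z mod d =? 0)
      then let g := (x / d, y / d, z / d) in [g; vsub u g]
      else go n (k + 1)
    end in
  (* For primitive u and v exactly one k between 1 and d - 1 passes the divisibility test. *)
  go (Z.to_nat (d - 1)) 1.

Fixpoint hjs (v : vec) (T : list vec) : list vec :=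
  match T with
  | [] => []
  | u :: T =>
    let d := content (cross u v) in
    if d <=? 1 then hjs v T else hj u v d ++ hj v u d ++ hjs v T
  end.

Definition excluded (st : state) (v : vec) : bool :=
  rmem v (nonroots st) || existsb (fun c => negb (coherent (snd c) v)) (chambers st).

(* The result None means that the given vectors cannot all be roots. *)
Fixpoint addroots (n : nat) (todo : list vec) (st : state) : option state :=
  match n with
  (* Running out of fuel only loses consequences; the state reached so far is still sound. *)
  | O => Some st
  | S n =>
    match todo with
    | [] => Some st
    | v :: todo =>
      if rmem v (roots st) then addroots n todo st else
      if negb (content v =? 1) || excluded st v then None else
      addroots n (hjs (canon v) (roots st) ++ todo)
        (State (canon v :: roots st) (nonroots st) (chambers st))
    end
  end.

Definition rotate (i : nat) (B : basis) : basis :=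
  let '(a, b, c) := B in
  match i with O => (a, b, c) | 1%nat => (b, c, a) | _ => (c, a, b) end.
Definition unrotate (i : nat) (B : basis) : basis :=
  let '(a, b, c) := B in
  match i with O => (a, b, c) | 1%nat => (c, a, b) | _ => (b, c, a) end.

Fixpoint climb (n : nat) (T : list vec) (a b : vec) : Z * vec :=
  match n with
  | O => (0, b)
  | S n => let y := vadd b a in
      if rmem y T then let '(k, r) := climb n T a y in (k + 1, r) else (0, b)
  end.

Definition idx (p : positive) : nat := Nat.pred (Pos.to_nat p).

Inductive outcome := Contradiction | Stuck | Next (st : state).

Section Run.
(* Some (q, n): every Cartan entry is at least - q, and the other entry of a row
   containing - q is at most - n. *)
Variable bound : option (Z * Z).
Variable targets : list (list vec).

(** The end of a string is settled if it has the maximal length q or if its next vector y is no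
    root: strings have no gaps, so one missing vector ends them. *)
Definition exact (st : state) (k : Z) (y : vec) : bool :=
  match bound with Some (q, _) => q <=? k | None => false end || excluded st y.

(** Two zeros would split the wall off from the other simple roots, against irreducibility. The
    remaining cases contradict the extremal choice of (q, n0), read in either order of the two
    entries. *)
Definition bad_row (m n : Z) : bool :=
  ((m =? 0) && (n =? 0)) ||
  match bound with
  | Some (q, n0) => (q <? m) || (q <? n) || ((m =? q) && (n <? n0)) || ((n =? q) && (m <? n0))
  | None => false
  end.

Definition cross_wall (st : state) (i ci : nat) : outcome :=
  match nth_error (chambers st) ci with
  | None => Stuck
  | Some (B, _) =>
    let '(a, b, c) := rotate i B in
    let '(m, b') := climb 20 (roots st) a b in
    let '(n, c') := climb 20 (roots st) a c in
    if exact st m (vadd b' a) && exact st n (vadd c' a) then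
      if bad_row m n then Contradiction else
      let B' := unrotate i (vopp a, b', c') in
      let D := dual_basis B' in
      if forallb (coherent D) (roots st)
      then Next (State (roots st) (nonroots st) ((B', D) :: chambers st))
      else Contradiction
    else Stuck
  end.

Definition branch_vec (st : state) (i j ci : nat) : option vec :=
  match nth_error (chambers st) ci with
  | None => None
  | Some (B, _) =>
    let '(a, _, _) := rotate i B in
    let '(b, _, _) := rotate j B in
    let '(_, b') := climb 20 (roots st) a b in Some (vadd b' a)
  end.

(** A violation of [string_bound]: two roots at distance q + 1 on a line in direction u. The sign s
    is needed because only one root of each pair is stored. *)
Definition long_string (st : state) (s : Z) (ui vi : nat) : bool :=
  match bound, nth_error (roots st) ui, nth_error (roots st) vi with
  | Some (q, _), Some u, Some v =>
      (content (cross u v) =? 1) && rmem (vadd v (vscal (s * (q + 1)) u)) (roots st)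
  | _, _, _ => false
  end.

(* If this holds then the known roots are all the roots. *)
Fixpoint gaps_excluded (st : state) (T : list vec) : bool :=
  match T with
  | [] => true
  | u :: T =>
    forallb (fun w =>
      if content (cross u w) =? 1 then
        (rmem (vadd u w) (roots st) || excluded st (vadd u w)) &&
        (rmem (vsub u w) (roots st) || excluded st (vsub u w))
      else true) T && gaps_excluded st T
  end.

Definition leaf (st : state) (ci : nat) (li p : nat) : bool :=
  match nth_error (chambers st) ci, nth_error targets li with
  | Some (B, _), Some l =>
    let '(a, b, c) := rotate (if Nat.ltb p 3 then p else p - 3) B in
    let B := if Nat.ltb p 3 then (a, b, c) else (b, a, c) in
    let D := dual_basis B in
    let T := map (fun v => canon (coords D v)) (roots st) in
    (* The completeness argument starts at the standard chamber, so its walls must be known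
       roots. *)
    rmem (1, 0, 0) (roots st) && rmem (0, 1, 0) (roots st) && rmem (0, 0, 1) (roots st) &&
    forallb (fun v => vmem v l) T && forallb (fun v => vmem v T) l &&
    gaps_excluded st (roots st)
  | _, _ => false
  end.

(** Tokens are read in prefix order. Each inference returns the tokens left over by its subtree, and
    a branch hands them to its second subtree; a contradiction found while carrying out an inference
    consumes no further token. *)
Definition refl_step (k : state -> list positive -> option (list positive))
    (st : state) (ts : list positive) (i ci : nat) : option (list positive) :=
  match cross_wall st i ci with
  | Contradiction => Some ts
  | Stuck => None
  | Next st => k st ts
  end.

Definition branch_step (k : state -> list positive -> option (list positive))
    (st : state) (ts : list positive) (i j ci : nat) : option (list positive) :=
  match branch_vec st i j ci with
  | None => None
  | Some y =>
    match
      match addroots 1000 [y] st with None => Some ts | Some st => k st ts end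
    with
    | None => None
    | Some ts => k (State (roots st) (canon y :: nonroots st) (chambers st)) ts
    end
  end.

Definition string_step (st : state) (ts : list positive) (s : Z) (ui : nat)
    : option (list positive) :=
  match ts with
  | p :: ts => if long_string st s ui (idx p) then Some ts else None
  | [] => None
  end.

Definition leaf_step (st : state) (ts : list positive) (ci : nat)
    : option (list positive) :=
  match ts with
  | li :: p :: ts => if leaf st ci (idx li) (idx p) then Some ts else None
  | _ => None
  end.

(* The four low bits of a token select the inference, the other ones its argument. *)
Fixpoint run (fuel : nat) (st : state) (ts : list positive) : option (list positive) :=
  match fuel, ts with
  | S fuel, t :: ts =>
    match t with
    | (p~0~0~0~0)%positive => refl_step (run fuel) st ts 0 (idx p)
    | (p~0~0~0~1)%positive => refl_step (run fuel) st ts 1 (idx p)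
    | (p~0~0~1~0)%positive => refl_step (run fuel) st ts 2 (idx p)
    | (p~0~0~1~1)%positive => branch_step (run fuel) st ts 0 1 (idx p)
    | (p~0~1~0~0)%positive => branch_step (run fuel) st ts 0 2 (idx p)
    | (p~0~1~0~1)%positive => branch_step (run fuel) st ts 1 0 (idx p)
    | (p~0~1~1~0)%positive => branch_step (run fuel) st ts 1 2 (idx p)
    | (p~0~1~1~1)%positive => branch_step (run fuel) st ts 2 0 (idx p)
    | (p~1~0~0~0)%positive => branch_step (run fuel) st ts 2 1 (idx p)
    | (p~1~0~0~1)%positive => string_step st ts 1 (idx p)
    | (p~1~0~1~0)%positive => string_step st ts (-1) (idx p)
    | (p~1~0~1~1)%positive => leaf_step st ts (idx p)
    | _ => None
    end
  | _, _ => None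
  end.
End Run.

Definition e0 : vec := (1, 0, 0).
Definition e1 : vec := (0, 1, 0).
Definition e2 : vec := (0, 0, 1).
Definition std_basis : basis := (e0, e1, e2).
Definition start (n : nat) (rs ns : list vec) : option state :=
  addroots n rs (State [] ns [(std_basis, std_basis)]).
(** With an empty list of targets no leaf can close a branch, so success means a contradiction; in
    general it means that the arrangement is one of the targets. *)
Definition refuted (n : nat) bound targets rs ns ts : bool :=
  match start n rs ns with
  | None => true
  | Some st => match run bound targets n st ts with Some _ => true | None => false end
  end.
(** In the coordinates of a chamber a, b, c: the a-strings through b and c for the row - q, - n of
    a. The vector c itself is listed in front, hence [seq 1 n]. *)
Definition start_roots (q n : nat) : list vec :=
  [e0; e2] ++ map (fun k => (Z.of_nat k, 1, 0)) (seq 0 (S q)) ++ map (fun k => (Z.of_nat k, 0, 1)) (seq 1 n).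
Definition start_nonroots (q n : nat) : list vec :=
  [(Z.of_nat q + 1, 1, 0); (Z.of_nat n + 1, 0, 1)].

(** * Arrangements in rank three *)

Definition comb (B : basis) (t : vec) : vec :=
  let '(a, b, c) := B in let '(x, y, z) := t in
  vadd (vadd (vscal x a) (vscal y b)) (vscal z c).

Ltac vdestr := repeat match goal with v : vec |- _ => destruct v as [[? ?] ?] end.
Lemma vec_eq (a b c a' b' c' : Z) :
  a = a' -> b = b' -> c = c' -> (a, b, c) = (a', b', c').
Proof. now intros -> -> ->. Qed.
Ltac vcbn := cbn [vadd vopp vsub vscal dot cross comb coords dual_basis det rotate unrotate fst snd].
Ltac vring := vdestr; vcbn; first [apply vec_eq; ring | ring].

Lemma veqE u v : veq u v = true <-> u = v.
Proof.
vdestr; cbn; rewrite !andb_true_iff, !Z.eqb_eq; split.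
- now intros [[-> ->] ->].
- now injection 1.
Qed.

Definition unimodular (B : basis) := det B = 1 \/ det B = -1.

Lemma comb_coords B v : unimodular B -> comb B (coords (dual_basis B) v) = v.
Proof.
destruct B as [[a b] c]; intros H.
assert (Hc : comb (a, b, c) (coords (dual_basis (a, b, c)) v)
  = vscal (det (a, b, c) * det (a, b, c)) v) by (vring).
rewrite Hc.
destruct H as [-> | ->]; vring.
Qed.

Lemma coords_comb B t : unimodular B -> coords (dual_basis B) (comb B t) = t.
Proof.
destruct B as [[a b] c]; intros H.
assert (Hc : coords (dual_basis (a, b, c)) (comb (a, b, c) t)
  = vscal (det (a, b, c) * det (a, b, c)) t) by (vring).
rewrite Hc.
destruct H as [-> | ->]; vring.
Qed.

Lemma coherentE B v : unimodular B ->
  coherent (dual_basis B) v = true <->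
  exists x y z, v = comb B (x, y, z) /\
    (0 <= x /\ 0 <= y /\ 0 <= z \/ x <= 0 /\ y <= 0 /\ z <= 0).
Proof.
intros HB; unfold coherent.
destruct (coords (dual_basis B) v) as [[x y] z] eqn:E.
assert (Ev : v = comb B (x, y, z)) by (now rewrite <- E, comb_coords).
cbn; split.
- intros H; exists x, y, z; split; [exact Ev|].
  apply orb_true_iff in H; destruct H as [H | H]; [left | right];
  rewrite !andb_true_iff, !Z.leb_le in H; lia.
- intros (x' & y' & z' & Ev' & H).
  assert (Et : (x, y, z) = (x', y', z'))
    by (rewrite <- E, Ev'; now apply coords_comb).
  injection Et as -> -> ->.
  apply orb_true_iff; rewrite !andb_true_iff, !Z.leb_le; lia.
Qed.

(* Ch a b c: some order of the simple roots of some chamber is a, b, c. *)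
Record arrangement (Rt : vec -> Prop) (Ch : vec -> vec -> vec -> Prop) : Prop := Arr {
  ch_swap : forall a b c, Ch a b c -> Ch b a c;
  ch_rot : forall a b c, Ch a b c -> Ch b c a;
  ch_root : forall a b c, Ch a b c -> Rt a;
  ch_unimod : forall a b c, Ch a b c -> unimodular (a, b, c);
  ch_coherent : forall a b c v, Ch a b c -> Rt v -> coherent (dual_basis (a, b, c)) v = true;
  ch_refl : forall a b c, Ch a b c -> exists m n, 0 <= m /\ 0 <= n /\
    Ch (vopp a) (vadd b (vscal m a)) (vadd c (vscal n a));
  ch_fin : exists l, forall v, Rt v <-> In v l;
  ch_wall : forall v, Rt v -> exists b c, Ch v b c;
  ch_gallery : forall P : vec -> vec -> vec -> Prop,
    (forall a b c, P a b c -> P b a c) -> (forall a b c, P a b c -> P b c a) ->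
    (forall a b c m n, Ch a b c -> P a b c -> 0 <= m -> 0 <= n ->
       Ch (vopp a) (vadd b (vscal m a)) (vadd c (vscal n a)) ->
       P (vopp a) (vadd b (vscal m a)) (vadd c (vscal n a))) ->
    forall a b c, Ch a b c -> P a b c -> forall a' b' c', Ch a' b' c' -> P a' b' c';
  ch_nonempty : exists a b c, Ch a b c }.

Section Arrangement.
Variables (Rt : vec -> Prop) (Ch : vec -> vec -> vec -> Prop).
Hypothesis arr : arrangement Rt Ch.

Lemma coh_comb a b c v : Ch a b c -> Rt v ->
  exists x y z, v = comb (a, b, c) (x, y, z) /\
    (0 <= x /\ 0 <= y /\ 0 <= z \/ x <= 0 /\ y <= 0 /\ z <= 0).
Proof.
intros HC Hv; apply coherentE; [exact (ch_unimod _ _ arr _ _ _ HC)|].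
exact (ch_coherent _ _ arr _ _ _ _ HC Hv).
Qed.

Lemma comb_inj B t t' : unimodular B -> comb B t = comb B t' -> t = t'.
Proof.
intros HB E; rewrite <- (coords_comb B t HB), E; now apply coords_comb.
Qed.

(** A root is a wall of some chamber, and the chamber across that wall contains its opposite. *)
Lemma Rt_opp v : Rt v -> Rt (vopp v).
Proof.
intros Hv; destruct (ch_wall _ _ arr v Hv) as (b & c & H).
destruct (ch_refl _ _ arr _ _ _ H) as (m & n & _ & _ & H').
exact (ch_root _ _ arr _ _ _ H').
Qed.

(* Coherence of [b + k a] in the chamber across the wall [a] bounds [k]. *)
Lemma string_le a b c m n k : Ch a b c ->
  Ch (vopp a) (vadd b (vscal m a)) (vadd c (vscal n a)) ->
  Rt (vadd b (vscal k a)) -> 0 <= k <= m.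
Proof.
intros H H' Hk; split.
- destruct (coh_comb _ _ _ _ H Hk) as (x & y & z & E & Hs).
  assert (Et : (k, 1, 0) = (x, y, z)).
  { apply (comb_inj (a, b, c)); [exact (ch_unimod _ _ arr _ _ _ H)|].
    rewrite <- E; vring. }
  injection Et as <- <- <-; lia.
- destruct (coh_comb _ _ _ _ H' Hk) as (x & y & z & E & Hs).
  assert (Et : (m - k, 1, 0) = (x, y, z)).
  { apply (comb_inj _ _ _ (ch_unimod _ _ arr _ _ _ H')).
    rewrite <- E; vring. }
  injection Et as <- <- <-; lia.
Qed.

Lemma filter_length_lt (A : Type) (f g : A -> bool) (l : list A) (x : A) :
  (forall y, In y l -> f y = true -> g y = true) ->
  In x l -> g x = true -> f x = false ->
  (length (filter f l) < length (filter g l))%nat.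
Proof.
assert (Hle : forall l, (forall y, In y l -> f y = true -> g y = true) ->
  (length (filter f l) <= length (filter g l))%nat).
{ clear; induction l as [|y l IH]; cbn; [lia|]; intros H.
  pose proof (IH (fun z Hz => H z (or_intror Hz))).
  pose proof (H y (or_introl eq_refl)).
  destruct (f y), (g y); cbn; try lia; discriminate (H1 eq_refl). }
induction l as [|y l IH]; cbn; [tauto|]; intros H [<-|Hx] Hg Hf.
- rewrite Hg, Hf; cbn; pose proof (Hle l (fun z Hz => H z (or_intror Hz))); lia.
- pose proof (IH (fun z Hz => H z (or_intror Hz)) Hx Hg Hf).
  pose proof (H y (or_introl eq_refl)).
  destruct (f y), (g y); cbn; try lia; discriminate (H1 eq_refl).
Qed.

(* Crossing a wall on which h is negative lowers the number of positive roots
   on which h is negative. *)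
Lemma dominant_chamber (h : vec) :
  exists a b c, Ch a b c /\ 0 <= dot h a /\ 0 <= dot h b /\ 0 <= dot h c.
Proof.
destruct (ch_fin _ _ arr) as [l Hl].
(* By coherence a root is positive at B exactly when the sum of its coordinates is positive. *)
pose (neg B v := let '(x, y, z) := coords (dual_basis B) v in
  (0 <? x + y + z) && (dot h v <? 0)).
assert (Hcross : forall a b c, Ch a b c -> dot h a < 0 -> exists a' b' c',
  Ch a' b' c' /\
  (length (filter (neg (a', b', c')) l) < length (filter (neg (a, b, c)) l))%nat).
{ intros a b c H Ha.
  destruct (ch_refl _ _ arr _ _ _ H) as (m & n & Hm & Hn & H').
  pose proof (ch_unimod _ _ arr _ _ _ H) as HB.
  pose proof (ch_unimod _ _ arr _ _ _ H') as HB'.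
  eexists _, _, _; split; [exact H'|].
  apply filter_length_lt with (x := a).
  - intros v Hv; apply Hl in Hv; unfold neg.
    destruct (coh_comb _ _ _ _ H Hv) as (x & y & z & E & Hs).
    destruct (coh_comb _ _ _ _ H' Hv) as (x' & y' & z' & E' & Hs').
    assert (Et : (m * y + n * z - x, y, z) = (x', y', z')).
    { apply (comb_inj _ _ _ HB'); rewrite <- E', E; vring. }
    injection Et as <- <- <-.
    assert (E1 : coords (dual_basis (a, b, c)) v = (x, y, z))
      by (rewrite E; now apply coords_comb).
    rewrite E1, E', coords_comb by exact HB'; rewrite <- E'.
    rewrite !andb_true_iff, !Z.ltb_lt; intros [H1 H2]; split; [|exact H2].
    (* Only multiples of a change sign across the wall, and h is positive on those that become
       positive. *)
    destruct (Z.eq_dec (y + z) 0); [|lia].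
    assert (y = 0) by lia; assert (z = 0) by lia; subst y z.
    assert (Hd : dot h v = x * dot h a) by (rewrite E; vdestr; vcbn; ring).
    nia.
  - apply Hl; exact (ch_root _ _ arr _ _ _ H).
  - unfold neg.
    assert (E : coords (dual_basis (a, b, c)) a = (1, 0, 0))
      by (rewrite <- (coords_comb _ (1, 0, 0) HB); f_equal; vring).
    rewrite E.
    apply andb_true_iff; rewrite !Z.ltb_lt; lia.
  - unfold neg.
    assert (E : coords (dual_basis (vopp a, vadd b (vscal m a), vadd c (vscal n a))) a
      = (-1, 0, 0))
      by (rewrite <- (coords_comb _ (-1, 0, 0) HB'); f_equal; vring).
    rewrite E; reflexivity. }
assert (Hind : forall k a b c, Ch a b c ->
  (length (filter (neg (a, b, c)) l) < k)%nat ->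
  exists a b c, Ch a b c /\ 0 <= dot h a /\ 0 <= dot h b /\ 0 <= dot h c).
{ induction k as [|k IH]; [lia|]; intros a b c H Hk.
  assert (Hstep : forall a' b' c', Ch a' b' c' ->
    length (filter (neg (a', b', c')) l) = length (filter (neg (a, b, c)) l) ->
    dot h a' < 0 ->
    exists a b c, Ch a b c /\ 0 <= dot h a /\ 0 <= dot h b /\ 0 <= dot h c).
  { intros a' b' c' H' E Hneg.
    destruct (Hcross _ _ _ H' Hneg) as (a2 & b2 & c2 & H2 & Hlt).
    apply (IH _ _ _ H2); lia. }
  assert (Hrot : forall a' b' c', Ch a' b' c' ->
    length (filter (neg (b', c', a')) l) = length (filter (neg (a', b', c')) l)).
  { intros a' b' c' H'; f_equal; apply filter_ext; intros v; unfold neg.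
    pose proof (ch_unimod _ _ arr _ _ _ H') as HB.
    pose proof (ch_unimod _ _ arr _ _ _ (ch_rot _ _ arr _ _ _ H')) as HB'.
    destruct (coords (dual_basis (a', b', c')) v) as [[x y] z] eqn:E.
    assert (Ev : v = comb (b', c', a') (y, z, x)).
    { rewrite <- (comb_coords _ v HB), E; vring. }
    rewrite Ev at 1; rewrite coords_comb by exact HB'.
    replace (y + z + x) with (x + y + z) by ring; reflexivity. }
  pose proof (ch_rot _ _ arr _ _ _ H) as H1.
  pose proof (ch_rot _ _ arr _ _ _ H1) as H2.
  destruct (Z_lt_le_dec (dot h a) 0) as [Ha|Ha]; [now apply (Hstep a b c)|].
  destruct (Z_lt_le_dec (dot h b) 0) as [Hb|Hb].
  { apply (Hstep b c a); [exact H1 | now apply Hrot | exact Hb]. }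
  destruct (Z_lt_le_dec (dot h c) 0) as [Hc|Hc].
  { apply (Hstep c a b); [exact H2 | | exact Hc].
    rewrite Hrot by exact H1; now apply Hrot. }
  now exists a, b, c. }
destruct (ch_nonempty _ _ arr) as (a & b & c & H).
apply (Hind (S (length (filter (neg (a, b, c)) l))) a b c H); lia.
Qed.
End Arrangement.

(** * Content, primitive vectors and sums of constant sign *)

Lemma content_dvd k v w : v = vscal k w -> (k | content v).
Proof.
intros ->; vdestr; cbn [vscal content].
repeat apply Z.gcd_greatest; apply Z.divide_factor_l.
Qed.

Lemma content_vscal k v : content (vscal k v) = Z.abs k * content v.
Proof.
vdestr; cbn [vscal content].
rewrite Z.gcd_mul_mono_l, <- (Z.gcd_abs_l (k * _)), Z.abs_mul, Z.gcd_mul_mono_l.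
now rewrite Z.abs_involutive, Z.gcd_abs_l.
Qed.

Lemma content_dvd_dot v w : (content v | dot v w).
Proof.
vdestr; cbn [dot content].
pose proof (Z.gcd_divide_l z2 (Z.gcd z3 z4)); pose proof (Z.gcd_divide_r z2 (Z.gcd z3 z4)).
pose proof (Z.gcd_divide_l z3 z4); pose proof (Z.gcd_divide_r z3 z4).
repeat apply Z.divide_add_r; apply Z.divide_mul_l; eauto using Z.divide_trans.
Qed.

Lemma content_nonneg v : 0 <= content v.
Proof. vdestr; apply Z.gcd_nonneg. Qed.

Lemma content_dot0 v : dot v v = 0 -> content v = 0.
Proof.
destruct v as [[x y] z]; cbn [dot]; intros E.
assert (x = 0 /\ y = 0 /\ z = 0) as (-> & -> & ->) by nia; reflexivity.
Qed.

Lemma content_wall a b c : unimodular (a, b, c) -> content (cross a b) = 1.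
Proof.
intros H; apply Z.divide_1_r_nonneg; [apply content_nonneg|].
pose proof (content_dvd_dot (cross a b) c) as D.
destruct H as [E|E]; unfold det in E; rewrite E in D; [exact D|].
now apply Z.divide_opp_r in D.
Qed.

Lemma dot_comb h a b c x y z :
  dot h (comb (a, b, c) (x, y, z)) = x * dot h a + y * dot h b + z * dot h c.
Proof. vring. Qed.

Lemma unit_factor x r : x * r = 1 \/ x * r = -1 -> r = 1 \/ r = -1.
Proof.
intros [H|H].
- apply (Z.eq_mul_1 r x); lia.
- apply (Z.eq_mul_1 r (- x)); lia.
Qed.

Lemma same_sign_sum0 x y z A B C : 0 <= A -> 0 <= B -> 0 <= C ->
  (0 <= x /\ 0 <= y /\ 0 <= z \/ x <= 0 /\ y <= 0 /\ z <= 0) ->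
  x * A + y * B + z * C = 0 -> x * A = 0 /\ y * B = 0 /\ z * C = 0.
Proof.
intros HA HB HC [(Hx & Hy & Hz)|(Hx & Hy & Hz)] E.
- pose proof (Z.mul_nonneg_nonneg _ _ Hx HA); pose proof (Z.mul_nonneg_nonneg _ _ Hy HB).
  pose proof (Z.mul_nonneg_nonneg _ _ Hz HC); lia.
- pose proof (Z.mul_nonpos_nonneg _ _ Hx HA); pose proof (Z.mul_nonpos_nonneg _ _ Hy HB).
  pose proof (Z.mul_nonpos_nonneg _ _ Hz HC); lia.
Qed.

(** * The roots in a plane *)

Section Plane.
Variables (Rt : vec -> Prop) (Ch : vec -> vec -> vec -> Prop).
Hypothesis arr : arrangement Rt Ch.

Lemma dot_bound (w : vec) : exists N, 0 < N /\ forall v, Rt v -> - N < dot w v < N.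
Proof.
destruct (ch_fin _ _ arr) as [l Hl].
assert (H : exists N, 0 < N /\ forall v, In v l -> - N < dot w v < N).
{ clear Hl; induction l as [|v l (N & HN & IH)].
  - exists 1; split; [lia|]; intros v [].
  - exists (N + Z.abs (dot w v)); split; [lia|]; intros u [<-|Hu]; [lia|].
    pose proof (IH u Hu); lia. }
destruct H as (N & HN & H); exists N; split; [exact HN|].
intros v Hv; apply H; now apply Hl.
Qed.

(* Dominate the functional N (cross u v) + w for a large N. *)
Lemma plane_chamber (u v w : vec) :
  Rt u -> Rt v -> content (cross u v) <> 0 ->
  exists a b c, Ch a b c /\ 0 <= dot w a /\ 0 <= dot w b /\
    dot (cross u v) a = 0 /\ dot (cross u v) b = 0 /\ 0 < dot (cross u v) c.
Proof.
intros Hu Hv Hn; set (n := cross u v) in *.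
destruct (dot_bound w) as (N & HN & HR).
destruct (dominant_chamber _ _ arr (vadd (vscal N n) w)) as (a & b & c & H & Ha & Hb & Hc).
assert (Hd : forall t, dot (vadd (vscal N n) w) t = N * dot n t + dot w t)
  by (intros; clearbody n; vring).
rewrite Hd in Ha, Hb, Hc.
pose proof (ch_rot _ _ arr _ _ _ H) as H1.
pose proof (ch_rot _ _ arr _ _ _ H1) as H2.
pose proof (HR _ (ch_root _ _ arr _ _ _ H)).
pose proof (HR _ (ch_root _ _ arr _ _ _ H1)).
pose proof (HR _ (ch_root _ _ arr _ _ _ H2)).
(* Since w stays above - N and below N on roots, a negative integer value of n would make the
   functional negative. For the same reason w >= 0 wherever n vanishes. *)
assert (Na : 0 <= dot n a) by nia.
assert (Nb : 0 <= dot n b) by nia.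
assert (Nc : 0 <= dot n c) by nia.
destruct (coh_comb _ _ arr _ _ _ _ H Hu) as (x1 & y1 & z1 & Eu & Su).
destruct (coh_comb _ _ arr _ _ _ _ H Hv) as (x2 & y2 & z2 & Ev & Sv).
assert (Du : x1 * dot n a + y1 * dot n b + z1 * dot n c = 0).
{ rewrite <- dot_comb, <- Eu; unfold n; vring. }
assert (Dv : x2 * dot n a + y2 * dot n b + z2 * dot n c = 0).
{ rewrite <- dot_comb, <- Ev; unfold n; vring. }
assert (Zu : x1 * dot n a = 0 /\ y1 * dot n b = 0 /\ z1 * dot n c = 0) by now apply same_sign_sum0.
assert (Zv : x2 * dot n a = 0 /\ y2 * dot n b = 0 /\ z2 * dot n c = 0) by now apply same_sign_sum0.
assert (Hx : forall p q, u = vscal p q -> forall r, v = vscal r q -> False).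
{ intros p q Ep r Er; apply Hn; unfold n; rewrite Ep, Er.
  replace (cross (vscal p q) (vscal r q)) with (vscal 0 q) by (clear; vring).
  now rewrite content_vscal. }
assert (Hn0 : dot n n <> 0) by (intros E; apply Hn; now apply content_dot0).
assert (Wa : dot n a = 0 -> 0 <= dot w a) by (intros E; rewrite E in Ha; lia).
assert (Wb : dot n b = 0 -> 0 <= dot w b) by (intros E; rewrite E in Hb; lia).
assert (Wc : dot n c = 0 -> 0 <= dot w c) by (intros E; rewrite E in Hc; lia).
destruct Zu as (Zu1 & Zu2 & Zu3), Zv as (Zv1 & Zv2 & Zv3).
(* Exactly two of the three walls lie in the plane: three would give n = 0, and with fewer u and v
   would be multiples of one vector. *)
destruct (Z.eq_dec (dot n a) 0) as [Ea|Ea], (Z.eq_dec (dot n b) 0) as [Eb|Eb],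
  (Z.eq_dec (dot n c) 0) as [Ec|Ec].
- exfalso; apply Hn0.
  rewrite <- (comb_coords _ n (ch_unimod _ _ arr _ _ _ H)) at 2.
  destruct (coords (dual_basis (a, b, c)) n) as [[x y] z].
  rewrite dot_comb, Ea, Eb, Ec; ring.
- exists a, b, c; repeat split; auto; lia.
- exists c, a, b; repeat split; auto; lia.
- exfalso; apply (Hx x1 a) with (r := x2).
  + assert (y1 = 0) by nia; assert (z1 = 0) by nia; subst y1 z1; rewrite Eu; vring.
  + assert (y2 = 0) by nia; assert (z2 = 0) by nia; subst y2 z2; rewrite Ev; vring.
- exists b, c, a; repeat split; auto; lia.
- exfalso; apply (Hx y1 b) with (r := y2).
  + assert (x1 = 0) by nia; assert (z1 = 0) by nia; subst x1 z1; rewrite Eu; vring.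
  + assert (x2 = 0) by nia; assert (z2 = 0) by nia; subst x2 z2; rewrite Ev; vring.
- exfalso; apply (Hx z1 c) with (r := z2).
  + assert (x1 = 0) by nia; assert (y1 = 0) by nia; subst x1 y1; rewrite Eu; vring.
  + assert (x2 = 0) by nia; assert (y2 = 0) by nia; subst x2 y2; rewrite Ev; vring.
- exfalso; apply (Hx 0 c) with (r := 0).
  + assert (x1 = 0) by nia; assert (y1 = 0) by nia; assert (z1 = 0) by nia; subst; vring.
  + assert (x2 = 0) by nia; assert (y2 = 0) by nia; assert (z2 = 0) by nia; subst; vring.
Qed.

Lemma plane_coords (a b c n t : vec) : Ch a b c ->
  dot n a = 0 -> dot n b = 0 -> 0 < dot n c -> dot n t = 0 ->
  exists x y, t = comb (a, b, c) (x, y, 0).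
Proof.
intros H Ha Hb Hc Ht.
pose proof (comb_coords _ t (ch_unimod _ _ arr _ _ _ H)) as E.
destruct (coords (dual_basis (a, b, c)) t) as [[x y] z].
rewrite <- E, dot_comb, Ha, Hb in Ht.
exists x, y; assert (z = 0) by nia; subst z; now symmetry.
Qed.

Lemma plane_root (a b c n t : vec) : Ch a b c -> Rt t ->
  dot n a = 0 -> dot n b = 0 -> 0 < dot n c -> dot n t = 0 ->
  exists x y, t = comb (a, b, c) (x, y, 0) /\
    (0 <= x /\ 0 <= y \/ x <= 0 /\ y <= 0).
Proof.
intros H Rtt Ha Hb Hc Ht.
destruct (coh_comb _ _ arr _ _ _ _ H Rtt) as (x & y & z & E & S).
rewrite E, dot_comb, Ha, Hb in Ht.
exists x, y; assert (z = 0) by nia; subst z; split; [exact E | lia].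
Qed.

Lemma cross_comb a b c x y x' y' :
  cross (comb (a, b, c) (x, y, 0)) (comb (a, b, c) (x', y', 0))
  = vscal (x * y' - y * x') (cross a b).
Proof. vring. Qed.

Lemma comb_plane_inj a b c x y x' y' : Ch a b c ->
  comb (a, b, c) (x, y, 0) = comb (a, b, c) (x', y', 0) -> x = x' /\ y = y'.
Proof.
intros H E; apply comb_inj in E; [|exact (ch_unimod _ _ arr _ _ _ H)].
injection E; auto.
Qed.

(* The roots of the plane of u and v subdivide the cone of u and v into
   unimodular cones, and g is the lattice point next to u on the boundary of the
   convex hull of the nonzero lattice points of that cone, so it belongs to every
   such subdivision. *)
Lemma hull_point (u v g : vec) (d k : Z) :
  Rt u -> Rt v -> content (cross u v) = d -> 0 < k < d ->
  vscal d g = vadd (vscal k u) v -> Rt g.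
Proof.
intros Hu Hv Hd Hk Hg.
set (n := cross u v) in *.
(* [cross n g] is a multiple of g turned by a right angle in the plane, so a and b come to lie on
   one closed side of the line of g. *)
destruct (plane_chamber u v (cross n g) Hu Hv) as (a & b & c & H & Wa & Wb & Na & Nb & Nc);
  [fold n; lia|]; fold n in Na, Nb, Nc.
assert (Nu : dot n u = 0) by (unfold n; vring).
assert (Nv : dot n v = 0) by (unfold n; vring).
assert (Ng : dot n g = 0).
{ assert (E : d * dot n g = dot n (vscal d g)) by (clearbody n; vring).
  rewrite Hg in E.
  assert (E' : dot n (vadd (vscal k u) v) = k * dot n u + dot n v) by (clearbody n; vring).
  nia. }
destruct (plane_root _ _ _ _ _ H Hu Na Nb Nc Nu) as (x1 & y1 & Eu & Su).
destruct (plane_root _ _ _ _ _ H Hv Na Nb Nc Nv) as (x2 & y2 & Ev & Sv).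
destruct (plane_coords _ _ _ _ _ H Na Nb Nc Ng) as (p & r & Eg).
assert (Ex : d * p = k * x1 + x2 /\ d * r = k * y1 + y2).
{ apply (comb_plane_inj a b c _ _ _ _ H).
  transitivity (vscal d g); [rewrite Eg; vring|].
  rewrite Hg, Eu, Ev; vring. }
destruct Ex as (Ex & Ey).
(* D is the determinant of u and g in the basis a, b. As d g - v is a multiple of u and u, v have
   index d, the vectors u and g span the plane lattice, which makes D a unit. *)
set (D := x1 * r - y1 * p).
assert (En : n = vscal (d * D) (cross a b)).
{ unfold n; rewrite Eu, Ev, cross_comb; f_equal; unfold D; nia. }
assert (HD : D = 1 \/ D = -1).
{ pose proof (content_dvd _ _ _ En) as [q Hq]; rewrite Hd in Hq.
  assert (q * D = 1) by nia.
  destruct (Z.eq_mul_1 D q); [lia|auto|auto]. }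
set (A := dot n (cross a b)).
assert (HA : 0 < d * D * A).
{ assert (E : d * D * A = dot n n)
    by (rewrite En at 2; unfold A; clearbody n; vring).
  assert (0 <= dot n n) by (clearbody n; clear; vdestr; cbn [dot]; nia).
  assert (dot n n <> 0).
  { intros E0; apply content_dot0 in E0; lia. }
  lia. }
assert (Wa' : - r * A >= 0).
{ assert (E : dot (cross n g) a = - r * A).
  { rewrite Eg; unfold A; clearbody n; vring. }
  lia. }
assert (Wb' : p * A >= 0).
{ assert (E : dot (cross n g) b = p * A).
  { rewrite Eg; unfold A; clearbody n; vring. }
  lia. }
assert (Ra := ch_root _ _ arr _ _ _ H).
assert (Rb := ch_root _ _ arr _ _ _ (ch_rot _ _ arr _ _ _ H)).
assert (Hga : p = 1 -> r = 0 -> Rt g).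
{ intros -> ->; replace g with a; [exact Ra|]; rewrite Eg; vring. }
assert (Hgb : p = 0 -> r = 1 -> Rt g).
{ intros -> ->; replace g with b; [exact Rb|]; rewrite Eg; vring. }
assert (Hga' : p = -1 -> r = 0 -> Rt g).
{ intros -> ->; replace g with (vopp a); [now apply (Rt_opp _ _ arr)|]; rewrite Eg; vring. }
assert (Hgb' : p = 0 -> r = -1 -> Rt g).
{ intros -> ->; replace g with (vopp b); [now apply (Rt_opp _ _ arr)|]; rewrite Eg; vring. }
destruct (Z.eq_dec p 0) as [Hp|Hp].
{ subst p; unfold D in HD.
  assert (r = 1 \/ r = -1) as [Hr|Hr] by (apply (unit_factor x1); lia); auto. }
destruct (Z.eq_dec r 0) as [Hr|Hr].
{ subst r; unfold D in HD.
  assert (p = 1 \/ p = -1) as [Hp'|Hp'] by (apply (unit_factor y1); lia); auto. }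
(* Now p and r have strictly opposite signs, while x1 and y1 do not. A determinant 1 or -1 then
   forces u = - a or u = - b, and k < d gives v = d g - k u coordinates of mixed sign. *)
exfalso.
assert (Hs : D = 1 /\ 0 < A \/ D = -1 /\ A < 0) by nia.
destruct Hs as [[HD1 HA1]|[HD1 HA1]]; unfold D in HD1; clearbody A D n.
- assert (0 < p) by nia; assert (r < 0) by nia.
  assert (x1 <= 0 /\ y1 <= 0) by nia.
  assert (Hc : x1 = -1 /\ y1 = 0 /\ r = -1 \/ x1 = 0 /\ y1 = -1 /\ p = 1) by nia.
  destruct Hc as [(-> & -> & ->)|(-> & -> & ->)]; nia.
- assert (p < 0) by nia; assert (0 < r) by nia.
  assert (x1 <= 0 /\ y1 <= 0) by nia.
  assert (Hc : x1 = -1 /\ y1 = 0 /\ r = 1 \/ x1 = 0 /\ y1 = -1 /\ p = -1) by nia.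
  destruct Hc as [(-> & -> & ->)|(-> & -> & ->)]; nia.
Qed.

(** Strings have no gaps: b + (t + 1) a is the first Hirzebruch-Jung point of b + t a and b + m a,
    which have index m - t. The last step, t + 1 = m, is the known root b + m a. *)
Lemma chamber_string a b c m n k : Ch a b c -> 0 <= m ->
  Ch (vopp a) (vadd b (vscal m a)) (vadd c (vscal n a)) ->
  0 <= k <= m -> Rt (vadd b (vscal k a)).
Proof.
intros H Hm H' [Hk Hkm].
assert (Hb : Rt b) by exact (ch_root _ _ arr _ _ _ (ch_rot _ _ arr _ _ _ H)).
assert (Hbm : Rt (vadd b (vscal m a)))
  by exact (ch_root _ _ arr _ _ _ (ch_rot _ _ arr _ _ _ H')).
assert (Hab : content (cross a b) = 1) by exact (content_wall _ _ _ (ch_unimod _ _ arr _ _ _ H)).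
assert (Hall : forall j : nat, Z.of_nat j <= m -> Rt (vadd b (vscal (Z.of_nat j) a))).
{ induction j as [|j IH]; intros Hj.
  - replace (vadd b (vscal (Z.of_nat 0) a)) with b by (change (Z.of_nat 0) with 0; vring).
    exact Hb.
  - destruct (Z.eq_dec (Z.of_nat (S j)) m) as [E|E]; [rewrite E; exact Hbm|].
    set (t := Z.of_nat j) in *.
    apply (hull_point (vadd b (vscal t a)) (vadd b (vscal m a)) _ (m - t) (m - t - 1)).
    + apply IH; lia.
    + exact Hbm.
    + replace (cross (vadd b (vscal t a)) (vadd b (vscal m a)))
        with (vscal (t - m) (cross a b)) by vring.
      rewrite content_vscal, Hab; lia.
    + lia.
    + replace (Z.of_nat (S j)) with (t + 1) by lia; vring. }
rewrite <- (Z2Nat.id k) by exact Hk; apply Hall; lia.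
Qed.
End Plane.

(** * A bound for all strings of roots *)

Section Bound.
Variables (Rt : vec -> Prop) (Ch : vec -> vec -> vec -> Prop).
Hypothesis arr : arrangement Rt Ch.

(* Some chamber of the plane of u and v has u or - u as a wall. *)
Lemma string_bound q u v k :
  (forall a b c m n, Ch a b c ->
     Ch (vopp a) (vadd b (vscal m a)) (vadd c (vscal n a)) -> m <= q) ->
  Rt u -> Rt v -> Rt (vadd v (vscal k u)) -> content (cross u v) = 1 -> k <= q.
Proof.
intros Hq Hu Hv Hk H1; set (n := cross u v) in *.
assert (Hnn : 0 < dot n n).
{ assert (0 <= dot n n) by (clearbody n; clear; vdestr; cbn [dot]; nia).
  assert (dot n n <> 0) by (intros E; apply content_dot0 in E; lia). lia. }
assert (Nu : dot n u = 0) by (unfold n; vring).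
assert (Nv : dot n v = 0) by (unfold n; vring).
assert (Nk : dot n (vadd v (vscal k u)) = 0) by (unfold n; vring).
assert (Hmain : forall a b c, Ch a b c -> dot n a = 0 -> dot n b = 0 -> 0 < dot n c ->
  dot (cross n u) a = 0 -> 0 <= dot (cross n u) b -> k <= q).
{ intros a b c H Na Nb Nc Wa Wb.
  destruct (plane_root _ _ arr _ _ _ _ _ H Hu Na Nb Nc Nu) as (x1 & y1 & Eu & _).
  destruct (plane_root _ _ arr _ _ _ _ _ H Hv Na Nb Nc Nv) as (x2 & y2 & Ev & Sv).
  assert (Du : x1 * dot (cross n u) a + y1 * dot (cross n u) b = 0).
  { transitivity (dot (cross n u) u); [rewrite Eu at 4|clearbody n; vring].
    rewrite dot_comb; ring. }
  assert (Dv : x2 * dot (cross n u) a + y2 * dot (cross n u) b = dot n n).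
  { transitivity (dot (cross n u) v); [rewrite Ev, dot_comb; ring|].
    unfold n at 3; clearbody n; clear; vring. }
  assert (0 < y2 * dot (cross n u) b) by lia.
  assert (Hy1 : y1 = 0) by nia; subst y1.
  assert (Hy2 : 0 < y2) by nia.
  assert (Hx : x1 * y2 = 1 \/ x1 * y2 = -1).
  { assert (En : n = vscal (x1 * y2) (cross a b)).
    { unfold n; rewrite Eu, Ev, cross_comb; f_equal; ring. }
    pose proof (content_dvd _ _ _ En) as [z Hz]; rewrite H1 in Hz.
    apply (unit_factor z); left; lia. }
  (* Since u and v span the plane lattice, u is a or - a and v = b + x2 a; hence v and v + k u both
     lie in the a-string through b. *)
  assert (y2 = 1) by (apply unit_factor in Hx; lia); subst y2.
  assert (Hx1 : x1 = 1 \/ x1 = -1) by lia.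
  destruct (ch_refl _ _ arr _ _ _ H) as (m & m' & Hm & Hm' & H').
  pose proof (Hq _ _ _ _ _ H H') as Hmq.
  assert (Hs : forall t, Rt (vadd b (vscal t a)) -> 0 <= t <= m)
    by (intros t; apply (string_le _ _ arr _ _ _ _ _ _ H H')).
  assert (Hs2 : 0 <= x2 <= m).
  { apply Hs; replace (vadd b (vscal x2 a)) with v; [exact Hv|rewrite Ev; vring]. }
  assert (Hs3 : 0 <= x2 + k * x1 <= m).
  { apply Hs; replace (vadd b (vscal (x2 + k * x1) a)) with (vadd v (vscal k u));
      [exact Hk|rewrite Ev, Eu; vring]. }
  destruct Hx1; subst x1; lia. }
(* The dominated functional vanishes on u, puts a and b on one side of its line, and u has
   coordinates of constant sign; so u lies along a or b. *)
destruct (plane_chamber _ _ arr u v (cross n u) Hu Hv) as (a & b & c & H & Wa & Wb & Na & Nb & Nc);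
  [fold n; lia|]; fold n in Na, Nb, Nc.
destruct (plane_root _ _ arr _ _ _ _ _ H Hu Na Nb Nc Nu) as (x1 & y1 & Eu & Su).
assert (Du : x1 * dot (cross n u) a + y1 * dot (cross n u) b + 0 * 0 = 0).
{ transitivity (dot (cross n u) u); [rewrite Eu at 4|clearbody n; vring].
  rewrite dot_comb; ring. }
apply same_sign_sum0 in Du; try lia.
destruct Du as (Du1 & Du2 & _).
destruct (Z.eq_dec (dot (cross n u) a) 0) as [Ea|Ea].
- now apply (Hmain a b c).
- destruct (Z.eq_dec (dot (cross n u) b) 0) as [Eb|Eb].
  + apply (Hmain b a c); auto; now apply (ch_swap _ _ arr).
  + exfalso; assert (x1 = 0) by nia; assert (y1 = 0) by nia; subst x1 y1.
    assert (En : n = vscal 0 v) by (unfold n; rewrite Eu; vring).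
    rewrite En, content_vscal in H1; lia.
Qed.
End Bound.

(** * Soundness of the search *)

Section Soundness.
Variables (Rt : vec -> Prop) (Ch : vec -> vec -> vec -> Prop).
Hypothesis arr : arrangement Rt Ch.
Hypothesis irreducible : forall a b c m n, Ch a b c ->
  Ch (vopp a) (vadd b (vscal m a)) (vadd c (vscal n a)) -> m <> 0 \/ n <> 0.
Hypothesis Ch_std : Ch e0 e1 e2.
Variable bound : option (Z * Z).
Hypothesis bounded :
  match bound with
  | None => True
  | Some (q, n0) => forall a b c m n, Ch a b c ->
      Ch (vopp a) (vadd b (vscal m a)) (vadd c (vscal n a)) ->
      m <= q /\ (m = q -> n0 <= n)
  end.
Variable targets : list (list vec).

Definition realized : Prop := exists a b c l, Ch a b c /\ In l targets /\
  forall v, Rt v <-> In (coords (dual_basis (a, b, c)) v) l \/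
                     In (vopp (coords (dual_basis (a, b, c)) v)) l.

Definition good (st : state) : Prop :=
  Forall Rt (roots st) /\ Forall (fun v => ~ Rt v) (nonroots st) /\
  Forall (fun c => let '(x, y, z) := fst c in Ch x y z /\ snd c = dual_basis (fst c))
    (chambers st).

Lemma vopp_opp v : vopp (vopp v) = v.
Proof. vring. Qed.

Lemma Rt_oppE v : Rt (vopp v) <-> Rt v.
Proof.
split; intros H; [rewrite <- (vopp_opp v)|]; now apply (Rt_opp _ _ arr).
Qed.

Lemma Rt_canon v : Rt (canon v) <-> Rt v.
Proof. unfold canon; destruct (nneg v); [easy | apply Rt_oppE]. Qed.

Lemma Rt_dec v : Rt v \/ ~ Rt v.
Proof.
destruct (ch_fin _ _ arr) as [l Hl].
assert (D : forall u w : vec, {u = w} + {u <> w}) by (repeat decide equality).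
destruct (in_dec D v l) as [H|H]; [left|right]; now rewrite Hl.
Qed.

Lemma memE v T : vmem v T = true <-> In v T.
Proof.
unfold vmem; rewrite existsb_exists; split.
- intros (u & Hu & E); apply veqE in E; now subst.
- intros H; exists v; split; [exact H | now apply veqE].
Qed.

Lemma rmem_root v T : Forall Rt T -> rmem v T = true -> Rt v.
Proof.
intros HT H; apply memE in H; rewrite Forall_forall in HT.
now apply Rt_canon, HT.
Qed.

Lemma rmem_nonroot v T : Forall (fun v => ~ Rt v) T -> rmem v T = true -> ~ Rt v.
Proof.
intros HT H; apply memE in H; rewrite Forall_forall in HT.
rewrite <- Rt_canon; exact (HT _ H).
Qed.

Lemma excluded_sound st v : good st -> excluded st v = true -> ~ Rt v.
Proof.
intros (_ & Hn & Hc) H; apply orb_true_iff in H; destruct H as [H|H].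
- exact (rmem_nonroot _ _ Hn H).
- apply existsb_exists in H; destruct H as ([[[x y] z] D] & Hin & H).
  rewrite Forall_forall in Hc; destruct (Hc _ Hin) as [HC ED]; cbn [fst snd] in *.
  intros Hv; rewrite ED, (ch_coherent _ _ arr _ _ _ _ HC Hv) in H; discriminate.
Qed.

Lemma content_opp_r u v : content (cross u (vopp v)) = content (cross u v).
Proof.
replace (cross u (vopp v)) with (vscal (-1) (cross u v)) by vring.
rewrite content_vscal; lia.
Qed.

Lemma content_cross_sym u v : content (cross u v) = content (cross v u).
Proof.
replace (cross v u) with (vscal (-1) (cross u v)) by vring.
rewrite content_vscal; lia.
Qed.

Lemma hj_sound u v d : Rt u -> Rt v -> content (cross u v) = d -> Forall Rt (hj u v d).
Proof.
intros Hu Hv Hd; unfold hj.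
set (go := fix go (n : nat) (k : Z) : list vec := _).
assert (H : forall n k, 0 < k -> k + Z.of_nat n <= d -> Forall Rt (go n k)).
{ induction n as [|n IH]; intros k Hk Hn; [constructor|].
  cbn [go]; destruct (vadd (vscal k u) v) as [[x y] z] eqn:E.
  destruct ((x mod d =? 0) && (y mod d =? 0) && (z mod d =? 0)) eqn:Em;
    [|apply IH; lia].
  rewrite !andb_true_iff, !Z.eqb_eq in Em; destruct Em as [[Mx My] Mz].
  assert (Eg : vscal d (x / d, y / d, z / d) = vadd (vscal k u) v).
  { rewrite E; cbn [vscal]; apply vec_eq; symmetry; apply Z_div_exact_2; lia. }
  constructor; [|constructor; [|constructor]].
  - apply (hull_point _ _ arr u v _ d k Hu Hv Hd); [lia | exact Eg].
  (* The vector u - g is the first point of the cone of u and - v, where d - k takes the place of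
     k. *)
  - apply (hull_point _ _ arr u (vopp v) _ d (d - k) Hu);
      [now apply Rt_oppE | now rewrite content_opp_r | lia |].
    transitivity (vsub (vscal d u) (vscal d (x / d, y / d, z / d))); [unfold vsub; vring|].
    rewrite Eg; unfold vsub; vring. }
destruct (Z_le_gt_dec d 1).
- replace (Z.to_nat (d - 1)) with 0%nat by lia; constructor.
- apply H; lia.
Qed.

Lemma hjs_sound v T : Rt v -> Forall Rt T -> Forall Rt (hjs v T).
Proof.
intros Hv; induction 1 as [|u T Hu _ IH]; cbn [hjs]; [constructor|].
destruct (content (cross u v) <=? 1); [exact IH|].
apply Forall_app; split; [now apply hj_sound|].
apply Forall_app; split; [|exact IH].
apply hj_sound; [exact Hv | exact Hu | apply content_cross_sym].
Qed.

(** A root belongs to a unimodular basis, and its content divides the determinant. *)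
Lemma root_primitive v : Rt v -> content v = 1.
Proof.
intros Hv; destruct (ch_wall _ _ arr v Hv) as (b & c & H).
apply Z.divide_1_r_nonneg; [apply content_nonneg|].
assert (E : det (v, b, c) = dot v (cross b c)) by (unfold det; vring).
pose proof (content_dvd_dot v (cross b c)) as D; rewrite <- E in D.
destruct (ch_unimod _ _ arr _ _ _ H) as [->| ->] in D; [exact D|].
now apply Z.divide_opp_r in D.
Qed.

Lemma addroots_sound n todo st : Forall Rt todo -> good st ->
  match addroots n todo st with None => False | Some st' => good st' end.
Proof.
revert todo st; induction n as [|n IH]; intros todo st Htodo Hst; [exact Hst|].
cbn [addroots]; destruct todo as [|v todo]; [exact Hst|].
inversion_clear Htodo as [|? ? Hv Ht].
destruct (rmem v (roots st)); [now apply IH|].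
rewrite (root_primitive v Hv).
destruct (excluded st v) eqn:E; [exact (excluded_sound _ _ Hst E Hv)|].
cbn [negb orb Z.eqb]; destruct Hst as (Hr & Hn & Hc); apply IH.
- apply Forall_app; split; [|exact Ht].
  apply hjs_sound; [now apply Rt_canon | exact Hr].
- repeat split; [|exact Hn | exact Hc].
  constructor; [now apply Rt_canon | exact Hr].
Qed.

Lemma climb_sound n T a b : Forall Rt T -> Rt b ->
  let '(k, r) := climb n T a b in 0 <= k /\ r = vadd b (vscal k a) /\ Rt r.
Proof.
intros HT; revert b; induction n as [|n IH]; intros b Hb; cbn [climb].
- repeat split; [lia | vring | exact Hb].
- destruct (rmem (vadd b a) T) eqn:E.
  + pose proof (IH (vadd b a) (rmem_root _ _ HT E)) as H.
    destruct (climb n T a (vadd b a)) as [k r].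
    destruct H as (Hk & -> & Hr); repeat split; [lia | vring | exact Hr].
  + repeat split; [lia | vring | exact Hb].
Qed.

Lemma exact_sound st a b c m n k : good st -> Ch a b c -> 0 <= m ->
  Ch (vopp a) (vadd b (vscal m a)) (vadd c (vscal n a)) ->
  Rt (vadd b (vscal k a)) ->
  exact bound st k (vadd (vadd b (vscal k a)) a) = true -> k = m.
Proof.
intros Hst H Hm H' Hk Hex.
pose proof (string_le _ _ arr _ _ _ _ _ _ H H' Hk).
apply orb_true_iff in Hex; destruct Hex as [Hq|Hex].
- destruct bound as [[q n0]|]; [|discriminate].
  apply Z.leb_le in Hq; destruct (bounded _ _ _ _ _ H H'); lia.
- destruct (Z.eq_dec k m) as [E|E]; [exact E|exfalso].
  apply (excluded_sound _ _ Hst Hex).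
  replace (vadd (vadd b (vscal k a)) a) with (vadd b (vscal (k + 1) a)) by vring.
  apply (chamber_string _ _ arr _ _ _ _ _ _ H Hm H'); lia.
Qed.

Lemma Ch_rot i x y z : Ch x y z -> let '(a, b, c) := rotate i (x, y, z) in Ch a b c.
Proof.
pose proof (ch_rot _ _ arr) as R.
intros H; destruct i as [|[|i]]; cbn [rotate]; auto.
Qed.

Lemma Ch_unrot i x y z : Ch x y z -> let '(a, b, c) := unrotate i (x, y, z) in Ch a b c.
Proof.
pose proof (ch_rot _ _ arr) as R.
intros H; destruct i as [|[|i]]; cbn [unrotate]; auto.
Qed.

Lemma Ch_swap23 a b c : Ch a b c -> Ch a c b.
Proof.
pose proof (ch_rot _ _ arr) as R; pose proof (ch_swap _ _ arr) as S; auto.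
Qed.

Lemma nth_chamber st ci B D : good st -> nth_error (chambers st) ci = Some (B, D) ->
  (let '(x, y, z) := B in Ch x y z) /\ D = dual_basis B.
Proof.
intros (_ & _ & Hc) E; apply nth_error_In in E.
rewrite Forall_forall in Hc; specialize (Hc _ E); destruct B as [[x y] z]; exact Hc.
Qed.

Lemma Ch_root2 a b c : Ch a b c -> Rt b.
Proof. intros H; exact (ch_root _ _ arr _ _ _ (ch_rot _ _ arr _ _ _ H)). Qed.

Lemma Ch_root3 a b c : Ch a b c -> Rt c.
Proof. intros H; exact (Ch_root2 _ _ _ (ch_rot _ _ arr _ _ _ H)). Qed.

Lemma cross_wall_sound st i ci : good st ->
  match cross_wall bound st i ci with
  | Contradiction => False
  | Stuck => True
  | Next st' => good st'
  end.
Proof.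
intros Hst; unfold cross_wall.
destruct (nth_error (chambers st) ci) as [[[[x y] z] D0]|] eqn:E; [|exact I].
destruct (nth_chamber _ _ _ _ Hst E) as [H0 _].
pose proof (Ch_rot i _ _ _ H0) as H.
destruct (rotate i (x, y, z)) as [[a b] c].
pose proof (climb_sound 20 (roots st) a b (proj1 Hst) (Ch_root2 _ _ _ H)) as Hb.
pose proof (climb_sound 20 (roots st) a c (proj1 Hst) (Ch_root3 _ _ _ H)) as Hc.
destruct (climb 20 (roots st) a b) as [m b'], (climb 20 (roots st) a c) as [n c'].
destruct Hb as (_ & -> & Hb), Hc as (_ & -> & Hc).
destruct (exact bound st m _ && exact bound st n _) eqn:Ex; [|exact I].
apply andb_true_iff in Ex; destruct Ex as [Exm Exn].
destruct (ch_refl _ _ arr _ _ _ H) as (m0 & n0 & Hm0 & Hn0 & H').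
assert (H'' := Ch_swap23 _ _ _ H').
pose proof (exact_sound _ _ _ _ _ _ _ Hst H Hm0 H' Hb Exm); subst m0.
pose proof (exact_sound _ _ _ _ _ _ _ Hst (Ch_swap23 _ _ _ H) Hn0 H'' Hc Exn); subst n0.
destruct (bad_row bound m n) eqn:Hbad.
{ apply orb_true_iff in Hbad; destruct Hbad as [Hbad|Hbad].
  - rewrite andb_true_iff, !Z.eqb_eq in Hbad.
    destruct (irreducible _ _ _ _ _ H H'); lia.
  - destruct bound as [[q n0]|]; [|discriminate].
    pose proof (bounded _ _ _ _ _ H H').
    pose proof (bounded _ _ _ _ _ (Ch_swap23 _ _ _ H) H'').
    rewrite !orb_true_iff, !andb_true_iff, !Z.ltb_lt, !Z.eqb_eq in Hbad; lia. }
pose proof (Ch_unrot i _ _ _ H') as HB.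
destruct (unrotate i _) as [[a' b'] c'].
destruct (forallb _ (roots st)) eqn:Hf.
- destruct Hst as (Hr & Hn & Hch); split; [exact Hr | split; [exact Hn|]].
  constructor; [exact (conj HB eq_refl) | exact Hch].
- rewrite <- not_true_iff_false, forallb_forall in Hf; apply Hf; intros v Hv.
  apply (ch_coherent _ _ arr _ _ _ _ HB).
  destruct Hst as (Hr & _ & _); rewrite Forall_forall in Hr; auto.
Qed.

Lemma long_string_sound st s ui vi : good st ->
  (s = 1 \/ s = -1) -> long_string bound st s ui vi = true -> False.
Proof.
intros (Hr & _ & _) Hs H; unfold long_string in H.
destruct bound as [[q n0]|]; [|discriminate].
destruct (nth_error (roots st) ui) as [u|] eqn:Eu; [|discriminate].
destruct (nth_error (roots st) vi) as [v|] eqn:Ev; [|discriminate].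
apply andb_true_iff in H; destruct H as [H1 H2]; apply Z.eqb_eq in H1.
pose proof Hr as Hr'; rewrite Forall_forall in Hr'.
pose proof (Hr' _ (nth_error_In _ _ Eu)) as Hu.
pose proof (Hr' _ (nth_error_In _ _ Ev)) as Hv.
apply (rmem_root _ _ Hr) in H2.
assert (Hq : forall a b c m n, Ch a b c ->
  Ch (vopp a) (vadd b (vscal m a)) (vadd c (vscal n a)) -> m <= q)
  by (intros a b c m n Ha Hb; apply (bounded _ _ _ _ _ Ha Hb)).
destruct Hs as [-> | ->].
- assert (q + 1 <= q); [|lia].
  apply (string_bound _ _ arr q u v _ Hq Hu Hv); [|exact H1].
  now replace (1 * (q + 1)) with (q + 1) in H2 by ring.
- assert (q + 1 <= q); [|lia].
  apply (string_bound _ _ arr q (vopp u) v _ Hq); [now apply Rt_oppE | exact Hv | |].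
  + replace (vadd v (vscal (q + 1) (vopp u))) with (vadd v (vscal (-1 * (q + 1)) u))
      by vring; exact H2.
  + rewrite content_cross_sym, content_opp_r, content_cross_sym; exact H1.
Qed.

Definition known (st : state) (v : vec) := rmem v (roots st) = true.

(** Every pair is tested once, in the order of the list, and so is only one of its two differences;
    this explains the disjunction. *)
Lemma gaps_sound st T u w : good st -> gaps_excluded st T = true ->
  In u T -> In w T -> content (cross u w) = 1 ->
  (Rt (vadd u w) -> known st (vadd u w)) /\
  (Rt (vsub u w) -> known st (vsub u w) \/ known st (vsub w u)).
Proof.
intros Hst; induction T as [|t T IH]; [intros _ []|].
cbn [gaps_excluded]; intros H; apply andb_true_iff in H; destruct H as [H HT].
rewrite forallb_forall in H.
assert (Hexc : forall y, rmem y (roots st) || excluded st y = true -> Rt y -> known st y).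
{ intros y Hy Ry; apply orb_true_iff in Hy; destruct Hy as [Hy|Hy]; [exact Hy|].
  now destruct (excluded_sound _ _ Hst Hy). }
intros [<-|Hu] [<-|Hw] H1.
- exfalso; replace (cross t t) with (vscal 0 t) in H1 by vring.
  rewrite content_vscal in H1; lia.
- specialize (H w Hw); rewrite H1 in H; cbn [Z.eqb] in H.
  change (1 =? 1) with true in H; cbv iota in H.
  apply andb_true_iff in H; destruct H as [Ha Hs]; split; auto.
- specialize (H u Hu); rewrite content_cross_sym, H1 in H.
  change (1 =? 1) with true in H; cbv iota in H.
  apply andb_true_iff in H; destruct H as [Ha Hs]; split; intros Hy.
  + replace (vadd u t) with (vadd t u) in * by vring; auto.
  + right; apply Hexc; [exact Hs|].
    replace (vsub t u) with (vopp (vsub u t)) by (unfold vsub; vring).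
    now apply Rt_oppE.
- auto.
Qed.
Definition within (T : list vec) (v : vec) := In v T \/ In (vopp v) T.

Lemma within_opp T v : within T (vopp v) <-> within T v.
Proof. unfold within; rewrite vopp_opp; tauto. Qed.

Lemma rmem_within T v : rmem v T = true -> within T v.
Proof.
intros H; apply memE in H; unfold canon in H; destruct (nneg v); [now left | now right].
Qed.

Lemma gap_step st u w : good st -> gaps_excluded st (roots st) = true ->
  within (roots st) u -> within (roots st) w -> content (cross u w) = 1 ->
  Rt (vadd u w) -> within (roots st) (vadd u w).
Proof.
intros Hst Hg Hu Hw H1 Hy.
assert (G := gaps_sound st (roots st)).
assert (Hsub : forall u w, In u (roots st) -> In w (roots st) ->
  content (cross u w) = 1 -> Rt (vsub u w) -> within (roots st) (vsub u w)).
{ clear u w Hu Hw H1 Hy; intros u w Hu Hw H1 Hy.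
  destruct (G u w Hst Hg Hu Hw H1) as [_ Hs].
  destruct (Hs Hy) as [K|K]; apply rmem_within in K; [exact K|].
  apply within_opp; now replace (vopp (vsub u w)) with (vsub w u) by (unfold vsub; vring). }
destruct Hu as [Hu|Hu], Hw as [Hw|Hw].
- apply rmem_within; now apply (G u w Hst Hg Hu Hw H1).
- replace (vadd u w) with (vsub u (vopp w)) in * by (unfold vsub; vring).
  apply Hsub; auto; now rewrite content_opp_r.
- replace (vadd u w) with (vsub w (vopp u)) in * by (unfold vsub; vring).
  apply Hsub; auto; now rewrite content_opp_r, content_cross_sym.
- apply within_opp; replace (vopp (vadd u w)) with (vadd (vopp u) (vopp w)) by vring.
  apply rmem_within, (G (vopp u) (vopp w) Hst Hg Hu Hw).
  + now rewrite content_opp_r, content_cross_sym, content_opp_r, content_cross_sym.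
  + replace (vadd (vopp u) (vopp w)) with (vopp (vadd u w)) by vring.
    now apply Rt_oppE.
Qed.

(** Along a gallery from the standard chamber a new wall b + m a is reached by adding a to b step by
    step. Each step is the sum of two known roots that span a primitive plane lattice, and such sums
    are decided. Since every root is a wall somewhere, all roots are known. *)
Lemma gaps_complete st : good st -> gaps_excluded st (roots st) = true ->
  within (roots st) e0 -> within (roots st) e1 -> within (roots st) e2 ->
  forall v, Rt v -> within (roots st) v.
Proof.
intros Hst Hg H0 H1 H2.
assert (Hchain : forall a b c m n, Ch a b c -> 0 <= m ->
  Ch (vopp a) (vadd b (vscal m a)) (vadd c (vscal n a)) ->
  within (roots st) a -> within (roots st) b -> within (roots st) (vadd b (vscal m a))).
{ intros a b c m n H Hm H' Ha Hb.
  assert (Hj : forall j : nat, Z.of_nat j <= m ->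
    within (roots st) (vadd b (vscal (Z.of_nat j) a))).
  { induction j as [|j IH]; intros Hj.
    - replace (vadd b (vscal (Z.of_nat 0) a)) with b by (change (Z.of_nat 0) with 0; vring).
      exact Hb.
    - set (t := Z.of_nat j) in *.
      replace (Z.of_nat (S j)) with (t + 1) by lia.
      replace (vadd b (vscal (t + 1) a)) with (vadd (vadd b (vscal t a)) a) by vring.
      apply gap_step; auto; [apply IH; lia | |].
      + replace (cross (vadd b (vscal t a)) a) with (cross b a) by vring.
        rewrite content_cross_sym; exact (content_wall _ _ _ (ch_unimod _ _ arr _ _ _ H)).
      + replace (vadd (vadd b (vscal t a)) a) with (vadd b (vscal (t + 1) a)) by vring.
        apply (chamber_string _ _ arr _ _ _ _ _ _ H Hm H'); lia. }
  rewrite <- (Z2Nat.id m) by exact Hm; apply Hj; lia. }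
pose (P a b c := within (roots st) a /\ within (roots st) b /\ within (roots st) c).
assert (HP : forall a b c, Ch a b c -> P a b c).
{ apply (ch_gallery _ _ arr P) with e0 e1 e2; try (unfold P; tauto).
  - intros a b c m n H (Ha & Hb & Hc) Hm Hn H'; repeat split.
    + now apply within_opp.
    + now apply (Hchain a b c m n).
    + apply (Hchain a c b n m); auto; now apply Ch_swap23.
}
intros v Hv; destruct (ch_wall _ _ arr v Hv) as (b & c & H).
exact (proj1 (HP _ _ _ H)).
Qed.

Lemma leaf_sound st ci li p : good st -> leaf targets st ci li p = true -> realized.
Proof.
intros Hst H; unfold leaf in H.
destruct (nth_error (chambers st) ci) as [[[[x y] z] D0]|] eqn:E; [|discriminate].
destruct (nth_error targets li) as [l|] eqn:El; [|discriminate].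
destruct (nth_chamber _ _ _ _ Hst E) as [H0 _].
pose proof (Ch_rot (if Nat.ltb p 3 then p else p - 3) _ _ _ H0) as HC.
destruct (rotate _ (x, y, z)) as [[a b] c].
set (B := if Nat.ltb p 3 then (a, b, c) else (b, a, c)) in *.
assert (HB : let '(a, b, c) := B in Ch a b c).
{ unfold B; destruct (Nat.ltb p 3); [exact HC | now apply (ch_swap _ _ arr)]. }
destruct B as [[a' b'] c'].
rewrite !andb_true_iff in H; destruct H as [[[[[R0 R1] R2] F1] F2] G].
exists a', b', c', l; split; [exact HB | split; [exact (nth_error_In _ _ El)|]].
rewrite forallb_forall in F1, F2.
assert (Hcanon : forall v, In v (roots st) ->
  In (coords (dual_basis (a', b', c')) v) l \/ In (vopp (coords (dual_basis (a', b', c')) v)) l).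
{ intros v Hv; assert (K := F1 _ (in_map _ _ _ Hv)); apply memE in K; cbv beta in K.
  unfold canon in K; destruct (nneg _); auto. }
assert (Hopp : forall v, coords (dual_basis (a', b', c')) (vopp v)
  = vopp (coords (dual_basis (a', b', c')) v)) by (intros; clear; vring).
pose proof (ch_unimod _ _ arr _ _ _ HB) as U.
assert (Hback : forall v, In (coords (dual_basis (a', b', c')) v) l -> Rt v).
{ intros v Hv; assert (K := F2 _ Hv); apply memE, in_map_iff in K.
  destruct K as (r & Er & Hr).
  assert (Rr : Rt r) by (destruct Hst as (Hr' & _); rewrite Forall_forall in Hr'; auto).
  unfold canon in Er; destruct (nneg _).
  - replace v with r; [exact Rr|].
    now rewrite <- (comb_coords _ r U), Er, comb_coords.
  - rewrite <- Hopp in Er; replace v with (vopp r); [now apply Rt_oppE|].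
    now rewrite <- (comb_coords _ (vopp r) U), Er, comb_coords. }
intros v; split.
- intros Hv.
  destruct (gaps_complete st Hst G (rmem_within _ _ R0) (rmem_within _ _ R1)
    (rmem_within _ _ R2) v Hv) as [K|K]; [now apply Hcanon|].
  apply Hcanon in K; rewrite Hopp, vopp_opp in K; tauto.
- intros [K|K]; [now apply Hback|].
  apply Rt_oppE, Hback; now rewrite Hopp.
Qed.

Lemma run_sound fuel st ts ts' :
  good st -> run bound targets fuel st ts = Some ts' -> realized.
Proof.
revert st ts ts'; induction fuel as [|fuel IH]; intros st ts ts' Hst; [discriminate|].
cbn [run]; destruct ts as [|t ts]; [discriminate|].
assert (Hrefl : forall i ci,
  refl_step bound (run bound targets fuel) st ts i ci = Some ts' -> realized).
{ intros i ci; unfold refl_step; pose proof (cross_wall_sound st i ci Hst) as H.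
  destruct (cross_wall bound st i ci); [tauto | discriminate |].
  now apply IH. }
assert (Hbranch : forall i j ci,
  branch_step (run bound targets fuel) st ts i j ci = Some ts' -> realized).
{ intros i j ci; unfold branch_step.
  destruct (branch_vec st i j ci) as [y|]; [|discriminate].
  destruct (Rt_dec y) as [Hy|Hy].
  - pose proof (addroots_sound 1000 [y] st (Forall_cons _ Hy (Forall_nil _)) Hst) as H.
    destruct (addroots 1000 [y] st) as [st'|]; [|tauto].
    destruct (run bound targets fuel st' ts) eqn:E; [|discriminate].
    intros _; exact (IH _ _ _ H E).
  - destruct (match addroots 1000 [y] st with None => _ | Some _ => _ end); [|discriminate].
    apply IH; destruct Hst as (Hr & Hn & Hc); repeat split; auto.
    cbn [nonroots]; constructor; [now rewrite Rt_canon | exact Hn]. }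
assert (Hstr : forall s ui, s = 1 \/ s = -1 ->
  string_step bound st ts s ui = Some ts' -> realized).
{ intros s ui Hs; unfold string_step; destruct ts as [|p ts1]; [discriminate|].
  destruct (long_string bound st s ui (idx p)) eqn:E; [|discriminate].
  destruct (long_string_sound _ _ _ _ Hst Hs E). }
assert (Hleaf : forall ci, leaf_step targets st ts ci = Some ts' -> realized).
{ intros ci; unfold leaf_step; destruct ts as [|li [|p ts1]]; try discriminate.
  destruct (leaf targets st ci (idx li) (idx p)) eqn:E; [|discriminate].
  intros _; exact (leaf_sound _ _ _ _ Hst E). }
destruct t as [t|t|]; try destruct t as [t|t|]; try destruct t as [t|t|];
  try destruct t as [t|t|];
  lazymatch goal with
  | |- refl_step _ _ _ _ _ _ = _ -> _ => apply Hrefl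
  | |- branch_step _ _ _ _ _ _ = _ -> _ => apply Hbranch
  | |- string_step _ _ _ _ _ = _ -> _ => apply Hstr; tauto
  | |- leaf_step _ _ _ _ = _ -> _ => apply Hleaf
  | |- None = _ -> _ => discriminate
  end.
Qed.

Lemma refuted_sound n rs ns ts : Forall Rt rs -> Forall (fun v => ~ Rt v) ns ->
  refuted n bound targets rs ns ts = true -> realized.
Proof.
intros Hr Hn H; unfold refuted, start in H.
assert (G : good (State [] ns [(std_basis, std_basis)])).
{ repeat split; [constructor | exact Hn | constructor; [|constructor]].
  split; [exact Ch_std | reflexivity]. }
pose proof (addroots_sound n rs _ Hr G) as H1.
destruct (addroots n rs _) as [st|]; [|tauto].
destruct (run bound targets n st ts) eqn:E; [|discriminate].
exact (run_sound _ _ _ _ H1 E).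
Qed.
End Soundness.

(** * The classification of arrangements *)

Lemma comb_opp B v : comb B (vopp v) = vopp (comb B v).
Proof. destruct B as [[a b] c]; vring. Qed.

Lemma comb_addscal B u k v : comb B (vadd u (vscal k v)) = vadd (comb B u) (vscal k (comb B v)).
Proof. destruct B as [[a b] c]; vring. Qed.

Lemma comb_comb B a b c t : comb B (comb (a, b, c) t) = comb (comb B a, comb B b, comb B c) t.
Proof. destruct B as [[x y] z]; vring. Qed.

Lemma det_comb B a b c : det (comb B a, comb B b, comb B c) = det B * det (a, b, c).
Proof. destruct B as [[x y] z]; vring. Qed.

Lemma coords_base_change B a b c v : unimodular (a, b, c) ->
  unimodular (comb B a, comb B b, comb B c) ->
  coords (dual_basis (comb B a, comb B b, comb B c)) (comb B v) = coords (dual_basis (a, b, c)) v.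
Proof.
intros U U'; rewrite <- (comb_coords _ v U) at 1.
rewrite comb_comb; now apply coords_comb.
Qed.

(** * Invariance under change of basis *)

Section BaseChange.
Variables (Rt : vec -> Prop) (Ch : vec -> vec -> vec -> Prop).
Hypothesis arr : arrangement Rt Ch.
Variable B : basis.
Hypothesis HB : unimodular B.

Definition base_Rt v := Rt (comb B v).
Definition base_Ch a b c := Ch (comb B a) (comb B b) (comb B c).

Let binv v := coords (dual_basis B) v.
Let combK v : comb B (binv v) = v := comb_coords B v HB.
Let binvK v : binv (comb B v) = v := coords_comb B v HB.

Lemma base_unimod a b c : base_Ch a b c -> unimodular (a, b, c).
Proof.
intros H; apply (ch_unimod _ _ arr) in H.
unfold unimodular in *; rewrite det_comb in H.
destruct HB as [E|E]; rewrite E in H; lia.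
Qed.

Lemma base_change : arrangement base_Rt base_Ch.
Proof.
split.
- intros a b c; apply (ch_swap _ _ arr).
- intros a b c; apply (ch_rot _ _ arr).
- intros a b c; apply (ch_root _ _ arr).
- exact base_unimod.
- intros a b c v H Hv; pose proof (ch_coherent _ _ arr _ _ _ _ H Hv) as K.
  unfold coherent in *; rewrite coords_base_change in K; [exact K | now apply base_unimod |].
  exact (ch_unimod _ _ arr _ _ _ H).
- intros a b c H; destruct (ch_refl _ _ arr _ _ _ H) as (m & n & Hm & Hn & K).
  exists m, n; split; [exact Hm | split; [exact Hn|]].
  unfold base_Ch; now rewrite comb_opp, !comb_addscal.
- destruct (ch_fin _ _ arr) as [l Hl]; exists (map binv l); intros v.
  rewrite in_map_iff; unfold base_Rt; rewrite Hl; split.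
  + intros H; exists (comb B v); split; [apply binvK | exact H].
  + intros (u & <- & H); now rewrite combK.
- intros v Hv; destruct (ch_wall _ _ arr _ Hv) as (b & c & H).
  exists (binv b), (binv c); unfold base_Ch; now rewrite !combK.
- intros P P1 P2 P3 a b c H HP a' b' c' H'.
  pose (Q x y z := P (binv x) (binv y) (binv z)).
  assert (HQ : Q (comb B a') (comb B b') (comb B c')).
  { apply (ch_gallery _ _ arr Q) with (comb B a) (comb B b) (comb B c); auto.
    - intros x y z; apply P1.
    - intros x y z; apply P2.
    - intros x y z m n K1 K2 Hm Hn K3; unfold Q.
      assert (E1 : binv (vopp x) = vopp (binv x))
        by (rewrite <- (combK x) at 1; rewrite <- comb_opp; apply binvK).
      assert (E2 : forall u k, binv (vadd u (vscal k x)) = vadd (binv u) (vscal k (binv x)))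
        by (intros u k; rewrite <- (combK u), <- (combK x) at 1;
            rewrite <- comb_addscal; apply binvK).
      rewrite E1, !E2; apply P3; auto; unfold base_Ch.
      + now rewrite !combK.
      + now rewrite comb_opp, !comb_addscal, !combK.
    - unfold Q; now rewrite !binvK. }
  unfold Q in HQ; now rewrite !binvK in HQ.
- destruct (ch_nonempty _ _ arr) as (a & b & c & H).
  exists (binv a), (binv b), (binv c); unfold base_Ch; now rewrite !combK.
Qed.

Lemma base_Ch_refl a b c m n :
  base_Ch (vopp a) (vadd b (vscal m a)) (vadd c (vscal n a)) <->
  Ch (vopp (comb B a)) (vadd (comb B b) (vscal m (comb B a)))
     (vadd (comb B c) (vscal n (comb B a))).
Proof. unfold base_Ch; now rewrite comb_opp, !comb_addscal. Qed.

Lemma base_realized targets :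
  realized base_Rt base_Ch targets -> realized Rt Ch targets.
Proof.
intros (a & b & c & l & H & Hl & E).
exists (comb B a), (comb B b), (comb B c), l; split; [exact H | split; [exact Hl|]].
intros v; pose proof (E (binv v)) as Ev; unfold base_Rt in Ev; rewrite combK in Ev.
rewrite Ev, <- (coords_base_change B), combK; [reflexivity | now apply base_unimod |].
exact (ch_unimod _ _ arr _ _ _ H).
Qed.
End BaseChange.

Lemma max_exists (P : Z -> Prop) (N x : Z) :
  P x -> (forall y, P y -> y <= N) -> exists y, P y /\ forall z, P z -> z <= y.
Proof.
intros Hx HN.
assert (H : forall k x, P x -> (Z.to_nat (N - x) < k)%nat ->
  exists y, P y /\ forall z, P z -> z <= y).
{ clear x Hx; induction k as [|k IH]; intros x Hx Hk; [lia|].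
  destruct (classic (exists y, P y /\ x < y)) as [(y & Hy & Hxy)|Hno].
  - apply (IH y Hy); pose proof (HN y Hy); lia.
  - exists x; split; [exact Hx|]; intros z Hz.
    destruct (Z_le_gt_dec z x) as [|Hg]; [assumption|].
    destruct Hno; exists z; split; [exact Hz | lia]. }
exact (H _ x Hx (Nat.lt_succ_diag_r _)).
Qed.

(** Irreducibility gives q >= 1, the maximality of q gives n <= q, and 8 is the bound obtained in
    [classification]. *)
Definition all_rows (f : nat -> nat -> bool) : bool :=
  forallb (fun q => forallb (f q) (seq 0 (S q))) (seq 1 8).

Lemma all_rowsP f q n : all_rows f = true -> (1 <= q <= 8)%nat -> (n <= q)%nat -> f q n = true.
Proof.
intros H Hq Hn; unfold all_rows in H; rewrite forallb_forall in H.
specialize (H q); rewrite in_seq, forallb_forall in H.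
apply H; [lia | apply in_seq; lia].
Qed.

Section Classification.
Variables (targets : list (list vec)) (cert : list positive)
  (certs : list (list (list positive))).

Definition level2 (n : nat) : list vec := map (fun k => (Z.of_nat k, 2, 1)) (seq 0 n).

Hypothesis level2_checked :
  refuted 1000 None [] (start_roots 4 0) (level2 5) cert = true.
Hypothesis certs_checked : all_rows (fun q n =>
  refuted 1000 (Some (Z.of_nat q, Z.of_nat n)) targets
    (start_roots q n) (start_nonroots q n) (nth n (nth q certs []) [])) = true.

Section Row.
Variables (Rt : vec -> Prop) (Ch : vec -> vec -> vec -> Prop).
Hypothesis arr : arrangement Rt Ch.
Hypothesis Ch_std : Ch e0 e1 e2.
Variables m n : Z.
Hypotheses (m_ge0 : 0 <= m) (n_ge0 : 0 <= n).
Hypothesis Ch_next : Ch (vopp e0) (vadd e1 (vscal m e0)) (vadd e2 (vscal n e0)).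

Lemma row1 k : 0 <= k <= m -> Rt (k, 1, 0).
Proof.
intros Hk; replace (k, 1, 0) with (vadd e1 (vscal k e0))
  by (unfold e0, e1; vcbn; apply vec_eq; ring).
exact (chamber_string _ _ arr _ _ _ _ _ _ Ch_std m_ge0 Ch_next Hk).
Qed.

Lemma row2 k : 0 <= k <= n -> Rt (k, 0, 1).
Proof.
intros Hk; replace (k, 0, 1) with (vadd e2 (vscal k e0))
  by (unfold e0, e2; vcbn; apply vec_eq; ring).
exact (chamber_string _ _ arr _ _ _ _ _ _ (Ch_swap23 _ _ arr _ _ _ Ch_std) n_ge0
  (Ch_swap23 _ _ arr _ _ _ Ch_next) Hk).
Qed.

Lemma row1_max k : Rt (k, 1, 0) -> k <= m.
Proof.
intros H; apply (string_le _ _ arr _ _ _ _ _ _ Ch_std Ch_next).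
now replace (vadd e1 (vscal k e0)) with (k, 1, 0) by (unfold e0, e1; vcbn; apply vec_eq; ring).
Qed.

Lemma row2_max k : Rt (k, 0, 1) -> k <= n.
Proof.
intros H; apply (string_le _ _ arr _ _ _ _ _ _ (Ch_swap23 _ _ arr _ _ _ Ch_std)
  (Ch_swap23 _ _ arr _ _ _ Ch_next)).
now replace (vadd e2 (vscal k e0)) with (k, 0, 1) by (unfold e0, e2; vcbn; apply vec_eq; ring).
Qed.

Lemma start_roots_Rt q p : Z.of_nat q <= m -> Z.of_nat p <= n ->
  Forall Rt (start_roots q p).
Proof.
intros Hq Hp; unfold start_roots; apply Forall_app; split.
- constructor; [exact (ch_root _ _ arr _ _ _ Ch_std)|].
  constructor; [exact (Ch_root3 _ _ arr _ _ _ Ch_std) | constructor].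
- apply Forall_app; split; apply Forall_forall; intros v Hv;
    apply in_map_iff in Hv; destruct Hv as (k & <- & Hk); apply in_seq in Hk.
  + apply row1; lia.
  + apply row2; lia.
Qed.

Lemma start_nonroots_Rt q p : Z.of_nat q = m -> Z.of_nat p = n ->
  Forall (fun v => ~ Rt v) (start_nonroots q p).
Proof.
intros Hq Hp; unfold start_nonroots.
constructor; [|constructor; [|constructor]]; intros H.
- apply row1_max in H; lia.
- apply row2_max in H; lia.
Qed.

(** The search starts from a, c and b, ..., b + 4 a with the five vectors (k, 2, 1) declared to be
    nonroots. It runs without targets, so its success is a contradiction, and without a bound on the
    entries, so it can be used before q is bounded. *)
Lemma level2_root : 4 <= m ->
  (forall a b c m n, Ch a b c ->
     Ch (vopp a) (vadd b (vscal m a)) (vadd c (vscal n a)) -> m <> 0 \/ n <> 0) ->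
  exists k, 0 <= k <= 4 /\ Rt (k, 2, 1).
Proof.
intros Hm irr; apply NNPP; intros Hno.
assert (R : realized Rt Ch []).
{ apply (refuted_sound _ _ arr irr Ch_std None I [] 1000 (start_roots 4 0) (level2 5) cert).
  - apply start_roots_Rt; lia.
  - apply Forall_forall; intros v Hv; apply in_map_iff in Hv.
    destruct Hv as (k & <- & Hk); apply in_seq in Hk; intros H.
    apply Hno; exists (Z.of_nat k); split; [lia | exact H].
  - exact level2_checked. }
destruct R as (a & b & c & l & _ & [] & _).
Qed.
End Row.

Section Main.
Variables (Rt : vec -> Prop) (Ch : vec -> vec -> vec -> Prop).
Hypothesis arr : arrangement Rt Ch.
Hypothesis irreducible : forall a b c m n, Ch a b c ->
  Ch (vopp a) (vadd b (vscal m a)) (vadd c (vscal n a)) -> m <> 0 \/ n <> 0.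

(** m a is the difference of the roots b + m a and b, whose coordinates are bounded by finiteness,
    and some coordinate of a is a nonzero integer. *)
Lemma entries_bounded : exists N, forall a b c m n, Ch a b c ->
  Ch (vopp a) (vadd b (vscal m a)) (vadd c (vscal n a)) -> m <= N.
Proof.
destruct (dot_bound _ _ arr e0) as (N0 & _ & H0).
destruct (dot_bound _ _ arr e1) as (N1 & _ & H1).
destruct (dot_bound _ _ arr e2) as (N2 & _ & H2).
exists (2 * (Z.max N0 (Z.max N1 N2))); intros a b c m n H H'.
pose proof (root_primitive _ _ arr a (ch_root _ _ arr _ _ _ H)) as Pa.
pose proof (Ch_root2 _ _ arr _ _ _ H) as Hb.
pose proof (Ch_root2 _ _ arr _ _ _ H') as Hb'.
pose proof (H0 _ Hb); pose proof (H0 _ Hb').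
pose proof (H1 _ Hb); pose proof (H1 _ Hb').
pose proof (H2 _ Hb); pose proof (H2 _ Hb').
destruct a as [[a1 a2] a3], b as [[b1 b2] b3]; unfold e0, e1, e2 in *.
cbn [vadd vscal dot] in *.
assert (Ha : a1 <> 0 \/ a2 <> 0 \/ a3 <> 0).
{ destruct (Z.eq_dec a1 0), (Z.eq_dec a2 0), (Z.eq_dec a3 0); subst; try tauto.
  discriminate Pa. }
destruct (Z_le_gt_dec m 0); [lia|].
destruct Ha as [Ha|[Ha|Ha]]; nia.
Qed.

Theorem classification : realized Rt Ch targets.
Proof.
destruct entries_bounded as [N HN].
destruct (ch_nonempty _ _ arr) as (x & y & z & Hxyz).
destruct (ch_refl _ _ arr _ _ _ Hxyz) as (m & n & _ & _ & Hmn).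
destruct (max_exists (fun q => exists a b c n, Ch a b c /\
  Ch (vopp a) (vadd b (vscal q a)) (vadd c (vscal n a))) N m) as (q & Hq & Hqmax).
{ now exists x, y, z, n. }
{ intros q (a & b & c & n' & H & H'); exact (HN _ _ _ _ _ H H'). }
destruct Hq as (x1 & y1 & z1 & n1 & H1 & H1').
(* The least second entry n0 of a row with maximal entry q is found as a largest value of p = -
   n. *)
destruct (max_exists (fun p => exists a b c, Ch a b c /\
  Ch (vopp a) (vadd b (vscal q a)) (vadd c (vscal (- p) a))) 0 (- n1))
  as (p & Hp & Hpmax).
{ exists x1, y1, z1; split; [exact H1 | now rewrite Z.opp_involutive]. }
{ intros p (a & b & c & H & H').
  assert (0 <= - p <= - p); [|lia].
  apply (string_le _ _ arr _ _ _ _ _ _ (Ch_swap23 _ _ arr _ _ _ H)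
    (Ch_swap23 _ _ arr _ _ _ H')).
  exact (Ch_root3 _ _ arr _ _ _ H'). }
destruct Hp as (a & b & c & H & H'); set (n0 := - p) in *.
assert (Hbound : forall a b c m n, Ch a b c ->
  Ch (vopp a) (vadd b (vscal m a)) (vadd c (vscal n a)) -> m <= q /\ (m = q -> n0 <= n)).
{ intros a' b' c' m' n' K K'; split.
  - apply Hqmax; now exists a', b', c', n'.
  - intros ->; assert (- n' <= p); [|lia].
    apply Hpmax; exists a', b', c'; split; [exact K | now rewrite Z.opp_involutive]. }
assert (Hrow : 0 <= q /\ 0 <= n0 <= q /\ q <> 0).
{ pose proof (string_le _ _ arr _ _ _ _ _ _ H H' (Ch_root2 _ _ arr _ _ _ H')).
  pose proof (Ch_swap23 _ _ arr _ _ _ H) as K.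
  pose proof (Ch_swap23 _ _ arr _ _ _ H') as K'.
  pose proof (string_le _ _ arr _ _ _ _ _ _ K K' (Ch_root2 _ _ arr _ _ _ K')).
  destruct (Hbound _ _ _ _ _ K K'), (irreducible _ _ _ _ _ H H'); lia. }
destruct Hrow as (Hq0 & Hn0 & Hq1).
assert (irr' : forall B a b c m n, base_Ch Ch B a b c ->
  base_Ch Ch B (vopp a) (vadd b (vscal m a)) (vadd c (vscal n a)) -> m <> 0 \/ n <> 0).
{ intros B a' b' c' m' n' K K'; apply base_Ch_refl in K'; exact (irreducible _ _ _ _ _ K K'). }
assert (Estd : forall B, comb B e0 = fst (fst B) /\ comb B e1 = snd (fst B) /\
  comb B e2 = snd B)
  by (intros [[u v] w]; unfold e0, e1, e2; cbn [fst snd]; repeat split; vring).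
assert (Hstd : forall a b c, Ch a b c -> base_Ch Ch (a, b, c) e0 e1 e2).
{ intros a' b' c' K; destruct (Estd (a', b', c')) as (E0 & E1 & E2).
  unfold base_Ch; now rewrite E0, E1, E2. }
assert (Hnext : forall a b c m n, Ch (vopp a) (vadd b (vscal m a)) (vadd c (vscal n a)) ->
  base_Ch Ch (a, b, c) (vopp e0) (vadd e1 (vscal m e0)) (vadd e2 (vscal n e0))).
{ intros a' b' c' m' n' K; apply base_Ch_refl.
  destruct (Estd (a', b', c')) as (E0 & E1 & E2); now rewrite E0, E1, E2. }
pose proof (ch_unimod _ _ arr _ _ _ H) as U.
pose proof (ch_unimod _ _ arr _ _ _ H') as U'.
assert (Hq8 : q <= 8).
{ destruct (Z_le_gt_dec q 3) as [|Hq3]; [lia|].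
  destruct (level2_root _ _ (base_change _ _ arr _ U) (Hstd _ _ _ H) q n0 Hq0 (proj1 Hn0)
    (Hnext _ _ _ _ _ H') ltac:(lia) (irr' _)) as (k & Hk & Rk).
  assert (H'' : Ch (vopp (vopp a)) (vadd (vadd b (vscal q a)) (vscal q (vopp a)))
    (vadd (vadd c (vscal n0 a)) (vscal n0 (vopp a)))).
  { replace (vopp (vopp a)) with a by vring.
    replace (vadd (vadd b (vscal q a)) (vscal q (vopp a))) with b by vring.
    replace (vadd (vadd c (vscal n0 a)) (vscal n0 (vopp a))) with c by vring. exact H. }
  destruct (level2_root _ _ (base_change _ _ arr _ U') (Hstd _ _ _ H') q n0 Hq0 (proj1 Hn0)
    (Hnext _ _ _ _ _ H'') ltac:(lia) (irr' _)) as (k' & Hk' & Rk').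
  unfold base_Rt in Rk, Rk'.
  (* The root (k', 2, 1) of the neighbour reads (2 q + n0 - k', 2, 1) at the first chamber and
     differs from (k, 2, 1) by a multiple of a. With k, k' <= 4 and n0 >= 0 the string bound yields
     q <= 8. *)
  assert (2 * q + n0 - k' - k <= q); [|lia].
  apply (string_bound _ _ (base_change _ _ arr _ U) q e0 (k, 2, 1)).
  - intros a' b' c' m' n' K K'; apply base_Ch_refl in K'; exact (proj1 (Hbound _ _ _ _ _ K K')).
  - exact (ch_root _ _ (base_change _ _ arr _ U) _ _ _ (Hstd _ _ _ H)).
  - exact Rk.
  - unfold base_Rt; replace (comb (a, b, c) _) with
      (comb (vopp a, vadd b (vscal q a), vadd c (vscal n0 a)) (k', 2, 1))
      by (clear; unfold e0; vring); exact Rk'.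
  - reflexivity. }
apply (base_realized _ _ arr _ U).
apply (refuted_sound _ _ (base_change _ _ arr _ U) (irr' _) (Hstd _ _ _ H)
  (Some (q, n0)) (fun a b c m n K K' =>
    Hbound _ _ _ _ _ K (proj1 (base_Ch_refl _ _ _ _ _ _ _) K'))
  targets 1000 (start_roots (Z.to_nat q) (Z.to_nat n0))
  (start_nonroots (Z.to_nat q) (Z.to_nat n0))
  (nth (Z.to_nat n0) (nth (Z.to_nat q) certs []) [])).
- apply (start_roots_Rt _ _ (base_change _ _ arr _ U) (Hstd _ _ _ H) q n0 Hq0 (proj1 Hn0)
    (Hnext _ _ _ _ _ H')); lia.
- apply (start_nonroots_Rt _ _ (base_change _ _ arr _ U) (Hstd _ _ _ H) q n0
    (Hnext _ _ _ _ _ H')); lia.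
- rewrite <- (Z2Nat.id q) at 1 by lia; rewrite <- (Z2Nat.id n0) at 1 by lia.
  exact (all_rowsP _ (Z.to_nat q) (Z.to_nat n0) certs_checked ltac:(lia) ltac:(lia)).
Qed.
End Main.
End Classification.

(** * The chambers of a root list *)

Definition list_refl (l : list vec) (i : nat) (B : basis) : basis :=
  let '(a, b, c) := rotate i B in
  unrotate i (vopp a, snd (climb 20 l a b), snd (climb 20 l a c)).

Definition wall (i : nat) (B : basis) : vec := fst (fst (rotate i B)).

Definition beq (B B' : basis) : bool :=
  let '(a, b, c) := B in let '(a', b', c') := B' in veq a a' && veq b b' && veq c c'.
Definition bmem (B : basis) (L : list basis) : bool := existsb (beq B) L.

Definition permv (p : nat) (v : vec) : vec :=
  let '(x, y, z) := v in
  match p with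
  | 0%nat => (x, y, z) | 1%nat => (y, z, x) | 2%nat => (z, x, y)
  | 3%nat => (y, x, z) | 4%nat => (x, z, y) | _ => (z, y, x)
  end.

(* The negated conditions say that the fuel of climb was sufficient. *)
Definition row_ok (l : list vec) (i : nat) (B : basis) : bool :=
  let '(a, b, c) := rotate i B in
  (rmem (vadd b a) l || rmem (vadd c a) l) &&
  negb (rmem (vadd (snd (climb 20 l a b)) a) l) &&
  negb (rmem (vadd (snd (climb 20 l a c)) a) l).

Definition vcoord (k : nat) (v : vec) : Z :=
  let '(x, y, z) := v in match k with 0%nat => x | 1%nat => y | _ => z end.

(** The walk alternates between the walls i and j. It fails unless each step crosses its wall from
    the negative side, that is, goes down one level. *)
Fixpoint descend (l : list vec) (n i j : nat) (B : basis) : option basis :=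
  match n with
  | O => Some B
  | S n => if nneg (wall i B) then None else descend l n j i (list_refl l i B)
  end.

(* cs are the coordinates of the roots at B; k is the third index, so the
   parabolic spanned by i and j has as many positive roots as cs has vectors
   without k-th coordinate. *)
Definition diamond (l cs : list vec) (B : basis) (i j k : nat) : bool :=
  if nneg (wall i B) then true else if nneg (wall j B) then true else
  match length (filter (fun c => vcoord k c =? 0) cs) with
  | O => false
  | S m =>
    match descend l (S m) i j B, descend l (S m) j i B with
    | Some X, Some Y => beq X Y
    | _, _ => false
    end
  end.

Definition chamber_ok (l : list vec) (others : list (list vec)) (B : basis) : bool :=
  let cs := map (coords (dual_basis B)) l in
  forallb (fun c => nneg c || nneg (vopp c)) cs &&
  forallb (fun i => row_ok l i B) [0; 1; 2]%nat &&
  forallb (fun l' => forallb (fun p =>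
    negb (forallb (fun c => vmem (canon (permv p c)) l') cs)) (seq 0 6)) others &&
  (diamond l cs B 0 1 2 && diamond l cs B 0 2 1 && diamond l cs B 1 2 0).

Fixpoint ascents (l : list vec) (L acc : list basis) : list basis :=
  match L with
  | [] => acc
  | B :: L =>
    ascents l L (fold_right (fun i acc =>
      if nneg (wall i B) then
        let B' := list_refl l i B in if bmem B' acc then acc else B' :: acc
      else acc) acc [0; 1; 2]%nat)
  end.

Definition is_wall (L : list basis) (v : vec) : bool :=
  existsb (fun B => existsb (fun i => veq v (wall i B)) [0; 1; 2]%nat) L.

(* L is one level of the breadth-first search, rest the roots that are not walls
   of the previous levels. *)
Fixpoint check_levels (n : nat) (l : list vec) (others : list (list vec))
    (rest : list vec) (L : list basis) : bool :=
  match n, L with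
  | _, [] => match rest with [] => true | _ => false end
  | O, _ => false
  | S n, _ =>
    let L' := ascents l L [] in
    forallb (chamber_ok l others) L &&
    (* Negative walls of the next level must lead back to this one. This makes the levels a grading
       and their union closed under all reflections. *)
    forallb (fun B => forallb (fun i =>
      nneg (wall i B) || bmem (list_refl l i B) L) [0; 1; 2]%nat) L' &&
    check_levels n l others (filter (fun v => negb (is_wall L v)) rest) L'
  end.

Fixpoint distinct (l : list vec) : bool :=
  match l with [] => true | v :: l => negb (vmem v l) && distinct l end.

Definition list_ok (l : list vec) : bool :=
  forallb (fun v => nneg v && (content v =? 1)) l && distinct l &&
  vmem e0 l && vmem e1 l && vmem e2 l.

Definition same_length (l l' : list vec) : bool := Nat.eqb (length l) (length l').
Definition veqs (l l' : list vec) : bool :=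
  same_length l l' && forallb (fun v => vmem v l') l.
Definition check_list (lists : list (list vec)) (l : list vec) : bool :=
  list_ok l &&
  check_levels 100 l (filter (fun l' => same_length l l' && negb (veqs l l')) lists)
    l [std_basis].

Definition cross_basis (i : nat) (B : basis) (m n : Z) : basis :=
  let '(x, y, z) := rotate i B in
  unrotate i (vopp x, vadd y (vscal m x), vadd z (vscal n x)).

Lemma beqE B B' : beq B B' = true <-> B = B'.
Proof.
destruct B as [[a b] c], B' as [[a' b'] c']; cbn [beq].
rewrite !andb_true_iff, !veqE; split; [now intros [[-> ->] ->] | now injection 1].
Qed.

Lemma bmemE B L : bmem B L = true <-> In B L.
Proof.
unfold bmem; rewrite existsb_exists; split.
- intros (X & HX & E); apply beqE in E; now subst.
- intros H; exists B; split; [exact H | now apply beqE].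
Qed.

Lemma nnegE v : nneg v = true <-> let '(x, y, z) := v in 0 <= x /\ 0 <= y /\ 0 <= z.
Proof. destruct v as [[x y] z]; cbn; rewrite !andb_true_iff, !Z.leb_le; tauto. Qed.

Lemma wall_mod i B : wall i B = wall (Nat.min i 2) B.
Proof. destruct B as [[a b] c]; now destruct i as [|[|i]]. Qed.

Lemma list_refl_mod l i B : list_refl l i B = list_refl l (Nat.min i 2) B.
Proof. destruct B as [[a b] c]; now destruct i as [|[|i]]. Qed.

Lemma min2_in i : In (Nat.min i 2) [0; 1; 2]%nat.
Proof. destruct i as [|[|[|i]]]; cbn; tauto. Qed.

Lemma climb_spec n T a b :
  let '(k, r) := climb n T a b in
  r = vadd b (vscal k a) /\ 0 <= k /\ (rmem b T = true -> rmem r T = true) /\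
  (forall j, 1 <= j <= k -> rmem (vadd b (vscal j a)) T = true) /\ k <= Z.of_nat n.
Proof.
revert b; induction n as [|n IH]; intros b; cbn [climb].
- split; [vring|]; split; [lia|]; split; [easy|]; split; [lia|lia].
- destruct (rmem (vadd b a) T) eqn:E.
  + specialize (IH (vadd b a)); destruct (climb n T a (vadd b a)) as [k r].
    destruct IH as (-> & Hk & Hr & Hj & Hn); split; [vring|]; split; [lia|]; split; [now auto|].
    split; [|lia]; intros j Hj1; destruct (Z.eq_dec j 1) as [->|].
    * rewrite <- E; f_equal; vring.
    * rewrite <- (Hj (j - 1)) by lia; f_equal; vring.
  + split; [vring|]; split; [lia|]; split; [easy|]; split; [lia|lia].
Qed.

Lemma climb_exact n T a b k : 0 <= k <= Z.of_nat n ->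
  (forall j, 1 <= j <= k -> rmem (vadd b (vscal j a)) T = true) ->
  rmem (vadd b (vscal (k + 1) a)) T = false ->
  climb n T a b = (k, vadd b (vscal k a)).
Proof.
revert b k; induction n as [|n IH]; intros b k Hk Hj He; cbn [climb].
- replace k with 0 by lia; f_equal; vring.
- destruct (Z.eq_dec k 0) as [->|Hk0].
  + replace (vadd b (vscal (0 + 1) a)) with (vadd b a) in He by vring.
    rewrite He; f_equal; vring.
  + assert (E1 : rmem (vadd b a) T = true) by (rewrite <- (Hj 1) by lia; f_equal; vring).
    rewrite E1, (IH (vadd b a) (k - 1)).
    * f_equal; [lia | vring].
    * lia.
    * intros j Hj1; rewrite <- (Hj (j + 1)) by lia; f_equal; vring.
    * rewrite <- He; f_equal; vring.
Qed.

Definition climbs (l : list vec) (a b : vec) : Z := fst (climb 20 l a b).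

Lemma list_refl_cross l i B : exists m n, 0 <= m /\ 0 <= n /\
  m = climbs l (wall i B) (snd (fst (rotate i B))) /\
  n = climbs l (wall i B) (snd (rotate i B)) /\
  list_refl l i B = cross_basis i B m n.
Proof.
unfold list_refl, cross_basis, wall, climbs; destruct (rotate i B) as [[a b] c]; cbn [fst snd].
pose proof (climb_spec 20 l a b) as Hb; pose proof (climb_spec 20 l a c) as Hc.
destruct (climb 20 l a b) as [m b'], (climb 20 l a c) as [n c'].
destruct Hb as (-> & Hm & _), Hc as (-> & Hn & _); exists m, n; now repeat split.
Qed.

Lemma det_cross i B m n : det (cross_basis i B m n) = - det B.
Proof. destruct B as [[x y] z]; destruct i as [|[|i]]; cbn [cross_basis rotate unrotate]; vring. Qed.

Lemma rotate_cross i B m n : let '(a, b, c) := rotate i B in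
  rotate i (cross_basis i B m n) = (vopp a, vadd b (vscal m a), vadd c (vscal n a)).
Proof. destruct B as [[x y] z]; now destruct i as [|[|i]]. Qed.

Lemma in_ascents l L acc B : In B (ascents l L acc) <->
  In B acc \/ exists i B0, In B0 L /\ nneg (wall i B0) = true /\ B = list_refl l i B0.
Proof.
revert acc; induction L as [|B0 L IH]; intros acc; cbn [ascents].
- split; [now left | intros [H|(i & B0 & [] & _)]; exact H].
- rewrite IH; cbn [fold_right].
  assert (Hstep : forall i acc, In B (if nneg (wall i B0) then
     let B' := list_refl l i B0 in if bmem B' acc then acc else B' :: acc else acc) <->
     In B acc \/ nneg (wall i B0) = true /\ B = list_refl l i B0).
  { clear; intros i acc; destruct (nneg (wall i B0)); cbn zeta; [|now intuition].
    destruct (bmem (list_refl l i B0) acc) eqn:E.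
    - apply bmemE in E; split; [now left | intros [H|[_ ->]]; assumption].
    - cbn [In]; intuition. }
  rewrite !Hstep; split.
  + intros [[[[H|H]|H]|H]|(i & B1 & H & H')]; [now left|..]; right;
      [exists 2%nat, B0 | exists 1%nat, B0 | exists 0%nat, B0 | exists i, B1]; cbn [In]; tauto.
  + intros [H|(i & B1 & [<-|H] & H1 & H2)]; [tauto| |right; now exists i, B1].
    left; rewrite wall_mod in H1; rewrite list_refl_mod in H2.
    pose proof (min2_in i) as [E|[E|[E|[]]]]; rewrite <- E in H1, H2; tauto.
Qed.

Section Levels.
Variables (l : list vec) (others : list (list vec)).

Fixpoint level (n : nat) : list basis :=
  match n with O => [std_basis] | S n => ascents l (level n) [] end.

Lemma check_levels_sound fuel rest n : check_levels fuel l others rest (level n) = true ->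
  exists N, (n <= N)%nat /\ level N = [] /\
   (forall k B, (n <= k)%nat -> In B (level k) -> chamber_ok l others B = true) /\
   (forall k B i, (n <= k)%nat -> In B (level (S k)) -> nneg (wall i B) = false ->
      In (list_refl l i B) (level k)) /\
   (forall v, In v rest -> exists k B i, In B (level k) /\ v = wall i B).
Proof.
revert rest n; induction fuel as [|fuel IH]; intros rest n; cbn [check_levels].
- destruct (level n) eqn:E; [|discriminate]; destruct rest; [intros _|discriminate].
  assert (Hk : forall k, (n <= k)%nat -> level k = []).
  { intros k; induction 1; [exact E|]; cbn [level]; now rewrite IHle. }
  exists n; split; [lia|]; split; [exact E|]; split; [|split].
  + intros k B Hnk; now rewrite Hk.
  + intros k B i Hnk; now rewrite Hk by lia.
  + intros v [].
- destruct (level n) as [|B0 L0] eqn:E.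
  + destruct rest; [intros _|discriminate].
    assert (Hk : forall k, (n <= k)%nat -> level k = []).
    { intros k; induction 1; [exact E|]; cbn [level]; now rewrite IHle. }
    exists n; split; [lia|]; split; [exact E|]; split; [|split].
    * intros k B Hnk; now rewrite Hk.
    * intros k B i Hnk; now rewrite Hk by lia.
    * intros v [].
  + rewrite <- E; clear B0 L0 E; cbn zeta; change (ascents l (level n) []) with (level (S n)).
    rewrite !andb_true_iff, !forallb_forall; intros [[H1 H2] H3].
    destruct (IH _ _ H3) as (N & HN & EN & K1 & K2 & K3).
    exists N; split; [lia|]; split; [exact EN|]; split; [|split].
    * intros k B Hk HB; destruct (Nat.eq_dec n k) as [<-|]; [now apply H1|].
      apply (K1 k); [lia | exact HB].
    * intros k B i Hk HB Hw; destruct (Nat.eq_dec n k) as [<-|]; [|apply K2; [lia|assumption..]].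
      specialize (H2 B HB); rewrite forallb_forall in H2.
      specialize (H2 _ (min2_in i)); rewrite <- wall_mod, <- list_refl_mod, Hw in H2.
      now apply bmemE.
    * intros v Hv; destruct (is_wall (level n) v) eqn:Ew.
      -- unfold is_wall in Ew; apply existsb_exists in Ew; destruct Ew as (B & HB & Ew).
         apply existsb_exists in Ew; destruct Ew as (i & _ & Ew); apply veqE in Ew.
         now exists n, B, i.
      -- apply K3; apply filter_In; now rewrite Ew.
Qed.

Record levels_ok : Prop := LevelsOk {
  levels_end : exists N, level N = [];
  levels_checked : forall n B, In B (level n) -> chamber_ok l others B = true;
  levels_down : forall n B i, In B (level (S n)) -> nneg (wall i B) = false ->
    In (list_refl l i B) (level n);
  levels_walls : forall v, In v l -> exists n B i, In B (level n) /\ v = wall i B }.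

Lemma check_levels_ok : check_levels 100 l others l [std_basis] = true -> levels_ok.
Proof.
intros H; destruct (check_levels_sound 100 l 0 H) as (N & _ & EN & H1 & H2 & H3).
split.
- now exists N.
- intros n B; apply H1; lia.
- intros n B i; apply H2; lia.
- exact H3.
Qed.
End Levels.

Lemma climbs_ge0 l a b : 0 <= climbs l a b.
Proof.
unfold climbs; pose proof (climb_spec 20 l a b) as H; destruct (climb 20 l a b); apply H.
Qed.

(** The right-hand side is symmetric in a and b; this is the source of the symmetric zero pattern of
    the Cartan matrices. *)
Lemma climbs_eq0 l a b : climbs l a b = 0 <-> rmem (vadd b a) l = false.
Proof.
unfold climbs; generalize 19%nat as n; intros n; cbn [climb].
destruct (rmem (vadd b a) l); [|easy].
pose proof (climb_spec n l a (vadd b a)) as H; destruct (climb n l a (vadd b a)).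
destruct H as (_ & H & _); cbn [fst]; split; [lia | easy].
Qed.

Lemma distinctE l : distinct l = true <-> NoDup l.
Proof.
induction l as [|v l IH]; cbn; [split; [constructor | easy]|].
rewrite andb_true_iff, IH, negb_true_iff, <- not_true_iff_false, memE; split.
- intros [H1 H2]; now constructor.
- inversion 1; tauto.
Qed.

Lemma nneg_antisym v : nneg v = true -> nneg (vopp v) = true -> v = (0, 0, 0).
Proof.
rewrite !nnegE; destruct v as [[x y] z]; cbn; intros H H'; apply vec_eq; lia.
Qed.

Lemma coords_opp D v : coords D (vopp v) = vopp (coords D v).
Proof. destruct D as [[x y] z]; vring. Qed.

Lemma coherent_opp D v : coherent D (vopp v) = coherent D v.
Proof.
unfold coherent; rewrite coords_opp.
replace (vopp (vopp (coords D v))) with (coords D v) by (destruct (coords D v) as [[x y] z]; vring).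
apply orb_comm.
Qed.

Lemma unimodular_rotate i B : unimodular (rotate i B) <-> unimodular B.
Proof.
unfold unimodular; replace (det (rotate i B)) with (det B); [easy|].
destruct B as [[a b] c]; destruct i as [|[|i]]; vring.
Qed.

Lemma coherent_rotate i B v : unimodular B ->
  coherent (dual_basis (rotate i B)) v = coherent (dual_basis B) v.
Proof.
intros U; apply eq_true_iff_eq; rewrite !coherentE by (try apply unimodular_rotate; exact U).
destruct B as [[a b] c]; destruct i as [|[|i]]; cbn [rotate]; [easy| |].
all: split; intros (x & y & z & -> & H).
- exists z, x, y; split; [vring | lia].
- exists y, z, x; split; [vring | lia].
- exists y, z, x; split; [vring | lia].
- exists z, x, y; split; [vring | lia].
Qed.

Lemma coherent_string a b c m k : unimodular (vopp a, vadd b (vscal m a), c) ->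
  coherent (dual_basis (vopp a, vadd b (vscal m a), c)) (vadd b (vscal k a)) = true -> k <= m.
Proof.
intros U H; apply coherentE in H; [|exact U]; destruct H as (x & y & z & E & Hs).
assert (Et : (m - k, 1, 0) = (x, y, z))
  by (apply (comb_inj _ _ _ U); rewrite <- E; vring).
injection Et as <- <- <-; lia.
Qed.

Lemma coherent_swap a b c v : unimodular (a, b, c) ->
  coherent (dual_basis (a, c, b)) v = coherent (dual_basis (a, b, c)) v.
Proof.
intros U; apply eq_true_iff_eq; rewrite !coherentE.
- split; intros (x & y & z & -> & H); exists x, z, y; split; (vring || lia).
- exact U.
- unfold unimodular in *; replace (det (a, c, b)) with (- det (a, b, c)) by vring; lia.
Qed.

Lemma coherent_strings i B m n k k' : unimodular B ->
  let '(a, b, c) := rotate i B in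
  coherent (dual_basis (cross_basis i B m n)) (vadd b (vscal k a)) = true ->
  coherent (dual_basis (cross_basis i B m n)) (vadd c (vscal k' a)) = true -> k <= m /\ k' <= n.
Proof.
intros U.
assert (U' : unimodular (cross_basis i B m n))
  by (unfold unimodular in *; rewrite det_cross; lia).
pose proof (rotate_cross i B m n) as E.
destruct (rotate i B) as [[a b] c]; intros H H'.
rewrite <- (coherent_rotate i), E in H, H' by exact U'.
apply (unimodular_rotate i) in U'; rewrite E in U'; split.
- exact (coherent_string _ _ _ _ _ U' H).
- rewrite <- coherent_swap in H' by exact U'.
  refine (coherent_string _ _ _ _ _ _ H').
  unfold unimodular in *.
  replace (det (vopp a, vadd c (vscal n a), vadd b (vscal m a)))
    with (- det (vopp a, vadd b (vscal m a), vadd c (vscal n a))) by vring; lia.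
Qed.

(** * The chambers reached from the standard one *)

Section Reached.
Variables (l : list vec) (others : list (list vec)).
Hypothesis ok : list_ok l = true.
Hypothesis checked : levels_ok l others.

Definition reached (B : basis) : Prop := exists n, In B (level l n).

Lemma list_root v : In v l -> nneg v = true /\ content v = 1.
Proof.
unfold list_ok in ok; rewrite !andb_true_iff, forallb_forall in ok; intros H.
destruct ok as ((((H1 & _) & _) & _) & _); specialize (H1 v H).
rewrite andb_true_iff, Z.eqb_eq in H1; exact H1.
Qed.

Lemma list_nodup : NoDup l.
Proof. unfold list_ok in ok; rewrite !andb_true_iff, distinctE in ok; tauto. Qed.

Lemma within_sign v : within l v -> nneg (vopp v) = negb (nneg v).
Proof.
intros Hv; destruct (nneg v) eqn:E, (nneg (vopp v)) eqn:E'; try easy.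
- rewrite (nneg_antisym _ E E') in Hv.
  destruct Hv as [H|H]; apply list_root in H; destruct H as [_ H]; discriminate H.
- destruct Hv as [H|H]; apply list_root in H; destruct H as [H _]; congruence.
Qed.

Lemma rmemE v : rmem v l = true <-> within l v.
Proof.
split; [apply rmem_within|].
intros H; unfold rmem, canon; apply memE; destruct (nneg v) eqn:E, H as [H|H]; try easy.
- pose proof (within_sign v (or_intror H)) as E'; rewrite E in E'; cbn [negb] in E'.
  apply list_root in H; destruct H; congruence.
- apply list_root in H; destruct H; congruence.
Qed.

Lemma within_std i : within l (wall i std_basis).
Proof.
unfold list_ok in ok; rewrite !andb_true_iff, !memE in ok.
left; destruct i as [|[|i]]; cbn; tauto.
Qed.

Lemma refl_wall i j B : (forall k, within l (wall k B)) -> within l (wall j (list_refl l i B)).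
Proof.
intros H.
assert (Hrot : forall k, within l (wall k (rotate i (list_refl l i B)))).
{ assert (E : rotate i (list_refl l i B) = let '(a, b, c) := rotate i B in
    (vopp a, snd (climb 20 l a b), snd (climb 20 l a c)))
    by (destruct B as [[a b] c]; now destruct i as [|[|i]]).
  rewrite E.
  assert (Hk : forall k, within l (wall k (rotate i B))).
  { intros k; destruct B as [[a b] c]; pose proof (H 0%nat); pose proof (H 1%nat).
    pose proof (H 2%nat); destruct i as [|[|i]], k as [|[|k]]; assumption. }
  destruct (rotate i B) as [[a b] c]; intros k.
  pose proof (climb_spec 20 l a b) as Sb; pose proof (climb_spec 20 l a c) as Sc.
  destruct (climb 20 l a b) as [m b'], (climb 20 l a c) as [n c'].
  destruct k as [|[|k]]; unfold wall; cbn [rotate fst snd].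
  - apply within_opp; exact (Hk 0%nat).
  - apply rmemE, Sb, rmemE; exact (Hk 1%nat).
  - apply rmemE, Sc, rmemE; exact (Hk 2%nat). }
destruct (list_refl l i B) as [[a b] c].
pose proof (Hrot 0%nat); pose proof (Hrot 1%nat); pose proof (Hrot 2%nat).
destruct i as [|[|i]], j as [|[|j]]; assumption.
Qed.

Lemma refl_unimodular i B : unimodular B -> unimodular (list_refl l i B).
Proof.
destruct (list_refl_cross l i B) as (m & n & _ & _ & _ & _ & ->).
unfold unimodular; rewrite det_cross; lia.
Qed.

Lemma level_succ n B : In B (level l (S n)) <->
  exists i B0, In B0 (level l n) /\ nneg (wall i B0) = true /\ B = list_refl l i B0.
Proof. cbn [level]; rewrite in_ascents; cbn [In]; tauto. Qed.

Lemma reached_ind (P : basis -> Prop) : P std_basis ->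
  (forall i B, P B -> P (list_refl l i B)) -> forall B, reached B -> P B.
Proof.
intros P0 PS B [n H]; revert B H; induction n as [|n IH]; intros B.
- intros [<-|[]]; exact P0.
- rewrite level_succ; intros (i & B0 & H & _ & ->); now apply PS, IH.
Qed.

Lemma reached_std : reached std_basis.
Proof. now exists 0%nat; left. Qed.

Lemma reached_unimodular B : reached B -> unimodular B.
Proof.
apply (reached_ind unimodular); [now left|]; intros i X; apply refl_unimodular.
Qed.

Lemma reached_wall i B : reached B -> within l (wall i B).
Proof.
intros H; revert i; apply (reached_ind (fun B => forall i, within l (wall i B))); try exact H.
- exact within_std.
- intros j X HX i; now apply refl_wall.
Qed.

Lemma reached_checked B : reached B -> chamber_ok l others B = true.
Proof.
intros [n H]; exact (levels_checked _ _ checked n B H).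
Qed.

Lemma reached_coherent B v : reached B -> within l v -> coherent (dual_basis B) v = true.
Proof.
intros HB; pose proof (reached_checked B HB) as H; unfold chamber_ok in H; cbn zeta in H.
rewrite !andb_true_iff, !forallb_forall in H; destruct H as ((H & _) & _).
destruct H as [H _].
intros [Hv|Hv]; [|rewrite <- coherent_opp]; apply H; now apply in_map.
Qed.

(** The standard basis has positive walls only, so level zero cannot occur. *)
Lemma level_down n B i : In B (level l n) -> nneg (wall i B) = false ->
  exists k, n = S k /\ In (list_refl l i B) (level l k).
Proof.
destruct n as [|n].
2: { intros HB Hw; exists n; split; [easy | now apply (levels_down _ _ checked)]. }
intros [<-|[]]; now destruct i as [|[|i]].
Qed.

(** Positive walls lead to the next level by construction, negative ones to the previous level by
    the check. *)
Lemma reached_refl i B : reached B -> reached (list_refl l i B).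
Proof.
intros [n H]; destruct (nneg (wall i B)) eqn:E.
- exists (S n); apply level_succ; now exists i, B.
- destruct (level_down _ _ _ H E) as (k & _ & K); now exists k.
Qed.

Lemma reached_root v : within l v -> exists B i, reached B /\ v = wall i B.
Proof.
assert (Hw : forall i B, wall i (list_refl l i B) = vopp (wall i B))
  by (intros i [[a b] c]; now destruct i as [|[|i]]).
assert (H : forall v, In v l -> exists B i, reached B /\ v = wall i B).
{ intros u Hu; destruct (levels_walls _ _ checked u Hu) as (k & B & i & HB & E).
  exists B, i; split; [now exists k | exact E]. }
intros [Hv|Hv]; [now apply H|].
destruct (H _ Hv) as (B & i & HB & E); exists (list_refl l i B), i; split; [now apply reached_refl|].
rewrite Hw, <- E; vring.
Qed.

Lemma reached_row i B : reached B ->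
  let '(a, b, c) := rotate i B in
  let '(m, b') := climb 20 l a b in let '(n, c') := climb 20 l a c in
  (m <> 0 \/ n <> 0) /\ rmem (vadd b' a) l = false /\ rmem (vadd c' a) l = false.
Proof.
intros HB; pose proof (reached_checked B HB) as H; unfold chamber_ok in H; cbn zeta in H.
rewrite !andb_true_iff in H; destruct H as [[[_ H] _] _]; rewrite forallb_forall in H.
specialize (H _ (min2_in i)); unfold row_ok in H.
replace (rotate (Nat.min i 2) B) with (rotate i B) in H
  by (destruct B as [[a b] c]; now destruct i as [|[|i]]).
destruct (rotate i B) as [[a b] c].
rewrite !andb_true_iff, !negb_true_iff, orb_true_iff in H.
assert (Hpos : forall k u, rmem (vadd u a) l = true -> fst (climb (S k) l a u) <> 0).
{ intros k u Hu; pose proof (climb_spec k l a (vadd u a)) as K.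
  cbn [climb]; rewrite Hu; destruct (climb k l a (vadd u a)).
  destruct K as (_ & K & _); cbn [fst]; lia. }
pose proof (Hpos 19%nat b); pose proof (Hpos 19%nat c).
destruct (climb 20 l a b), (climb 20 l a c); cbn [fst snd] in *; tauto.
Qed.

(** Coherence at B gives the lower bound and coherence at the reflected chamber the upper one. Hence
    [climb] finds the true end of a string although it only looks one vector ahead. *)
Lemma string_up i B : reached B -> let '(a, b, c) := rotate i B in
  (forall k, within l (vadd b (vscal k a)) -> 0 <= k <= climbs l a b) /\
  (forall k, within l (vadd c (vscal k a)) -> 0 <= k <= climbs l a c).
Proof.
intros HB; pose proof (reached_unimodular _ HB) as U.
pose proof (reached_refl i _ HB) as HB'.
destruct (list_refl_cross l i B) as (m & n & _ & _ & Em & En & E); rewrite E in HB'.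
pose proof (fun k k' => coherent_strings i B m n k k' U) as H1.
assert (Ub : unimodular (rotate i B)) by now apply unimodular_rotate.
assert (Hc : forall v, within l v -> coherent (dual_basis (rotate i B)) v = true)
  by (intros v Hv; rewrite coherent_rotate by exact U; now apply reached_coherent).
assert (Wa : forall k, within l (wall k (rotate i B))).
{ intros k; pose proof (reached_wall 0 B HB); pose proof (reached_wall 1 B HB).
  pose proof (reached_wall 2 B HB).
  destruct B as [[a b] c], i as [|[|i]], k as [|[|k]]; assumption. }
unfold wall in Em, En; pose proof (Wa 1%nat) as Wb; pose proof (Wa 2%nat) as Wc.
destruct (rotate i B) as [[a b] c]; cbn [fst snd] in Em, En; unfold wall in Wb, Wc.
cbn [rotate fst snd] in Wb, Wc; rewrite <- Em, <- En.
replace b with (vadd b (vscal 0 a)) in Wb by vring.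
replace c with (vadd c (vscal 0 a)) in Wc by vring.
split; intros k Hk; split.
- apply Hc, coherentE in Hk; [|exact Ub]; destruct Hk as (x & y & z & Ev & Hs).
  assert (Et : (k, 1, 0) = (x, y, z)) by (apply (comb_inj _ _ _ Ub); rewrite <- Ev; vring).
  injection Et as <- <- <-; lia.
- apply (H1 k 0); apply reached_coherent; assumption.
- apply Hc, coherentE in Hk; [|exact Ub]; destruct Hk as (x & y & z & Ev & Hs).
  assert (Et : (k, 0, 1) = (x, y, z)) by (apply (comb_inj _ _ _ Ub); rewrite <- Ev; vring).
  injection Et as <- <- <-; lia.
- apply (H1 0 k); apply reached_coherent; assumption.
Qed.

(** Climbing back along - a runs through the same string and stops at b, because b - a has mixed
    signs at B. Reflections are therefore involutions with equal rows at both ends. *)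
Lemma climbs_sym i B : reached B -> let '(a, b, c) := rotate i B in
  climb 20 l (vopp a) (snd (climb 20 l a b)) = (climbs l a b, b) /\
  climb 20 l (vopp a) (snd (climb 20 l a c)) = (climbs l a c, c).
Proof.
intros HB; pose proof (string_up i B HB) as Hs.
assert (Wa : forall k, within l (wall k (rotate i B))).
{ intros k; pose proof (reached_wall 0 B HB); pose proof (reached_wall 1 B HB).
  pose proof (reached_wall 2 B HB).
  destruct B as [[a b] c], i as [|[|i]], k as [|[|k]]; assumption. }
pose proof (Wa 1%nat) as Wb; pose proof (Wa 2%nat) as Wc.
destruct (rotate i B) as [[a b] c]; unfold wall in Wb, Wc; cbn [rotate fst snd] in Wb, Wc.
assert (H : forall u, within l u -> (forall k, within l (vadd u (vscal k a)) -> 0 <= k) ->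
  climb 20 l (vopp a) (snd (climb 20 l a u)) = (climbs l a u, u)).
{ clear -ok; intros u Hu Hk; unfold climbs.
  pose proof (climb_spec 20 l a u) as K; destruct (climb 20 l a u) as [m u'].
  destruct K as (-> & Hm & _ & Hj & Hm'); cbn [fst snd].
  rewrite (climb_exact _ _ _ _ m).
  - f_equal; vring.
  - lia.
  - intros j Hj1.
    replace (vadd (vadd u (vscal m a)) (vscal j (vopp a))) with (vadd u (vscal (m - j) a)) by vring.
    destruct (Z.eq_dec j m) as [->|]; [|apply Hj; lia].
    apply rmemE; replace (vadd u (vscal (m - m) a)) with u by vring; exact Hu.
  - apply not_true_iff_false; intros Hr; apply rmemE in Hr.
    replace (vadd (vadd u (vscal m a)) (vscal (m + 1) (vopp a))) with (vadd u (vscal (-1) a))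
      in Hr by vring.
    apply Hk in Hr; lia. }
destruct Hs as [H1 H2]; split; apply H; try assumption; intros k Hk;
  [apply (H1 k Hk) | apply (H2 k Hk)].
Qed.

Lemma list_reflK i B : reached B -> list_refl l i (list_refl l i B) = B.
Proof.
intros HB; pose proof (climbs_sym i B HB) as H; unfold list_refl.
assert (Er : forall a b c, rotate i (unrotate i (a, b, c)) = (a, b, c))
  by (intros; now destruct i as [|[|i]]).
assert (Eu : unrotate i (rotate i B) = B) by (destruct B as [[a b] c]; now destruct i as [|[|i]]).
rewrite <- Eu at 2; destruct (rotate i B) as [[a b] c]; rewrite Er.
destruct H as [-> ->]; cbn [snd]; f_equal; f_equal; f_equal; vring.
Qed.

(** That the new vectors are roots bounds m and n from above by the strings, and coherence bounds
    them from below. The root set thus determines what lies across a wall, be it in an abstract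
    arrangement or in a given Cartan scheme. *)
Lemma reflection_unique i B m n : reached B ->
  (forall v, within l v -> coherent (dual_basis (cross_basis i B m n)) v = true) ->
  (forall k, within l (wall k (cross_basis i B m n))) ->
  cross_basis i B m n = list_refl l i B /\
  let '(a, b, c) := rotate i B in m = climbs l a b /\ n = climbs l a c.
Proof.
intros HB Hc Hw; pose proof (string_up i B HB) as Hs.
pose proof (coherent_strings i B m n) as K.
destruct (list_refl_cross l i B) as (m' & n' & Hm' & Hn' & Em & En & E).
assert (Hb : let '(a, b, c) := rotate i B in
   within l (vadd b (vscal m a)) /\ within l (vadd c (vscal n a)) /\
   within l (vadd b (vscal m' a)) /\ within l (vadd c (vscal n' a))).
{ pose proof (fun k => refl_wall i k B (fun k => reached_wall k B HB)) as Hr; rewrite E in Hr.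
  pose proof (Hw 0%nat); pose proof (Hw 1%nat); pose proof (Hw 2%nat).
  pose proof (Hr 0%nat); pose proof (Hr 1%nat); pose proof (Hr 2%nat).
  clear -H H0 H1 H2 H3 H4; destruct B as [[a b] c], i as [|[|i]]; cbn in *; tauto. }
unfold wall in Em, En; destruct (rotate i B) as [[a b] c]; cbn [fst snd] in Em, En.
destruct Hb as (H1 & H2 & H3 & H4); destruct Hs as [Hs1 Hs2].
apply Hs1 in H1; apply Hs2 in H2.
destruct (K m' n' (reached_unimodular _ HB) (Hc _ H3) (Hc _ H4)).
assert (E1 : m = m') by lia; assert (E2 : n = n') by lia.
rewrite E, E1, E2; repeat split; congruence.
Qed.

Lemma nneg_wall_refl i B : reached B ->
  nneg (wall i (list_refl l i B)) = negb (nneg (wall i B)).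
Proof.
intros HB.
replace (wall i (list_refl l i B)) with (vopp (wall i B))
  by (destruct B as [[a b] c]; now destruct i as [|[|i]]).
now apply within_sign, reached_wall.
Qed.

(** A chamber of positive level has a negative wall, the standard one has none. Crossing such a wall
    lowers both levels by one. *)
Lemma level_inj n m B : In B (level l n) -> In B (level l m) -> n = m.
Proof.
revert m B; induction n as [|n IH]; intros [|m] B Hn Hm.
- easy.
- apply level_succ in Hm; destruct Hm as (i & B0 & H0 & Hw & ->).
  assert (K : nneg (wall i (list_refl l i B0)) = false)
    by (rewrite nneg_wall_refl, Hw; [easy | now exists m]).
  destruct (level_down _ _ _ Hn K) as (k & E & _); discriminate E.
- apply level_succ in Hn; destruct Hn as (i & B0 & H0 & Hw & ->).
  assert (K : nneg (wall i (list_refl l i B0)) = false)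
    by (rewrite nneg_wall_refl, Hw; [easy | now exists n]).
  destruct (level_down _ _ _ Hm K) as (k & E & _); discriminate E.
- pose proof Hn as Hn'; apply level_succ in Hn; destruct Hn as (i & B0 & H0 & Hw & EB).
  assert (K : nneg (wall i B) = false)
    by (rewrite EB, nneg_wall_refl, Hw; [easy | now exists n]).
  destruct (level_down _ _ _ Hn' K) as (k & [= <-] & K1).
  destruct (level_down _ _ _ Hm K) as (k & [= <-] & K2).
  f_equal; exact (IH _ _ K1 K2).
Qed.

(** Induction from the top level downwards; it is well founded because some level is empty and all
    later ones are then empty too. *)
Lemma reached_up_ind (P : basis -> Prop) :
  (forall B, reached B -> (forall i, nneg (wall i B) = true -> P (list_refl l i B)) -> P B) ->
  forall B, reached B -> P B.
Proof.
intros HP; destruct (levels_end _ _ checked) as [N HN].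
assert (Hempty : forall n, (N <= n)%nat -> level l n = []).
{ intros n; induction 1; [exact HN|]; cbn [level]; now rewrite IHle. }
assert (H : forall k n B, (N - n <= k)%nat -> In B (level l n) -> P B).
{ induction k as [|k IH]; intros n B Hk HB.
  - rewrite Hempty in HB by lia; destruct HB.
  - apply HP; [now exists n|]; intros i Hi; destruct (Nat.le_gt_cases N n).
    + rewrite Hempty in HB by lia; destruct HB.
    + apply (IH (S n)); [lia|]; apply level_succ; now exists i, B. }
intros B [n HB]; exact (H N n B ltac:(lia) HB).
Qed.

(** The list holds one root of each pair, so this is the number m_ij at B for the two indices i, j
    other than k. *)
Definition plane_count (k : nat) (B : basis) : nat :=
  length (filter (fun c => vcoord k c =? 0) (map (coords (dual_basis B)) l)).

Lemma vcoord_cross i k B m n v : unimodular B -> Nat.min i 2 <> Nat.min k 2 ->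
  vcoord k (coords (dual_basis (cross_basis i B m n)) v) = vcoord k (coords (dual_basis B) v).
Proof.
intros U Hik.
assert (U' : unimodular (cross_basis i B m n))
  by (unfold unimodular in *; rewrite det_cross; lia).
pose proof (comb_coords _ v U') as E.
destruct (coords (dual_basis (cross_basis i B m n)) v) as [[x y] z].
rewrite <- E.
assert (H : exists t, comb (cross_basis i B m n) (x, y, z) = comb B t /\ vcoord k t = vcoord k (x, y, z)).
{ destruct B as [[a b] c], i as [|[|i]]; cbn [cross_basis rotate unrotate].
  - exists (m * y + n * z - x, y, z); split; [vring|].
    destruct k as [|[|k]]; cbn in *; lia.
  - exists (x, m * z + n * x - y, z); split; [vring|].
    destruct k as [|[|k]]; cbn in *; lia.
  - exists (x, y, m * x + n * y - z); split; [vring|].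
    destruct k as [|[|k]]; cbn in *; try lia. }
destruct H as (t & -> & <-); now rewrite coords_comb.
Qed.

(** Crossing any wall but the k-th leaves the k-th coordinate of every vector unchanged, so m_ij is
    constant on a walk through the walls i and j. *)
Lemma plane_count_refl i k B : reached B -> Nat.min i 2 <> Nat.min k 2 ->
  plane_count k (list_refl l i B) = plane_count k B.
Proof.
intros HB Hik; destruct (list_refl_cross l i B) as (m & n & _ & _ & _ & _ & ->).
pose proof (reached_unimodular _ HB) as U; unfold plane_count.
generalize l as T; clear HB; induction T as [|v T IH]; cbn [map filter]; [easy|].
rewrite vcoord_cross by assumption.
destruct (vcoord k (coords (dual_basis B) v) =? 0); cbn [length]; now rewrite IH.
Qed.

Lemma diamond_descend i j k B : reached B ->
  (i < 3)%nat -> (j < 3)%nat -> i <> j -> k = (3 - i - j)%nat ->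
  nneg (wall i B) = false -> nneg (wall j B) = false ->
  exists m X, plane_count k B = S m /\
    descend l (S m) i j B = Some X /\ descend l (S m) j i B = Some X.
Proof.
intros HB Hi Hj Hij Hk Hwi Hwj.
(* Each pair of indices is checked in one order only. *)
assert (H : diamond l (map (coords (dual_basis B)) l) B i j k = true \/
            diamond l (map (coords (dual_basis B)) l) B j i k = true).
{ pose proof (reached_checked B HB) as H; unfold chamber_ok in H; cbn zeta in H.
  rewrite !andb_true_iff in H; destruct H as (_ & (H1 & H2) & H3).
  destruct i as [|[|[|i]]], j as [|[|[|j]]]; try lia; cbn in Hk; subst k; tauto. }
unfold diamond in H; rewrite Hwi, Hwj in H.
fold (plane_count k B) in H; destruct (plane_count k B) as [|m]; [destruct H; discriminate|].
exists m.
destruct (descend l (S m) i j B) as [X|], (descend l (S m) j i B) as [Y|];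
  try (destruct H; discriminate).
exists X; repeat split; destruct H as [H|H]; apply beqE in H; now subst.
Qed.
End Reached.

Lemma canon_inj u v : canon u = canon v -> u = v \/ u = vopp v.
Proof.
unfold canon; destruct (nneg u), (nneg v); intros E; [now left | now right | right | left].
- rewrite <- E; vring.
- rewrite <- (vopp_opp u), E; vring.
Qed.

Lemma permv_opp p v : permv p (vopp v) = vopp (permv p v).
Proof. destruct v as [[x y] z]; now destruct p as [|[|[|[|[|p]]]]]. Qed.

Lemma permv_inj p u v : permv p u = permv p v -> u = v.
Proof.
destruct u as [[x y] z], v as [[x' y'] z'].
destruct p as [|[|[|[|[|p]]]]]; cbn; now intros [= -> -> ->].
Qed.

Lemma permv_min p v : permv p v = permv (Nat.min p 5) v.
Proof. destruct v as [[x y] z]; now destruct p as [|[|[|[|[|p]]]]]. Qed.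

Lemma permv_comp p q : exists r, forall v, permv p (permv q v) = permv r v.
Proof.
assert (H : exists r, forall x y z, permv p (permv q (x, y, z)) = permv r (x, y, z)).
{ destruct p as [|[|[|[|[|p]]]]], q as [|[|[|[|[|q]]]]]; cbn [permv];
  solve [now exists 0%nat | now exists 1%nat | now exists 2%nat
        | now exists 3%nat | now exists 4%nat | now exists 5%nat]. }
destruct H as [r H]; exists r; intros [[x y] z]; apply H.
Qed.

Lemma canon_nodup l f : list_ok l = true -> (forall u v, f u = f v -> u = v) ->
  (forall v, f (vopp v) = vopp (f v)) -> NoDup (map (fun v => canon (f v)) l).
Proof.
intros ok Hinj Hopp; apply NoDup_map_NoDup_ForallPairs; [|now apply list_nodup].
intros u v Hu Hv E; apply canon_inj in E; rewrite <- Hopp in E.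
destruct E as [E|E]; apply Hinj in E; [exact E|].
pose proof (within_sign l ok v (or_introl Hv)) as S.
rewrite <- E in S; apply (list_root l ok) in Hu, Hv.
destruct Hu as [Hu _], Hv as [Hv _]; rewrite Hu, Hv in S; discriminate.
Qed.

Lemma coords_inj B u v : unimodular B ->
  coords (dual_basis B) u = coords (dual_basis B) v -> u = v.
Proof. intros U E; now rewrite <- (comb_coords B u U), E, comb_coords. Qed.

Lemma vcoord_canon k v : (vcoord k (canon v) =? 0) = (vcoord k v =? 0).
Proof.
unfold canon; destruct (nneg v); [easy|].
apply eq_true_iff_eq; rewrite !Z.eqb_eq; destruct v as [[x y] z].
destruct k as [|[|k]]; cbn; lia.
Qed.

Definition plane_list (l : list vec) (k : nat) (B : basis) : list vec :=
  filter (fun c => vcoord k c =? 0) (map (fun v => canon (coords (dual_basis B) v)) l).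

Lemma plane_list_length l k B : length (plane_list l k B) = plane_count l k B.
Proof.
unfold plane_list, plane_count; induction l as [|v l IH]; cbn [map filter]; [easy|].
rewrite vcoord_canon; destruct (vcoord k (coords (dual_basis B) v) =? 0); cbn [length]; now rewrite IH.
Qed.

Lemma plane_list_nodup l k B : list_ok l = true -> unimodular B -> NoDup (plane_list l k B).
Proof.
intros ok U; apply NoDup_filter, canon_nodup; [exact ok | |].
- intros u v; now apply coords_inj.
- intros v; apply coords_opp.
Qed.

Lemma plane_listP l others k B w : list_ok l = true -> levels_ok l others -> reached l B ->
  In w (plane_list l k B) <-> vcoord k w = 0 /\ nneg w = true /\ within l (comb B w).
Proof.
intros ok lv HB; pose proof (reached_unimodular _ _ HB) as U; unfold plane_list.
assert (Hn : forall v, In v l -> nneg (canon (coords (dual_basis B) v)) = true).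
{ intros v Hv; pose proof (reached_coherent _ _ lv B v HB (or_introl Hv)) as H.
  unfold coherent in H; unfold canon; destruct (nneg (coords (dual_basis B) v)) eqn:E; easy. }
rewrite filter_In, Z.eqb_eq, in_map_iff; split.
- intros ((v & <- & Hv) & Hk); split; [exact Hk|]; split; [now apply Hn|].
  unfold canon; destruct (nneg (coords (dual_basis B) v));
    rewrite ?comb_opp, comb_coords by exact U; [now left|].
  apply within_opp; now left.
- intros (Hk & Hw & H); split; [|exact Hk].
  assert (K : exists v, In v l /\ (v = comb B w \/ v = comb B (vopp w))).
  { destruct H as [H|H]; [exists (comb B w) | exists (comb B (vopp w)); rewrite comb_opp];
      split; auto. }
  destruct K as (v & Hv & E); exists v; split; [|exact Hv].
  destruct E as [E|E]; pose proof (Hn v Hv) as Hc; rewrite E, coords_comb in Hc |- * by exact U.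
  + unfold canon; now rewrite Hw.
  + unfold canon in *; destruct (nneg (vopp w)) eqn:Ev; [|vring].
    pose proof (nneg_antisym w Hw Ev) as ->; reflexivity.
Qed.

(** * Comparison of two root lists *)

Section TwoLists.
Variables l l' : list vec.
Hypotheses (ok : list_ok l = true) (ok' : list_ok l' = true).

Lemma map_length_le B q : unimodular B ->
  (forall v, within l v -> within l' (permv q (coords (dual_basis B) v))) ->
  (length l <= length l')%nat.
Proof.
intros U H; pose (f v := canon (permv q (coords (dual_basis B) v))).
rewrite <- (length_map f l); apply NoDup_incl_length.
- apply canon_nodup; [exact ok | |].
  + intros u v E; exact (coords_inj B u v U (permv_inj _ _ _ E)).
  + intros v; now rewrite coords_opp, permv_opp.
- intros w Hw; apply in_map_iff in Hw; destruct Hw as (v & <- & Hv).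
  apply memE; apply (rmemE l' ok'); apply H; now left.
Qed.

(** If l' differed from l as a set, it would be among the lists of the same length that [chamber_ok]
    has tested against B in all six orders. *)
Lemma check_list_unique lists B q : In l' lists ->
  levels_ok l (filter (fun l' => same_length l l' && negb (veqs l l')) lists) ->
  reached l B -> length l = length l' ->
  (forall v, within l v -> within l' (permv q (coords (dual_basis B) v))) ->
  forall v, In v l <-> In v l'.
Proof.
intros Hl' checked HB El H.
assert (El' : same_length l l' = true) by now apply Nat.eqb_eq.
assert (Eq : veqs l l' = true).
{ apply not_false_iff_true; intros E.
  pose proof (reached_checked _ _ checked B HB) as K; unfold chamber_ok in K; cbn zeta in K.
  rewrite !andb_true_iff in K; destruct K as ((_ & K) & _).
  rewrite forallb_forall in K; specialize (K l').
  rewrite filter_In, El', E in K; specialize (K (conj Hl' eq_refl)).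
  rewrite forallb_forall in K; specialize (K (Nat.min q 5)).
  rewrite in_seq in K; specialize (K ltac:(lia)).
  apply negb_true_iff, not_true_iff_false in K; apply K; apply forallb_forall.
  intros c Hc; apply in_map_iff in Hc; destruct Hc as (v & <- & Hv).
  rewrite <- permv_min; apply (rmemE l' ok'); apply H; now left. }
unfold veqs in Eq; apply andb_true_iff in Eq; destruct Eq as [_ Eq].
rewrite forallb_forall in Eq.
assert (Hincl : incl l l') by (intros v Hv; now apply memE, Eq).
intros v; split; [apply Hincl|].
apply NoDup_length_incl; [now apply list_nodup | lia | exact Hincl].
Qed.
End TwoLists.

(** * The certificates *)

(* Tokens are written in base 64 with the characters from 47 on; the characters from
   111 on are the non-final digits, in base 16. *)
Fixpoint decode (acc : N) (s : string) : list positive :=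
  match s with
  | EmptyString => []
  | String c s =>
    let d := (N_of_ascii c)%N in
    (* Characters below code 47, such as the line breaks inside the strings, are skipped. *)
    if (d <? 47)%N then decode acc s else
    if (d <? 111)%N then N.succ_pos (64 * acc + d - 48) :: decode 0 s
    else decode (16 * acc + d - 111) s
  end.

Local Open Scope string_scope.

Definition cert_level2 : string :=
 "CEGDFAB@CA?@AB??DFAB@@@CFAB?EA?@AAEGABTD@APA??A".

(* Indexed by the largest entry q and by the other entry n of the starting row. *)
Definition cert_rows : list (list string) :=
 [[];
 ["?UPae`Pp3p1?j10p/pAJ02aQ";
"?UEI2@P"];
 ["?UEWQQp4pY4dpY6TY2DY3p5p0`pErH4p@p0Sr83Oa_eaQpEp@`pEp@p0rCp91r?rQpQa@?J=5`OAp@?@A`p0`SQQper83p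
`pPSQpcp_p3qh<p/_`QOp?p?QQ?A@A?AJ74Oa_eqCq?@Ap_qJ64`Oa_p1p5p1aqeq`qPq5q0p@q5q0pPpSp91pOpapOpap
1@?J=5q0p/Aq0_Aq`qPq5q0?ApUQ?pPp0p3J64p/J44p1AQ";
"?Tp92Dp94UEqX3@CfQQQpGpAbpUpPCpI3?pPCi1?_OpSpOp?p5i4p0Paaaq0s0Vp?p/p1`J94?p/`A?PCfaaQp5p7p1bpE
p@CpI3?p@Ci1?_OpSpOp?p5i3p0Paaaq0r`Vp?p/p1`J94?p/`Ap0pASQpBp?_Tp97PPqSqOq?qCq?q/p1aq3q/q/paaap
bJ<1pOrJ91q/pP?q?`?qOq3@?q/@QJ34p?_q3q/p_pcp_pOp1`AqEq@Aq1pR@?q:91?q@q@pQJ51p?p0ApO`AJ22O?";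
"?TpI3Vi1DpI5UEr84@Cqh3?PaSSBerH5`CCpI3???OO"];
 ["?UEWQQp5esH6p5Up4D@CsH6ABs85?p0CABBD@pDp@A?p@QBb_OUpY6pRpOq2pBp?`CFA@A?EEt8E@q0A@A?EtX?A@?@AAq
/pO`Cr4r0Csh8?EsX7A?@?A???p4DTesX5@CsH4A@Abp2p/p/b_Ap5Ur4r0CApUpPC?EA@?@Ap0p0Fp5`?A`OVp3p1BrIC
?AUr9BPPO@AqA?EpapQOO@AAQA_PCFA@ABqY8?AUqEsX6p`CsH5A@AbqRp/p/p2t87p/p/qEq@epEpEp@C?EsCs?@As?s?
p?p7p1?q`dq94Pr5r0c_p1_a_a?A?@A@?_p1p/p/p1aa`OOtPt5t0t0sPaaaPA?@s`t1t1t1t0rPr0q@q1p`p_q0q1p?p?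
p@p/p0at/qBrar_r_q@q1q/pOpQpQpQpOpQpQp0`OQy4sQ@?ArBuZU2r?s_q?@p0p0?A`FpUp@?ApPpP?caapCrICp?__e
auCu?@Au?PPA@A?@`p1a_p1QO@AA_@?@AAp0CFApEs85p4p0PRpI3OOUqDq@CsH6A@AbqRp/p/p2t87p/p/qEq@epEpEp@
C?EsCs?@As?s?p?p7p1?q`dq94Pr5r0c_p1_a_a?A?@A@?_p1p/p/p1aa`OOtPt5t0t0sPaaaPA?@s`t1t1t1t0rPr0q@q
1p`p_q0q1p?p?p@p/p0at/qBrar_r_q@q1q/pOpQpQpQpOpQpQp0`OQy4sQ@?ArBuZU2r?s_q?@p0p0?A`FpUp@?ApPpP?
caapCsXCp?__eauCu?@Au?PPA@A?@`p1a_p1QO@AA_@?@Ap0Pp3Sc_pCbc_qDq@CA@A?p2Eqbq_pOpOUe`CA@?@A@p`Ap/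
_EqiAABD@@Gq4q0Csh8ABBtX:?Aq?EshD@QSORpUpE@QQODROAUsI?@@p@OQ?ABqDq@CsX7ABBtH9?AqOEsHB@QSOpUpE@
QQB?AUqi8@p@Q??A?@?_OWWQWQUpY2EpY4q2q/Dr4rI1r0CsX7?Q@Ap5p1pEsh>p@TPpBSQQp3tXCOOGrI;A?Er9:Ap?p?
s?r?rP``fpepUOQQpVqi7OPA@A?@A?p`_A@?@A?A@Ap1O`PVFA@A?As`eCsh8?QPPWQp`rVrQr?_QQpQbOOpBqI>PP?@?Q
Q?@@rQr?aQPA?@QOA?PA?sOs0w@pdp`p_pPPQOtBt?tPsP`_QtZP2t?pOP?@A?A@AQ?AdTPPr@CsH6?Q@p?E@qdq/aaa`_
`Pq0fAtUt@?AOOQPa`a`q_r1QPA?u_x@pTqAp0ArJN3pP?A?A@?@APQ?AdTPPrPCs85?Q@ApOpEpAr4q?pe`p1aa``_p0P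
qPpFpAp3pI1p/p/pAaa`A?u/qOxOr?q4q0q/p`p``aa_s?Ap4Bqa@zgzarQrA`Pp:N3zaz`raJJ3`q0?@QOAvAt/OA@qGq
Aq@p``OOqUscs_A?A@jI1s_saQtZF3AqA@As7r`?As1s0q/p`pOpOpOpOpaqDQPPOQxJA4`p@PQA@Abperh4b_pBp?qDqi
1q@q4q0dqi9p5rX7`pDp@p3p1p1pSt88pO__WGAEq96rRq3q1q1qSthBOOGrY6Ap_ErI5ArOrOq_p/p@``fpepUOQQpVr9
<OPA@A?@A?p`_A@?@A?A@AA?A@s/ApTp@p/p5@qD_aaPO`Pq`q0OpCp/pAQOPPOq?p1A?A@?@Ap@Qp/pApAeap5sH<p0TP
rBrRp2q3q1q1qSthBOOGrY5Ap_ErI4Ap/rOr?qOpOqcqaqarCsX=r?__r_ga?@Arcr_s1s1p/p1p/p/p1p/Ou/r?s5@QQ?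
q5p`p0p0a__`?q@vav`TpPp@p?aQApa@QQO@b_u7u1u1PPu`fx5weri2w`?@Ax0OA@?@AQu1u0T?QwewUrY2wP?@AQO@A_
OuAu@rar0p4Tqi1Aar_s1s/p?p1Pa`_`_sGsAsApA``t@r7fvUvErY2v@?@AvPOA@?@AQr1sAs@pApAp@pDp/pAvep4qi1
aQO@?@Ap1aq_r1r/rAQpEp@pQd@rCr?rQrQpOpapQpQpOpOpQpOpOpOp/PPv/sOqWqQpAp1`Pp`rGfwUwerY2w`w`?AwPO
A@?@AQqAqQpAp0p0C?QvUpTqi1p1QO@?@AArAr?_rErUqEUqi1P?@Aq@?@ArPrP?Ar@r@s5s0?As0a__p1`aOA@?A@?Atj
K4pAap?_Ap2p/p2p/qdq`qTpY1qPp5qH<dpY7`pdp@p3ap3t88p/O@q/ga?pPPqcqaqarCrX@OOrOga?@Aqcq_Or3r/aap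
_seqUpY1A?A@?@Ap0pAp?p?p1p/p0p0pAp0a_@qBq?p?pBp?p/``Qcq94___GeriH`QQczgr@?Ar@p/Oq5s8Jp@p?p1p1a
__PQ_OPaQPOAp?PAq?A?@xQxPT?Q?|U`p1QPO`PS?QQOOPPOOQ?@A@?A@?A@AqO_Pa`POtWpGQrWri5QO@pAtQtPT?QxEP
pDOQQOO@Ap0S?QQOOPPOOQ?@A@?AQO@?@AAaq_r1r/Ap5p0pAd@qC_p1aa___p0?s?q_tUPaQ?qEp`p0p0a__`?q@xAx@T
pPp@p?aQApaPaQO@b_vWvQvQPPw@fzUueri2u`?@AzPOA@?@AQvQvPT?QzEuUrY2uP?@AQO@A_Ovav`raq`p4Tqi1Aaq/p
/pAp/p0pApA_``?u7u1u1pQ``v0rGfyEtUrY2tP?@Ay@OA@?@AQrAu1u0pQpQp@pDp/pAyUp4qi1aQO@?@Ap1p1ap/pAp?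
EaQer8A`dPSQQp3r8Bp/__pOga?@Ascs_t1t1p/p1p/p/p1p/Ov/r?s5@QQ?q5p`p0p0a___p0POt1s@r@dq0p@_aQQpa@
QQO@b?r7r1qAPPr0f{5y5ri2y0?@A{0OA@?@AQr1q@T?QzexerY2x`?@AQO@A_OuAu@rar0Tp4qi1aAs_t1t/p?p1Pa`_`
_sGsAsApA``t@r7fwUyUrY2yPw`?AwPOA@?@AQr1sAs@pApAp@pDp/pAwep4qi1aQO@?@Ap1aOa_Ap5p0pAd@s3s/sAsAp
OpapQpQpOpOpQpOpOpOp/PPv_sOqWqQpAp1`Pp`rGfzUxUrY2xP?@AzPOA@?@AQqAqQpAp0p0C?QvEpTqi1p1QO@?@AAr_
s1_uEsEeq5qi1q0?@A`?@As@?@Au@u@ses`?As`QQP?A@?A@?A@?AtjK4p1Ap/p/p/p5Up5p0e`pEeSOOp6p1aapQp2Bq9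
3?A@?@p/p@p?p?p?pPp0p0q5q0avDt@A?v@qQp1OOPP?@As5rAr0POQ@A?z@qPt3Q?rjI1t1rQ_s:F1s0q0Oa_p1p1aPPp
dOpTOUpi8tdr`qTqPQQRshEOOQQv`q`pUsXDpPpPpPpPp6sHCp1p1p/p/qOqaqapEp@pQp@a`aOPr5r0AcqY1_p1@?A@A?
PPOOA@Asera@?sJU2rar1pAqPQ?t`s0qdq`A?q`p@_p1p/aQqCqCq?@Aq?qVqQq3q3p0Aq/qFqAqEq@q0q0q0q0p`pQpQp
QpQpQpQPPQOa`POOPPa@z@qaOAq7@AJP2papQtZN2pPpPpPpapQpApApA___aazdz`y0Os_rRrOq0``_a_O@A@A?s/{d{`
zPp0p1p/p/p1p0p0OOQz/sOu5@Aybp0AtJU2y_tQw/t/qQrOx`s?r/pPpOp0_s2A@s/q/Aq5@AJN2pA@u:J3q/qApP``QQ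
PO@?AqZF3q?qQp0PQQ?@QO@QQ@?p`tSZF3r/Aq:D2Op`A@?P?@Ap0Ce`?A`OOp6fVQQRpY6sDpFpAOEsDPWWQBrYE?QOA@
A@?A?@s@qPp/OPgQQp5p_@APPA@?a@?@As@qPq1p?Op/pSpSpO@ApOgPa`a`a@?Q@?rQpAOa``QQOPPOt`sOr`QrjA2pOP
AAp1aPA?q1pOpR@ApJ;2pOA_AQ";
"?UEr84WVD@CFAAQQBROOpUUpDp@p0SsX6?@WsH5APp0`VpDsH5p@ASs84O@?gpWAA?qFqApbp_sDrY1s@`drY>qGStH3OO
@raga?pPPSsX>OO@?p5qWAqQqOq`p1p/p@pEp@pAp0p1p1avTp?_PPrDp_pO_``aOOQ?A?A?p`p@p@p0?@?aqAp0pA`ap3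
OOqCsfrDpSp6r4r0AS?Gri?A?A@?@?A@A?QpOQ?`?@?r0aa?A?A@?@?q_q?q?@tQga?pPPSsH=OO@sC`?s?rAPa`a_OPPa
aa_@A?AwAt1vAv?vP`eQQ{TtOs/qP`OOt2r@?tZR4p`P`ap/_p1QPs0pUpQcpesHBp`PSQsCs?@?s/OQQPPOOQQO@A@OQ@
A?`_Ap_paQPPFAqDq0A?q@q@pAQp3_pS_QpaR?u6u1@?u1PP?@?QV?Q@?A@A?@?AQQ@Abq4s84q0Ap2p/p/p/p3p3p/qGq
Ar5pi1r0`epi8qbVtH4QQ@qOb_ApPPVqi>QQ@Ap2qR?qOqP_`c_p1_p1_Ov5pQaPPr5q1pPa`a_OQPA?A?@q0pPap0A@?_
q_p/p@``fQQqFrSrEpFp3rEr@?VABs9>?A?@A@A?@?AOpAOA`A@?r@__A?A?@A@?qaqAqA@s?b_ApPPVqY=QQ@s6`As1r?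
O```p1QPOOPa@?A?w/s_v/v0PSOO{5t1raq@`QQsgr0AtJR0p`PQ_a_@QOr`pRpOpFpdqYBp`PSOsFsA@?s1QOOPPQQOOQ
@?@QO@?A`a_OAqAq?OPPC?qEq@?Aq@q@p?_p6p1pVaOpOWAscs_@As_PPA@?QVQ?@A?@?A@A?p/p/P?p7p1rGQrAr?p1p0
`q@rE?@r@OOAj>2QO?TVQBDd``PRq96Bp5SOE@p1BDsH7@ASs86BqY5?EpSpOEWQB?Aq/PPapUapPp1p1p0p6p1@?POA@@
?@@PCFA@p5p7p1B?ApSpesH5``Vs84Q@Abqb??Ar3r/pgpaqUq91qP`eq99qBVtH3QQ@t/b_ApPPVr9CQQ@Ap2qR?qOqP_
`c_p1_p1_Ov5pQaPPr5q1pPa`a_OQPA?A?@q0pPap0A@?_q?p/p@``fQQqFu3rEpFp3r5r0?VABri??A?@A@A?@?AOpAOA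
`A@?r0__A?A?@A@?qaqAqA@u_b_ApPPVqiBQQ@s6`As1r?O```p1QPOOPa@?A?w/s_v/v0vA`c_O{EtAs1qP`QQt7r@AtZ
R0p`Pa_a_@QOs0pRpOpFpdqi=p`PSOsFsA@?s1QOOPPQQOOQ@?@QO@?A`a_OApap_OPPC?qEq0?Aq@q@p?Op3apVaOp_WA
vCv?@Av?PPA@?QVQ?@A?@?A@A?Op?@WqEs84p@p@gaa?p6p6p1rBr?rdrI1r``drI;qWStH4OO@qQga?pPPSsHCOO@?p5q
WAqQqOq`p1p/p@pEp@pAp0p1p1avTp?_PPrDp_pO_``aOOQ?A?A?p`p@p@p0?@?aqQp0pA`ap3OOqCpSrVrDp6rDr@AS?G
s9>A?A@?@?A@A?Qr@aq_pOQ?`?@?q?q?@sAga?pPPSs8BOO@sC`?s?rAPa`a_OPPaaa_@A?AwAt1vAv?vP`eQQ{TtOs/qP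
`OOt2r@?tZR4p`P`ap/_p1QPr`pUpQcpes8=p`PSQsCs?@?s/OQQPPOOQQO@A@OQ@A?`_Ar?q1QPPFAqDq@A?q@q@pAap3
p/pS_QpQR?sfsa@?saPP?@?QV?Q@?A@A?@?Ap1p1PAp2p/sBOs?r1p/p0`q@rDA@r@QQ?j>5OAp1BpDDp3s83p2qI2p/EG
AB?p?p?PUAA?pPdPA?``?A@@p@PpBbpBBp2_pbpcDr84@AqCq?qCq?pcp3rI6p/p/UqY3QPp@Ap_p_UEeqY2`CAAPp@Ap_
p_UEWQeD@Cq95AAPaacDpY1@ap/p/Uq2q3p3r96p/p/UqI3QPp_EE@?@A@PPCSSOqcpcqi7pOEq91@qOPUFA@Rpi;?PQ?Q
@eBpI1?a_p/p/q3pcp_pCp3p/e@pEpi1p@p0p7a?TTPpFs3r3u84TPRCriF?ErIDAPO@a@A?q1pApAB?Ap0PVqYAQQ?PT?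
P?PPQ@?pCp/tBs?A@s?aPTq6qY<q1pAROs6s1@?raPO@A?qO@PAp1@A?`PpUp0pGA?TTPpVr3s3u83TPRCriA?ErI?APO@
a@A?papQpQB?Ap0PVqY<QQ?PT?P?PPQ@?pCp/tBt?A@t?aPTq6qYAq1pAROsFsA@?s1PO@A?qO@PAp1@A?pPp@p6qSrSt8
3pQaaROOp4qYAp0``OSpY3APpAp1p1@b__pDq9:p@``c__r6u3cpi1As1qaaa_p0p/`Pw2w/v?pRpOp?p0`Qtbt_s_q0`Q
sRsOrOq`p`p0p0p1as3rOr3qOsSsO@?r?aa`A?@Au?@sSrOAscr_AJV4p@?r/@?s/s/rCP?r?r/Par3p@?q?q?p`A?AJQ4
sOqP?t_p`?pO`?w/v?pRpOp?P?PC?t2t/s/P?@Aa_p0p/`a@?@r1aPT?vBv?uOa`PQQqPtBt?q0QQPAu0u6u1tAOOr/pOs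
Ss/rCq_q_tCt?@?r_p1p1p1p0A?@As7pO@?r@q?`r_`q/rCqO@Ar?r?r/A@t:E4t?q0?v?Q@POQvbv_v/P?POp/`PgpUQp
Pp@p1p1Ts2r/d`TrI=dpVsSsOEsH=@Cs8<?qQpAOO`a`Pu?pBp?p/``QQrEtgs1sEsH=s@PSQQqCp_p_qcq_@?pOp?p?pA
pAp1@?A?q1@AqBp@?qjR4@q?_AOtasPr`?Ar@qAp`PQc?qSq?@?qOq?aJC4Qp?P?r/q1@A@?PA@?@q1aPu2u/t?p4_`QQP
AqPu7q1qErh;q@Pt@caatct_t1QOq_q1sSs/scs_@?q?QQ@?Aq0rO`aOP?A_u1s`qPqap0p/pFOApZ@4Ap0`?t/s1q`POA
Ap_`Pgp5Qp0aaqSq?p/p4s2s/pDp@Tr9:pDpfrSrOEs8B@CrhA?p1aOO`a`Pt?pBp?p/``QQrEu7s1sEsX<s@PSQQqCp_p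
_qcq_@?p/p/p1p1p1@?A?q1@AqBp@?qjR4@q?_AOu1t0r`?Ar@qAp`PQc?qSq?@?qOq?aJC4Qp?P?s/qA@A@?p0QQO`_tR
tOs_pDp/PQQPAq`tgqAqUs8:qPPt@caatCt?sAQOq_q1sSs/scs_@?q?QQ@?Aq0rO`aOP?A_tas`r1r0p0p/pFOApJ@4Ap
@P?tOraq`POAq?p/pAp@p7a`t2t/s?rWQqGQp5rh9p0`r@caar3q5s8<q0p`SQq3q/@?p?OQQPPOOQQO@A@OaOP?A_p@p?
Aq@pOp0QJ:4t/s?rQ@uJ84aA?A";
"?UErX5UWTFABrX5@PCFABp6p1B@@A@pV?pQBrX5@ABD@A@pV?pQBrH4@?TVQBDUrh5VQBDt89@RCsh8?GsX7A?A@@@@PCF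
A@p5rH4p4p6p1BDbp3sh4_GsX3A?A@@@p0CFA@pBpBRRp2p/EABBTPPqRBpBqSqSqOE@CAqOqOUEWUPC?QUDri:@PAPa`c
Cr91Aap?p/UPPSCVSOE@QSB?OAOa_eEpY1Aa??p/EE@WQBD@cCfc_E@QSB?OA_p1aq2eBpi1?ap/@?@QQOA@ArSqctH4SO
rbr/r/pb__UEqi4A?@A?A@Qp1`Cq91Ar?rbr_r_EUWqCqCPFABqY8@q?`A@A?@?AQ@Qp0?@A?pcDt3qY3t/q/U@@@pa?EE
@WWQWpbp_OTPPp@pcqcqSpfpaB?EGqY:A@qOp_q1PgaWq91QDq3p_p_q1p`gpUpPOA?a@ap_PPCpCp?pQWp6pI2p1P?@?A
Q?EqSq?p_GWqi4QDr95@AAQ?A@pCqCr3tH3q_ESOPgaQR@Br97?A@?AO@?@A?A@?@Aq/p?pQPa`TsCpi1s/EsRqi4sOs/U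
pWqi4pQPTqY3?Q@?@A?@A?Ap/EE@p2p2WWQWp2?TPPpCr3qcpFpAB?EGqi9A@q_p?pQPgaWqI1QDpSpO@qAp`gpUpPOA?a
@ap/PPCpCp?pQWp6pI2p1P?@?AQ?ErCr/p_GWr94QDqi5@AAQ?A@pCr3qCtH4q/ESOPgaQR@Bqi7?A@?AO@?@A?A@?@Aq_
p?pQPa`TrSpY1r?EsRqY4sOs/EpWqY4pQ`TqI3?A@?@A?@A?_aUcqSpct84pO`A@A?@q?aP?@Q@QQOA@ArSqcsH4qO_s2r
?r?q2p/p/p7p1p1p1```aq@faa___@Ap1p1p0p0p4p0aOpCO@Ap?_A@Or?q/s2s/s/q2q/q/p7p1p1p1p1p0p0p0p0qPqP
pVpQpFpA_OpQp?OpE@Ap:?2p@p1p1p1p0p0p4p0aOEpCO@Ap?_A@?A@?@A?@QAA";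
"?UEs86UWTVQB@CFA?PCABBD@ASp2p/p/bc_EpY6@Cq4q0CsX8AA???TVQBD@@PCUrh5TVQBrh5@PCrX4AA"];
 ["?UEWQQp5etH8p5Up4D@CtH8ABt87?p0CABB??p4DTetX7@CtH6ABt85?PCFA@R?E@?@AAp0CFApEt87Sp4B?EA?GGGbp4p
0CAB?_AEp2pDp@CtH8ABt87??PPVFA@RB?r@CuH<?Eth:A?AA?TD@dCC?E@CFA@Bqdq`CuX=ABuH<??A?@A?EGq4q0Cu8;
ABth:?A?A@rPSCtX9?EtH8AOOAA@AA@Abpesh6bp2pDp@Ct87A@Rb__buH;_qBq?Uu8:PFpEp0?Ap0?VFA@p6p1pdrbrR@
ROOqFUPgaQR@B?A@esi=AOQp_p_bPPQQPpQ`bBs92?__rOr_r_r0p/OPgpUUPpU?AP?@ApPpPp0p1Qp3p/p/qWpcpfQB?p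
ap0p/aQO`POA?@?@?A@A?@AAAOp/_Ap2bqDq@Ct87A@RROAbuH;_Eu8:@Fp5p0?Ap0p0OfaafOOpOgsDsEW@sE?A@?@As@
s@p1p0Ap3p/_qWpcpfQB?pap@p/aQO`POA?@?@?A@A?@QAAO_p/p/p5Up5p0e`pEeSOOp6p1aapQsds`CtH8A@RRuH;OAs
0p2uH8p/s0r2qBqbpEri4p@p@VrY3QOp_Aq_q?A@?@r/r@r?r?r@q/p_p@p@p5q@p5gagWDu9D@CtIA?Gt9@AaAp1p1OOa
_p1p1aPPpdpDRORErY?tTt4vhBt0CvH@AtPCuh>A@RRvH?OAs`rTrPA??Ep5pBw8?p?t0Urdr`A??Eqdq`CtYG?EEti8@?
@A@AP?@A`P?AAOOpdrDsds`CuX=A@RBuh=?Or@q0A?p`rTrPA?rPOQ??p`A@?P?@Ap0Ce`?A`OOp6fVQQqDrdr`CtH8A@R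
BB?qFqATp2r4@ROOrVUPgaQR@B?A@etI<AOQq_q_b@A?PpQ`bBsY2?__p?p/O`a`a?pWpeg@pE?A@?@Ap`p@pAp0Ap3p/_
rGpcpfQB?pap@p/aQO`POA?@?@?A@A?@a?Oq@paQOOWGGAEtdD@C?GAt`p_`Pp3u8;p/fOAA?A@Au`cCtX9?Q@Ap5pcp_@
Ap_p@PVQQ@ROOQpPPQrOrOx0waQOOp?gqVq?@Aq?q@q@p0p0pAapVpQpQpA__pOues7r93A?@A?A?PPOA@?Au`uauAq_q/
pAp?@A?A~?}Aqbq`q`q`q`p/p1p1p/PA?@?A@A?A@uBt0?jS4tAq_aQp0O@?A@A?@AAp1aa`Aq1@Aq2p_pbp/TPAq?q?v@
Ct87?Q@A?r?r0Aq5pOr5r0r0s3OaQOP?A?@s/s/p/pAp?p1p1`POa_a@AtUs_@AtPs`_ArjH4q1_p?A_AQ";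
"?UErX5WVD@CFAAQQBROpEEp4p0`StX8?@WtH7A@`PVp4tH7p0Ct86?@Wsh5AQ@Abpdt86p`ASsh5O@?gqGp2p/p1QepGp7
qbv85q_A?ev80PPVuh4QQs?bqUqPqPrgraraTPPSOOp6p1aaBb_r1Uu5u0rA_@`p?EOAAP?A_p1P@?paVQ@?QPPSpVSO@?
gQQtaqCq?q/rVrQuBu2@ROOAv/AUPTPwRr/rD@qEq@q@qgQQq`TTPA?POQQOp5Prcr_@Ar_s1s/p1p0A@?Apap0?@APO@q
@qQrarabO```___p1?qOp@pGGsI2A`?@A?A?@?@?A?wOr?rP``fSOQQeepVtTrerat1t1bPPOO@?@?tPtPq1@?OPAa?PQO
P@?@AAu/u?u?t0p/OPgUPASq5p`?Ap`?VA@p?b__Ur7r7r1sgsa?@?@aA?@A?Au1u1t1pbp/p0p0p/p0p/p/p0?A@r?pPA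
O?@?A@A?@A?@A@?A_OqAq?OdqRqBTPPpgparBr?E@q4q0SpSpOpOUQe@`pQBQ??POp_p_UQ@`paBQ??@?@Aq?P@Ar/r/c_
@A_`PVpcfaQp6p1rgrWrgraEsRPr3r/@?Ap1q2q/p_Au_ugE@pEp@pWpQQR@B?A@et9=AOp@p@p@VASO@OOUQq3q/@Aq1P
A?@AP?@?AuaPPQcSOa_addpcr5rTr?t_t_gPPQQ@A?Ar0q`q?@AQP?_@QQO@@A@??sOq@p/a_pEE@pU?@?@APrQrarar`r
?OQQpAbR?PPVqdqPA?qPASOO@pQgaaOp`PxQy2pTsRsRsOubu_A@@Ap_p?A@?A?w/w/uOpg```aaa@?@qapP?Qy/v`uOp0
p0p/aPP?pSpOpapOpQp1p/__u4s7qi3QPA?PPOA@?A?u0u/u@t_rAqapOpQ@?A?|_{?qeq`q`q`q`p1p/p/p1P?A?A?@tG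
s0Au:W0sAqap/QQ@A?@?@A?@?@A?A@AOaA@q?@b_A@AQO?TVQBDB?EGGTPCT?E@Cp5p0?Ap0OOWA?AAA@@PCFA@R?EGGp3
c_pUpQpetH8@Ft87A@Rsh6?pQDsh6@ASsX5O@?gp2q5q0q0VA@RRODpgpWAUPP?qQ?TPUPsBs?DsGqbvX4q_uRuOA@uO@C
AsAPPQcSOa_adD@r3q_r6r1@?A@raRtCtAtAtcOOpRA?@A?@?QVtCs1rasdRti3?s`s?O@A?tAtAtAp?p?@pBp/p@POOQp
aqT@p6b?@GAp1?A@?p0Or/r1pPPOOrSpaesI2`OqOcA@A@?A?@_p_``QO@?A@A@`POaQO`POA@A?pQpapapap0PQcSOa_a
dD@t2t/Dt7rRuh4rOvBv?A@v?@CAt1PPQcOOsTs@r0t4t0__qSqFap3?@qQgri2aaO@A?ApdpP?@QOA`q0pOpapQp/p0p0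
p0p1p1p/p/p0PQpEpAbOdri@`PAcOSsYEA@?A?PPOOA@tUyO@AtPsPSApfp/pAp/a_a_Oq?esIMQPpap?__aaPPOpQgPaQ
POA@?APOaPA@?pAsPsPr@pAp1p/p/p/p/p1p0a`cv3tatQq4vSOOAgri7@q0p?p?@At?aOaQPA?@?QQOO@qOp4p0v3tarU
a?A@wCp?p_Ap3p/@A@t?p0`?OA?@qA?pUp@p6p1Bq5QOOsbs_q4q0pDq4?p@p@SOEEqDOAU@@@`q0pPp@p@p/p/p/QQOrP
p``OwAs1Ta@?PPAs3q?qVw0A?qQQ@x2_p0p/`_`_a@z?~2~2~/A@~/PQQPAqVq/qAp_pOpOpAp?pApApAp?p@p?`Ps/ucu
_pQp?OqbQ@p`Aq__aqQq?p_pOpOpOpApAPPtCt?q_p/pAaar7pap/__```p1QO@tPrOOpSp/pAQOOPPpp3|Ov0vA`aQ@pq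
_u3u/p_pOpOpOp@p@p@aaa_p0POAr@rApAapv3pu/Apu/u0PQs4q/q/PP?A?Aycr:e4qQq?O@pv/tPAu/sPApp/v0Ap1r1
QO~/P?x/{b{_A@@qAw?{2{/A@{/PPA@p@p/p1QepGp7UPPpgpapaTPscq5CC?pVVsEs0sAQBB?A?@qPq@VfpTpPAS?@paW
Q?@@aa@?A?Q@A?pQpQROOpVpQ@?pQp4pD@ROOAp`p5p0pAp@p@p1faacsY4OOAgs9K@O`p0`SOv2s@A?s@QOAQP?QPq1q1
RpA_p0p/`_`_a@q`rWp6Qr5_OQPPqcq_q/p1aa?A@paOrQ@A@?p1P@?papafa@?a`CpVSOSOses`s`p`p0p1p1p1p1qApD
p@p@A@?x2x/A@x/uPu1p1p0_p?@pDp/QQOpgt4t0?As`s_OPQQ?@A?@A?@QQ@?p1s`s`p`p0pAaabOOqFqAqApTO`_`_`_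
a@r@sBpCp1apcOOAgqi8@Or@p0p0q?SO@AAPO?@?A@A?Q_PPgGWGAA?qTUTPCC?r5r1qArUrP``caaRROAbuh=_pWAtRtO
saQPp5PpewXDp`p`?cv8>QQtPbu6u1u1aBb_r1Us5s0rA_@`p?EOAAP?_P@ACpEp@?Ap@?VFAfapCubu_q@_a_pEE@?@AP
p?@?At`pAd@RwRwOs0qOa_pEE@?@AP?ApPUP?AA@A?`fA@a@?A?Or0qAQcC?p3e@s2s/AUp7p1p1?b_p0p0p0p0sPs@pCs
fsQaaBB?Ap0PVQQ@b__pDtYHPPp?w2w/A@w/taPTtFtA`?Eq3q/@Aq/q0PVp5ti2p0?q?W@?@AA@A???p?@@QQBBsRsOra
QPp5FABD@A@?@GA?A@?@QQ?@p3?v2t@A?t@QOAA@P?A?@?r`rPpdp`pFAubS?@q1WQ?@QO`_`a`a`_p1_@sap_apfpOgaB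
qFQ@R?A@?QQ@?q5p5p0PWsI7QQ@A?Aq0?pOu_u1QPp5PpEtfqFpcpO@rAWQ?@@q1tataqaqapVpQ@?pQpQR?rSr?@t1q2Q
?@p_a_OPPQOa_fGABs4ti3r`A?@A?@?sdQ@?QQO@?OPPpApAROOpfpa@?papapPp@p@p?p?p?p?p0aQpTpPPqSROO@eApQ
?A@?P??@?gWqEAq@q0a?TPUPS?u2VA@pAR?PPABth6tVrV_p1QOOPAd?rAtAp/p/p/aaa``Qpep0fa@?aBqEQ?Ts95PPSO
u2rPA?rPQOAQ@p0OO`PQ@?@sAqDtX5q@pap1a_pCOWQBpcQ@ROOUPu2r/A@r/QPAQ?Ou/tAQPp5PpEt6r6pfpQ@qQR?PPO
A?A@Ap4?@qat1t1p6p1@?p1p1ROOdpRpOpOpP``_@c?P`PSOubrPA?rPQOAQPPOaWQqFqA@?qAqAp0__PTpep`p?a_a`Ap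
fpBOOPUAp1PQ?A?@QQQ?@?gWWQQQUTTPCT?GE@sep0?As`s1pPp/`aB@pc_p6OQPO@B?A?@papEp0ad@q5a__PQ@?QPOQ@
A?A?@A@?p0a?APCC?sUrQp0``aa_u@p4pFv8?pAaab__pDv8>p@``pOrDr@A?r@p?p?aafa_``a__``?A?PvPp__a@?@QO
{a}QpGqEsUvcv_@Av_v`uO`p1`pFp7p1?@p1QOO``dpqbti3pq_rOUti3@OQ@A?@asPrPq`?Aap0?`A@?sPrap@a`tRtRt
OrGsgAU@s1D@r7r6qfr6r1B?E@qaqARB@q4q0rSqOA@B?sRsOA@sO@CAq_q_p/Q@pGpAQtBrVrQqArSrQ__Gu99Aq/t?_p
0ePQpTpEQO@`A@??A?@P@A@?OrQrAQOOp4p4TPp4PA?p0`___aQ@pFAtVsY5tAsaBqEsi3pPp?p?cQ@A@?A?@_@A@??@?A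
@?Ap0``?p`p3Q@?@A?@Ap1tOsararap1p0pUPQpT@qEa___``p1p0Pr`qPQpfp/pAQOPPqcq_q?aaa?A@q1p/?A?@A@?P?
@?At@sQ@cp0A?A?QaQA?qBEpGUqBq?dd`dC?EGA?qQpQp4```OOapSagth>aP?@A?PQ@?Qt`fA?A?@?Q@?@zQ@?Qq3p?pQ
QOO```qQqRxBti1w_x0v_`vCv?@AQQ@_t6pO@ApOQPApA?pQA``SCSOrTp4fGAB?PQQOPPOA?@uPtatas`p1p0p0p1p/p/
p/p/tEsAaOsUs1paOqWuh<qQ``p1QOrGu8?rAr0r0rAQOvRubtY1pP_`AB?r0q?q@AB?sPt@?OOWQ?r1q1p4dd`A?`PABq
7q1?u1tAp4dd`A?``ABt94?A?@A@?A?@?`P?A`?A?@A@?A?@?``?A`q?pQQPPVFAs5s1rAsUPPVQQPb__buh<_``p`p5uX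
;p0p/Vp3p/p/p6p1@A?pfpapapap_rAp2b_O`PVxTx@A?xPxPp1Qr2rUqPrRpCqgqaQ@B?p?rOrOA@qQ?As/PAq0pQp/p/
_Q?@AQQO`POA@?A@A?_AQ?s1rATPPQcOfA@BuH:?pBp?A@p?QQTD@@__p1gQp7u89p1pRs4si1s0r0rfrarO_GGb_p0Qe`
av4e`a_OPPp@S?QQO@A?A?@A@?`AApOO`PFpdpPA?p`p`Ac_p1p/aQpOvdp?p/PPpOSO@AAv`_aPPQpO?AQQQ@Ap2p/p/p
2pTrDrDr@p`QQROOsPq@q@rBr?r?r?p3p/p/UAq3q/EGAxDpethIp`p`SVQOAUpCq@?A_PPpEQQpAPPs0OOA@?@Q?PPQQ?
A?@A?@?pQu2s1r/p1``p1p0p/p1p0p/p0pAp/a`OOA@u/@?@AQ@Pr@p`A?Pp/OpA?AdpDDTd`C?QUWQPUPOOQQOA@d`OpR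
Rr91OQQPPQ@?@xA@?Qq3p?pQQOOPPqAsFqBuY:@_@?AsApApO`QP?@A?A@@p@p0A?```c__qTqTqPqTqPC?EpSq6ap3p/O
@qApWpQ?b_EEqEp`pgq7AD@paq@q0qAq1pApApAp0p0OOaaaPqOq`q_`PtPq4q0q/QQOq6q1q/pPp@aaPOOAs1q1q0q/AA
pAp1p/```p1_PPqBB?qgvevav1wEw8CPPs1fvXAaaPb_Rw8A@pPp@QPr1qaqAq1pQpAp?xAwQTuH<PPQq4qY<q0q0ArTrP
rPpCp/qCq?q?sDpSs9Fa@?A?PP?A@rOuDs/tCwHBrQrQ?A?PPOOA@rErO@Ar@r@SApfp/pAp/a_a_Oq?es9=QPpap?__aa
PPOpQgPaQPOA@?APOs/s@p?O@Aq1p/p/@?Ap?pQpOp/`Pa__PQOOPaOAv0s1ucr@?Au_rPp/OQQPO`_`_`?AtPs1pp2pp/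
y__p0``r5q@p/__aa`?QQtar?ps2ps/}OxPt@p0p0rBr?A@{Wp_A{`w1QsRs@?qZd4PPpw:b4{Qr?q0Ax0t?Aqa@A?@rPr
PrPr0qOqOq?q?q3p?pQQOO```r1s3r_s1QOOPPsAr/}2}/v_@r@rc?QQOO``ArAq_po2po/yOs0``atPr2r/q@p_p_pOpA
p?p@`aa_p1p/p/PPQOA@?A@{3u?Axdx0?wjb4x`r_wj_4Ar/q@Apo/r`Ar_pPAqPPArapA?A?@?qQ?sA?xax1Tth:PPQqf
qfqa@?qaqfqaqdq`q`q`p@p/p/p/p/`PQOaPAt`yBy?w@s_t0_Oqfq/p@``aa_@QQt/r@xcv0?Ax_x_vPtOOQQPO`_`_`?
Ay0sasQaptBpt?}Oy0p@p0p0p1wTwPOQ?At5q?AtaxdsO@r:b4xOs@pPrJ`4sawPv?Apt?x`Aqas?pQq`q`q`q`q?p_pOA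
pSp?pQQOO```_rA{B{?tO@p0pc?A?PqQp_|B|?z@POQwOqBq?p?p/aQPPOOQxgq`A@tdt:a4?prj\4Qq?q0A|?q`Ap_p`A
@`ApAqQ@A?u_wRwOA@wO@A?AqPqPp1p1p1_Op2pcp_p_faaaRB?q4p0pBqi=p?OAe`p7p1QqRO```___p1?zeyavAsa```
_u0p6pFvXApAaROpfpa@?pap0``___aa`Ar_p2P?@Gs9@AOPazaz1vQt0Tp4vH@p0p0Qc__cw8AQQ?A?PPOOA@p6AuEtUt
P?A?@QWsYB@u1s_A@?QAqO`PyExAtarA```s@fQQpFpVvXApQpQ@?OOA?@?q`OA`p1p0a_A@AtRtOvBv?QQTuHEPPr`cu8
D__W|5{1wQu1```v0fQQpFpVwHDpQpQ@?OOA?@A?@?|1{Awau@r_r_p0p/p1p0aOaPAvQs_s@_aaqVp_p0p0`aa_PPaaaO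
@?A@?@Q@?A@A?@?A?x_sQrQz3z/@Az/p0pA`aQ@|_yOQ@?p0AtGOOAyDjb4s_s`s?s/r_@Ar:a4tAqQQv?Q@q@pap_OPAq
0p?@WpRpOA@pOaPs2s/tbt_QQq7q1p@p0p0p/A@Aq0cOOqSu8DqOqOqOq3q/@Aq/pQpQ`OA@?Qv/rEr@rQrQr/qapAp@p@
p@p?p?PPQuA?A@Ap@tRtOr?@qPsFsArAp_p/p/p/p1p1p1p1p/p@p?pPpOpOpPp@p0p0QQv?u?rBr?q?pOp`pPp0p0sRsO
r_r/r@r0q?p_p`p`p`p_papapap?pAQs_pBp?qqeqq`?Aqq`qq1pz`ps1}Pt/sOr_q1pApA_As2p/AsZe4p`p?P?qPr?`A
sArAq?p?p/@A?pwEpvA@pw`Vw8C?Apw@pp0q5q0?A`c_@?_@QQ?AJ_4tOtPq@p?p1?@A@?@A@?pw`r`OOPs7J\4s1r@At_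
Q@pOpAp0POAQOOA?@waw1PPOa_qUqPqAaOvbv_sEs@sQsPaQvbv_paQd```sOp3tXB__WxTwOw`r`rPp0p/p/p/p/p1QP?
_pe@A?PPA?@QOA@?A@?A@A?@v0ra}7z`?A|@{0yPQQq7?Aub}j`4u_t`?~Z\4q1p`?@AxPw_r`rPqOp?p@a`aQPq5?Aq0p
P?sArCpOpOpap_q1pApAp?pAp?p?p?p@p?p0a`Av_q4q0p?O}Gp0`QQP?A?A@?@?A?@|PyPpQQ?@A@?A?AJ\4p?_p0``a@
?vA?@q3paQOOpoJY4pOr?p_pOpap0aOPQOOPPA?z`w`qDJW4p?Qv_pa@sA?A@ApQ@v_p_p0p0aQO@_uA?A@?QQ?@sPAqPp
_p_a@AqBq?s2s/QQpbTtHAPPQq/p3t8@p/p/p/gApEp@Ce`?A``OaQOP?@QOOQPA?w/tA?A@xgpPpapaa``OOQQ@A?@xQp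
`p`_p0p1p1___QQPOprPr4PA?PA?q?@pTA?}ZW4pPq0?QpOs/Q@q?s2s/A@s/PQ@PQ?_p1p/q`q`pGpAp@pGUPpCp?p?p/
p/p1p1p1p1p2Rb_ROsbwUvQrap1```_fp6uh>p1Q@b_pfpa@?@_`Q@?AwQvas1pAqRqOdpdp`Ppduh>p`p`S?q4q0aa___
PPp@SrCri2r?O@A?@?APqOp`P?As_sArAp1`d`A?PA?@AOp/p/p/p/p0p0pAp@p@pQpQp?pAp/`P{1zAw1``Oa_sgsaqaP
O@q1tWsP?A{Rr`?|:O4r`r/pPppJM4tQsap?p?p/p/p7qWv5v1uArbp7vUv8?PPr1fuh>aaPbORdpD`A?@O?p1r_q1pAap
1p1p1p1p0p/p@p@p?pPpOp/x1taqDq/p@q4qdq`A?q`p@p0p1_OQ@AxRr/r@POOAz:L4?p_q/POApAq?pQQPPVpdp`A?p`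
aQcp6SOOpCp?qdr5@WQQqVqQ@Rsh?OOUPPp7p1aaDrgra?@raraRPPpbp_@p/pRsRsPsbs_q/_``QOEsI8@sOp/p_q0p/p
/p0`QQOr/p`Gp5rI1aAO@A@?Pa`rArARO```___p1?qOp@GpGqi2`?QPAsa?P?q6`Aq?q1A?r0PaQRRRODuUuQtav5uh>P
PqAfuX=aaPbORdqbp@p4Ap@p0A?@O?uQtapap?OPp4pTuX=pPpPS?pdp`aa___a```p`cQp3?s?AUri2@?APOEuUuQtav5
uX=PPqAfuH<aaPbORdqbp@p4Ap@p0A?@O?pA_@?@AAOOPa`p1_OPPOa@?xax1uarap0p0p/p@p/pAp?p@p?p/Q@uWu@tQQ
OOPPraq`p``apSOOQQ?A?@p/p/pAwfppZM4wOuQq`q1QOOWGA?A@ASC?q7rWq7q1?A@rQqA?@q1Ps1s1p2O```__a?@QQO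
rarOp@p@p0Qu?rUrPq@q0aaa@A?P?@?pp5pp0ppApoQp0pAp0p0`u2u/t`qQpQpQpAp?p/`a`__QPAxbwTtA?yZW4v_w?O
Pu/t`?@?A@q0p0__PA?OO@?A@A?@A?PPQQPPOOA?@?sO@u7A?ujG4u1AO?@pQ@Ra?@?AAAAAA";
"?UUWTVQB@CC??PCFABp6p1B@@AC?ABD@AS??TVQBDUsH6VQBDu8<@ROEA?Dp3u8<p/Gth;A?TtX:@@@@@PCFA@p5rh5RcS
OEpDp@CFA@p?EbOEpCuH>p/@GA?@d?A@A@?@A@qQB?TtX;PPStH:OOWt89QQOOQQpTpPpPsfsa@uBq4BpdsBRp2p/p/qTq
PqTC?EE@pEp@?Ap@p@SQQpCp?p?pCpfQQROOUA_OAO@QQOA@w_pBr2r/A@@c_@_ESO@A@@p0OA?@p@_?A?@q0u?p`pOpOq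
`qPpCp0?Ae`?A`__aa`P?Ap0@OEEEpFSOO@WAD@qAB@O@GpV?VAq1B@pQp/_p1aadPPq2p2pDq2q4q0C?@?A?PA?q_q_pT
p?sDpdp5`e`QSQ@?OEAp0p0p0p0p1p1p1p1p/p/q3p/q3qCq?EsIA@CpGs9FaBriE?Ap/p/p??p/q0O@?@A@qQB_OqGdtH
6`PQQp3t85p/p/WsRsRsOsOpBpBp?p?TsY1DsY2sGp7v86@Cuh5?sA`ASpguh5p0ASc_SOr2r2r/t2t2t/Tsi3Dsi4uGuA
QPPp@fQp6?_?uAqPpPp0p0QcOOt7wX5t1r0r0`QcOOrVrQr1uCrStFtAs1p/p/rarap7u93p1p1p/q/p2wcbu3vi5p?`A@
?A_qOPA@A?@?Ap/qQtArAqQqQ`u_s?b_`Apbp_p@ApCwhOp?p?GUwhNPx3x/@Ax/wQtat1t1p@p/@v/pBp?PQQPrcq?qQQ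
OO`?uSvYRu?r/q_q_`aQ?qeui:q`qQQq7ui;pPpAQp2uY9p0A?v_pBuY:p@PC?pF@Ar_p?PAAp_p@A_`A__t/p0Q?@?Q@?
@qAaPt/ROPQQPArfrfra@A?qCv8Hq?q/q/Wev8G`CwCw?@Aw?OPa`aQ@pB___UwX;@QQO@A?AtAxfxaq2q2xTvO`PqBpO_
PQOaQORu9?OPApPxPv_p/p@p?p?p@p@pAp0OpCp?pQpQp?p1p/p/p1p/OqapGtY7`aQ?PPOAAq/A?@A@?A?@?@A?Apqapo
PPQr4p?__`aaq?ROA@@|E?@Ap@?QraOPAr/qa`a`a`a_p0_r_b_PQQPApCuXFp?p/p/WeuXL`ASvCv?@Av?_Pa`aQ@q?pR
pOp?p?p?vVvVvQufua~GpUvTyh8vPtOt1qQp`pOpOpQpPpA`a?r0q0pFOa_a_a_OqaeuI9`aQ?PPOOQQOOPA?A?PPOAap_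
pQ~AzPyPyaq@p1p1RO`Ppobpo_{@p/`_a_EA?@@p5?@AqPO`_`a?@A@|Ps_OPPp7Ar6p_q1p/a_a_`_tAq_xEs7tI3A?@A
?A?PPOOQQOOPA?A?PPOAx@xAvaa|aRtGt93pQ?@A?A?PPOOQQOOPA?A@?AO`PQ?@A@x@s/OPPtetQ?@tQtQt@_OaQR?PPO
OaaaO@A?AwPA?@A@r2r/q_q?pa``___Ay7xQwPuO`a|6pO_Ajf4yOxQp`@OQvQ@A?}_A?@?qBpPV??q/OQ_PAOOp?p1Qpb
pbp_p_pWApEU@p@p@VQBqEQOd@`A@??A?@`pQp0p0p1VVQ@A?AqDq@A?q@p`Aq3q/wGsQses`P?s6q/qAq?a_a_`Ap2zGw
83zAp4rCr1r6?@s/u5s`t7Ap7`Au0PAr?rQrA?Tp5p5wHSp0?QUueu`u`p0aaa`POOaQP?A@?QQPOQPr4ti<OOPPp1@pAp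
0_@WGAzRzOt?p_`PqPrbr_q_@CpSuSuOuQuQOOpEdqSqOqOqapPa`sCq4q0q0p?Evi=@p/p/cA@A@?A?@_pQ`_OPaQP?@p
ApO?r_pPAzOt?qbq_@Aq_PPQQ?A?@`s1q?q?_agxBq_x?r/pAaapEpe`PpPV?@?AP@sPASC?vbrfp_p_QQq?RROyGwH2yA
xOp0_`PpPcOOpctiKp_EtiJ@pcp_@Ap1p1?A?PP?A?@v_ROA@@xe?@A_OQ@Op?v_PQ?@A@?pa@r?ROA@@tE?@AOO@?A?y1
xB?@A?x?p0_p0p0`rErArAtet`?@t`t`t0sPpPpPpOpap?pAQ@tPt3t/Oscs_sap1p1_q1s6s1?@s1r?r/rAaa`?A@AvQ~
Q|_|_|_p/p1p7p1p1p5p0p0p0p0p1p1a@?A@?A?@xAQyBy/wOwP``_x4@w/q:]2y?y?x_`Awdv_s_PPy:]2w`w/OpzJ[4@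
s1q0QQp_pQp0p0p1p0p1`apVVpVpQ@A?Aq3q/p_p_qVqQpUPgaQ?qPTTPA?POQQOApE``{Wpep`?Ap`aa_A@?A?PAdqDtb
v7v1?@ua@RtI6?t`r`q`A??`w`q0?Ap@PO@pPpPp0pAq1q1pFp1p2_p0p0`___p1?q_pEpEp@p@PaQ|BtOt`POA@p_rgqg
r93qaPPrarP?QPAwOwQ?pfp/PPQOOQPA?@QOA@?A@?A@A?@?A?xOwOsaP?AqWudu`tPp?`qJ^2pPpa|?y0u/p?p?p/p0p0
p0pAp@pApAPpWPOOQPPOa_aQ?PPOa_A?@u@paQy`?~/Vsbs_q_pPpOp:Z2QpQp@p/p0p/`UPazBrOr`_`_`Q@q@tSr3qfr
92qaOOr/tOtQsOOp5@QQPO`_`QQ?@QOA@?A@?A@A?@?A?x/w_sapguRs`?@pvJ]4uOt0_OpvZZ4Pp0z?w0s/p/p@p/p0p0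
p1p0p1@pF?QQOO``OQQ?PPOa_A?@?po`u?qAQx_@Q|/|1?pG@ArAvD@?q:[2v@t/r@r@qZX2p0p/PpA?pQsOs1QrBrBr?r
?sWApEU@?pPpPVQBqUQOOp4p0``pPr6_r1r1pOpOp/p/p1PPpDpVA?@Q?@sCs?s?pQaa?A@s1?p@?A?@A@?`sQp0p0p1p4
p0A?p0PApV_p1p/a_a_`bt7uX5t1rVrVrQfauRPb_OAvOvGAUPP?rTcQV?@pOr5r0rGAp7`Ar0q``A_p1a?Tp5p5wHLp0?
QUrerPrPp0aaaPPOOaQP?A@?QQPOQPr4ti<OOPPp1@pArPq_@WGAxRxOuOsO`Pt@uBu?q_@CpSs3s/s1s1OOpEdqSqOqOq
apPa`sCq4q0p/p0p/Qp5vY=POp?cA@?A@?_pQ`_OPaQP?@pApO?u?pPAxOuOtBt?@At?PPQQ?A?@vAPPQrTcwRwOtOrO`P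
s@cOOtbt_q0QQPp3uIMp/_GUuISPArSrO@ArOr1r1`OA?PP?A?@w?s3q_r1QOO`?tOp5vXBQP?QQRrbti4rP|E?@A@s/At
_q0A_wOtOrP`sbs_A@`C?c@A___eaQrEq`?@r@rQrPrPq@p`p`pAp?p?QQPPrVp_AqV_A?Ds9<@arQ`?@rPq_@WGAxRxOu
OPqStRtOq/pOp@p0p0p0acpCtiKp?p?_UAp5u9R@?A@?@Q?@?s/pWsi7QP?A?PPOAP_tO`AqAOxOuOtBt?@At?PPQQr1@u
OuAu0p?p1p0p/p0p0q@p0q7p1QpFp/pAp?a_a_Oq?sgq`p5`tGQQ?PTrY:?aq`Paaa_@A?Apbp_q0q/`_`_aQO@A?@QQ@A
}2}/O`PrRrOq?qPp?p?p0p/p1p1p/p1QB?A?PPAz2z/yOx?t@p_pOpPpPpPpOpA_a``p1p0O@~0s1pc_p1QO@ApvVt/q?q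
Qaa_@Aqp2qp/p}/p{/p{@~@p@p@p@p?OQQO@A?Ar/pb~_wPs/r__aQPq:f4PpzPt?p_z/s`??A?@q0}/pr2~_@A~_PPAp`
_p1rQ@A?v/uaQPPqBpPV??q/_A?@pQp/p/QWsRp?sOpOp1aapUpPp0`p`fsVr?p?p6p1p/AUrUrP?ArPr0p0___aQP?@yQ
r@x6x1sasauAuFuA?@uAt?p_q1aa`?A@AsasauQsBr_r_r/r0p0p0p0p/p/pAp?p?p1aaOpcAu4qPu0tOtOtOp@p0Q@?pe
pQpubpt`?@?J]2pu_pu0{@{/p?@z:[2p1p/s?s?s?sPsO`PQQ@qUqPqaq`aQprbpr_x0w_s`q0p@p?p@p?p?p?p/A?r`pe
Q@xdx/@yZ]2x`x?OA@pz:[4p`pr_pr0x@s_q0pPev4u/@vjZ2v0?|:X2``Pp1p1@?Q@?@ArA@?r?``a?@?Q@pffSOOqFqA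
pVpQt2Pb_OAu/p5p0p0pWpQaap`TTPA?POQQOApE``xGpep`?Ap`aa_A@?A?PAdqDtbwWwA?@wQ@RtI6?t`r`q`A??`r`q
0?Ap@PO@p0pAp@p@rArApVpB?PPOOaaOqOee``PaQybu?uPPOA@p_s7qgr93qaPPs1rP?QPAvQvOOQq6p?```aa_PQQ?@?
A@?@Q@?A@A?@?A?y/x/sara`?Aqgudu`p?p@`?Ar:^2p`q1y_xPu_p?p?p/p0p0p0pAp@pApAPpWPOOQPPOa_aQ?PPOa_A
?@u@paQy`?|_Vsbs_q_pPpOp:Z2QpQ`p?_p0`e`p1x2sOs`_`_`Q@q@r3qfqi3qaOOr/@QtQtOOQpWPa`a`a`_`QQ?@QOA
@?A@?A@A?@?A?y/x_x0t1QqGv2t@?@pvZ]4v/__pvZZ4p0p@x/v`t/p/p@p/p0p0p1p0p1@pF?A?P?A?PPQOA?@?y0t/w/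
@QyQyOOpG@Aqau4@?pj[2u0sOpjX2p0p/`pQt/s@p/a_`p7UPASq5q0?Aq0pPOa_p1p1p/__p0?xArOyBy?x0u@`__r7uW
uWuQwGw1?@?@paq`qQq@aOaQxaxawapBp/`_`_`_p1_aQ@As/tBp_t?tPq?p?pAp@p0?A{ApF``AjZ2pAp?p?p?p/p@p0`
QQ?tPtPqUqPqapAa`POOqOqQ?p5@AzawB@?q:[2w@r@q:X2p0qPy?x0u?p?pPp@p?p0p1`P?pcp_q1pap_p_pAp?p?p1?y
Wgqi3A?@A?A?@?AyQu0uAQO@A?A}A}AtQsas7P?s1rRrPr/pP_`_rbOr_q0P?tZX4rPpOp`r2q?qPPOOA@t:X4p0rZT4p/
OAOpaOPA?pBp?@A_QQOOQQpTpPpPuRpTpDsRROOq4q0p`qDq@q0p3p/wBw?w?p?pCp?v2v/p?pEpAp1pep```q0VVQQOAU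
ygr@e`?A`QOApPqCw8>?QQP?A@?QQPOQPr4y5y0?Ay0y0SASt95?@AOOQr@`?APQp@pQp@rPrPcpABpS_p1p1a___p0?q_
q_@pUp0pAQPOOPuerQuau`r0A?ApAp1pOp/pAp?p?pApArar`CpPApepPpPOOP?Ap0q?paAa`?pPuOu1pPp?p1qPu/pPp0
q@q3p`?Aq/f@?OAp0qAqApO__QpTpPpPqdt85q`qPpdpTpDq4p2p/p/qDq@qDq@SOSOUUPpep`?Ap`p`SQQpCp?p?q5pCp
fQQpOb__U@p7t95A?PTsIC?A_q0p/OAOPa?A@q`q`cpaBq3_p1p1a___p0?q_q_@pUp0pAQPOOPv5rQv1q`OQQOPQQp1q/
p/pAp?p?pApAs1?A@Cq0AqEq0q0OOP?Ap0q?qAAaq0p@_p`pPpOpOqPepCp?@Ap?p?p@`pUpP?AQQpQpPPpD?Ap:B4p0`O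
A`@@A";
"?UUWTVQB@CC??PCABD@AS??TVQBD@@PCFA@p5sH6RcSOEpDp@CsX7A@?@VVq6q4q0CtX;AAQqABsX7@QOEEESSOO@WAD@A
@qf?qaB@O@GcpTpPCsX7A?QQTDD@qVAS?r1B@qQBtH:@@qQBsX7@@@?@fVq6q4q0CtH:AAQqABsH6@Q@A";
"?UUWTVQB@CC??PCABB??TVQBD@@PCFA@p5sh7cROEEESSOO@WA?TPASCe`?VrDr@CAA??O@GcpTpPCt88A_OaQTDD@BpFA
SOOUQQTD@sABuX>@P?AUE@rQBuH=@@@ASC?rABu8<@?@@?@ffVFq4q0Cth;AAQQRRORpgpWEqRqOq1QPPVFA@R?Q@Fr6r1
BuX>@ApapaORrVrQBu8<@PPOEEqdq`Cth;A@r1Bt88@@Q@A"];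
 ["?UEWQQp5euH:p5Up4D@CuH:ABu89?p0CABB??p4DTeuX9@CuH8ABu87?PCFA@R?E@?@AAp0CFASp4B?EA?@WWQ?Adp7p1?
Tp4p0p0d`q4q0pTpPSQQp3p/__pOp5p0pApApAp@``sOs?qCq?qQpRpcp_q1pbq2q/pgpWu2u/q1Qpbp_``a?@pPVApfS?
@A?@paQpQpQp1p/_Pp0`papQpO_Pp0`p_p_?A?@q?OOQQPPpUpEqcq_@Aq_p`Pr3r/@Ar/q@PpWgq7pgs2s/AU@FFA@A?A
U@?@A?A?@ApapAAq1papQpAOAr1paqA?q4q0dxTpPOQUPOA?A@CwhDAPpPApP?@A@PQA@Abb_Ap2p/p/qeth8p5Up5p0e`
pEeSOOp6p1aapQp2p/p@p?p?p?pPp0p0q5q0pEt4t0A?t0qAQRpGpWtDt@A?t@q1QRpgpa?T@Aq/crWp@?VA@pOROA@@OP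
A?pQpApA?p@q0Oa_p1p1aPPpdpDRBtDt@Cvh@ABvX???pdrDsds`CABvH>?r@q0A?p`rTrPA?rPOQ??p`A@?P?@Ap0Ce`?
A`OOp6VpdrDr@Cu89ABth8?p`pAQOOWGsTsPCv8=ABuX;?A?T@Ap1aa`pa@pRp?pBp?TPAp_cp4p0p_Sp3p/p0PVq3faQp
6R?EA?A@?A?@Cw8AAaQQPA?p?pB@A@A?@?@Ap?OPAOPAO_A_AQ";
"?UEs86WVD@CFAAQQBROpEEp4p0`SuX:?@WuH9A@`FduH9`Cu88?@Wth7AA@RpDu88p@Cth7?@WtX6A??TVQBDB?EGGGTPC
T?E@Q?cD@_AAAA@@PCFA@R?EGGGp3c_pCU@WQQRO``e`r2r/A@r/Ap3aP`@QQRB?A?eUPPVpEQBD@RRORSp7@Ap3p/E@CC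
?p/@?AgDvX?@CvH>Aa?Qq_sRsOA@sOPQ@OA?esesat5w8A@Fvh@A@RvH>?@```tQsapCpAp6qSuDu@p0p0cuh<OOWuX;Aq
OOp1`?Ap??P?_@WGA?q2Ep7qEqADu89@ASth8O@?Ap7aTpGvX=pAPFvH<AqB`POOEvH<@?@A_PPSv8;OQ@ga?@?ap1?Adp
DDTd`C?QWQPUPOOQQB?A?@Q@p@p0A?```c__qTqTqPqTqPC?EGpSp1p/PPO@gpRBq7q1q1pGpAdPC?QPa`_QQO@QOAyay1
PPQpRqAsGr4xXGr0p?p?cApRpOp1`a`_`a`Ap6vUvPu5u0OaWQt5p1d``SA@A?@GvI5AQ_asApO??aAAqPqPp1p1p1_Op2
pWpcp_p_faaaqabROOU@?wQvap6Tv8=PPQcuh<__p1gQTqQ@?PpGw8?pA`Fvh>ArfrauTuPt`ROOuOrbq?qPq@`___UUPv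
6sOsasOsOp?pAp?pApApAp?p@ApBp2p/pbp_p_pPp@p0p0p/p/Up3p/p/PUgADv7vI:uarPTv99?@Q@pOp@p/Ssgv5u`u`
v1QOA@|`x_pobcOPQQ@bx96?@x@qQq/OPAp0p0A@p?v1s/OxBrUpGp1ar1s?PAP?@Ar_qOq@PSu6rOrarOa_a_`At/r/pR
p@p0q2q/__q/eUPQBBpEp@a?TrGq@?Aq@p1OABufvI:s1@Rv99??@??PpOpPp?pAcp5}Rs6|2tUt@tA?A@z`v_cOPQQ@bw
i6?@|/A?@pAP?@?As`pQ`?@?Ap0Pq_O@A?@A@?A?uPt_@Wu2u/@Au/tPpPpAp0AxBu6rOAr/q3q/ApOE{BrGrAqPp2TPQ?
Gti2Ap/p1@A@?{?z/A@@p_u1r_r/_@Aq?q1p@POAQQaP?AOp_p_q1p1@AqRpWbs2pWpQ?PPVQQ@A?q_q_Pq2q/q@q?`_`_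
aQO@A?A}1|APPOa_p1r2q?a``OOaBqRwbw_wPtbrGxXErAq@p`pap/OpFxHDpApAp@p@p@p@p@p?p?p?p?p?PPpWpG|6|1
tQpqbpq_}0p0OOp_|R|Ov`q?p@p@p/p0aOarEpap0pwbpw_s`poBqEpQpPseqepCp?@WAtP?q3APOApPpO_QP?ApQpo?r`
Apw_s`Apap_pq_}0p/OptBpt?A@pt?p@QQPpUpP?ApPp?p/aaOPPAAQt_A?@w_qOA?@A@??A?@A@?A?@A?AQq0s/q_A@_p
A?p/A?@A@PQ?_p1p/q`q`pGpAp@pGUPp7pCp?p?p/p/p1p1p1p1r1pBbp2p/OU@?x1wAp6xTxP``cuh<OOagQTqQ@?PpGw
8>pA`sRsOrfrar2r/p?TPPq0q6?A@tfr?AwBw?w/vPrPp0p0p/p/s_epCp?p?PUgaQ?q0q1QpDp0bpd?E@?@A?@A_p@QPw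
?w/vPrOSzg{Rpbp5p0_OQQpAbvY5OPp_A?@{Os0p0A@tarOOwRwOvPrP`__sOePPpSQQ@?AAr/PAOOAgE@u6rOAzbwRwOw
?v`r`p0p0p/p/t/epCp?p?PUgaQ?q0q1QpDp0bpd?EuI>@?@A?@A_p@QPwOw?v`r_S{7p5p0p0p/_QQpCRtet`pOAB??pA
s@p0A@z_zAyAs1`d`A?PA?@Au1?wRwOvPrP`__sOePPpSQQ@?AAr/PA@?@Ap/p@pA`aVt6qOqaqOa_a_`Ar/pBp0`pbp__
_p_eUPPaQRRpep`pA_Odrgr0?Ar0p?pQpPp/p1QBqDq@p?p0UtY=POA?@A?@OOPp?p@p/S@p5p5p0p/OQQpABbq7q1q1?D
@pOSOPA@?AO@p0@_?@A?@A@?A?QaP?A_p/p?p?pQp?p?qgpGp1grbpWpQp1qGqApAp4p0p0SOa_p1q`q0pWpQpPpWpQpPp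
SpOp/pcp_p/{Dq5`{Uu@pPQQqApQ`O`pdzBz?yarPrap1p0p1`qTRfaQOPPOOq?_pAq0p0pAQO@A?A}P|aQPOOaqbq/a``
OOaBrRt2qWxHCqQp`p@pAp/OQpdp`p0`pdp`pPAr6r1r1q/q/p_p_pOpOpQpQpQpQpQpQpOp?p0p0p0p0p/p/rBp/`rBp?
p0faQsbs_p`p0OOp_tbt_q`q?p@p@p/p0aOarEpap0{R{Os`{BqEpQpPseqepCp?@WAtP?q3APOApPpO_QP?ApQ{?r`A{O
s`Apap_s_p`p/Ox2x/A@x/p@QQPpUpP?ApPp?p/aaOPPAp?p/r1r1q/q/p_p_pOpOpQpAp0p0p0p0p1p1rGp1`rG`SOO~e
~`}QQ~ApvGpvAps0po@QQ@d?~a~`}`~1~1p1p1p/@A?Apx1vWvQsPs0QQsawWPp4?savQsPs0sAs@p1p1_p1QxQpRpOp`p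
_`_p1p0p/}2s_pAp@`OOaqBqoRu_v0POa_p1?q?y2x?pap``OOaBqg}hbqaqPq0pPpQp@pA_w7}Xdw1v`v@vAt0p?`Qq4q
0p0`rdr`r@AtCs?s?QQu?RROP?@C~Hh?OPAOt?tAtAt/t/q/q/pOpOpQpAp0p0p0p0p1p1rGp1`rGses`?As``_a_aQpQp
?q?@pBAz6y?@Az1z1y?y/y/pOpOpOpQpQp0p0p0p0p1p1p1PPrgp@_OQP?QQtaqobqo_qp0qp/`_`_rp2qq_p1PAqy2p~0
?qo2p~_@Aprbs@?tBprR|97r?rAr0PQ?A?A?@A@?A?A?@A@?A?@A?Aaqo_qp0Pro2qp`?AQQOPPOpQapArA?A?@A@?pQ?A
?@A@?q?qAq0a`a`OQp1pOp`P{brP?AQQOPPOpAp1t/rOqaq0PQ??A?@A@?A?@A?AQpQpQr_ap1pQapQPOApAq/pAQPPVpd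
p`A?p`aQcp6SOOpCp?qdpfr5@QQRB?A?ePPv1uAp6TPPSvH>OOagQTqA@?PpGw8<Pr6r1uVtVr6_At2sPp0tRtO__q/eUP
QBBpEp@a?wgq@?Aq@p/pA_aQBq4p0d?EtYA@?@A?@Ap`???Pt/s`p?uauapEp3pEp@p?OQQpAbBq2q/q0POQpGtI7@?OP`
pAr1p/OtBs`p@tbOOq/ePPpEQQ@?AAp/PAQaP?A?pa@Ab___e``pGeqgt5q@qQQRRB?A?wU@?VFA@AbOOr/eUPP?APAOOq
apQ?@ApAaaDrWrQ?@rQrQRPPwdpbp_q0q0p_p0p/p/p0?q_p5rBzEz@ASx8E?@WGAvas_@C?@?A?Aq_PQp_q0q0p?p0PQQ
OU@q2q/A@q/aaa`POQ?u0vTvPA?vP?AAO@A@?`p1p0r1r1RO```___p1?qOp7QpUpP`pE`gxEuPuapaa``q1?ffPUri9PO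
OQQpARROO`PVtIAQQ@bt9@?OOa`?@?AQaa@A?P?@?@Q@r4q0p1QOPA?s`?AqOQP?@AsA@??A?@?q`q1QOOWGA?T@AO?@pQ
@Ra?@?AAAAAAA";
"?UUWTVQB@CC??PCFABp6p1B@@AC?ABD@AS??TVQBDUsh7VQBDv8?@b_EADcv8?_Guh>A?TuX=@@@@@PCFA@p5sH6RcSOEp
FOE@@?@AqABDuX>@CuH=?Gu8<A?Tth;@@OEE@?@A@qQB?q7TuH8PPSu87OOWth6QQOOQQpTpPpPt7t1t7t1q4pdpTpDp2p
/p/qTqPqTqPq@c_c_Uu2q/q@PFqUqPqPSQc_OPQOa`a`sAp7d`__QPpCpCp?p@p0`aQOP?qQ@?Ap1p0p/p/PPAOAPa?Aq`
q`pSpQpDBpc_p1p1a___p0?q_p5PaQPO`_OP?A?u`u`OOpo?y_z0``rGqPqaq@a`a`_rar`PuEpT?A?A@sOq_q?@QtVp@p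
Qp1p/p1p0p/p0p/p/p0p1p0p0p1tdt?y6{85y1p1@papxbpt_pu0pP`__qOUqRyGyAw0rPraaa__Qppepp`qPApAq2?PPO
Oa?rPr@OOy/xPwO`qgq@p`QQqQqPPp4?Aqeq`r1QP?@?QQOOPPA?q`p0pQp`Qp0qOPA?@?A@?APpx_pu/pu@p_`UPafaaP
A?pvOs2p_q0POOa?gpx5px0pxApuAptPr1pAp@p@pAp@P?t0puepu`pa@p@q6?QQOP?q_Aq1PQ?px1pu1pt@q`Q?pt5pt0
pPAp1pc@?Ap@puEUxI8POApu@q?ApaA?A@?@?@r_pOp0epw5pw1@pPCp/@??Apw1pt1ps@p`Q?ps5ps0pPAp1pc@?Ap@pt
EUx99POApt@q?ApaA?A@?@?`Pt`tQpPp1_paQp_p1_aU@?@?A?PA?sPsPOO}/wOw```r2qPq0QQPArAr@PtTpT?A?A@s/q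
_q_qO`PatVpaa_`_`PQQsds?r?QQOAsQp2{T{PtP`OO@?@QQPP?s0s0OOuOuPPqRq0pPQQqAq@Pp4?A?Dw9K@p0qO?`s`t
QpPp/_r/Qp@pOp@pP_q0p?p?qPp3p/@A`e`?A`_aaa?A@vOr`Ppdp`p`pO__eA@?A`pPp0q1q1p?__QpTpPpPqTu87qPqP
QQp3th6p/p/WWQWQrDr4qdrTqRqOqOrdr`rdr`Ac_c_Ur2q/q@PFqUqPqPSQc_OPQOa`a`sAp7d`__QPpCpCp?p@p0`aQO
P?qQ@?Ap1p0p/p/PPAOAPa?Aq`q`pSpQpDBpc_p1p1a___p0?q_p5PaQPO`_OP?A?u`u`OOzOy_z0``rGqPqaq@a`a`_ra
r`PuEpT?A?A@sOq_q?@QtVp@pQp1p/p1p0p/p0p/p/p0p1p0p0p1tdt?y6{8Hy1p1@papubpt_pu0pP`__qOUqRyGyAw0r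
Praaa__Qppepp`qPApAq2?PPOOa?rPr@OOy/xPwO`qgq@p`QQqQqPPp4?Aqeq`r1QP?@?QQOOPPA?q`p0pQp`Qp0qOPA?@
?A@?APpu_pu/pu@p_`UPafaaPA?pvOs2p_q0POOa?gpx5px0pxApuAptPr1pAp@p@pAp@P?t0puepu`pa@p@q6?QQOP?q_
Aq1PQ?px1pu1pt@q`Q?pt5pt0pPAp1pc@?Ap@puEUxY8POApu@q?ApaA?A@?@?@r_pOp0epw5pw1@pPCp/@??Apw1pt1ps
@p`Q?ps5ps0pPAp1pc@?Ap@ptEUxI9POApt@q?ApaA?A@?@?`Pt`tQpPp1_paQp_p1_aU@?@?A?PA?sPsPOOx?wOw```r2
qPq0QQPArAr@PtTpT?A?A@s/q_q_qO`PatVpaa_`_`PQQsds?r?QQOAsQp2{T{PtP`OO@?@QQPP?s0s0OOuOuPPqRq0pPQ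
QqAq@Pp4?A?DwIK@p0qO?`s`tQpPp/_r/Qp@pOrPq`q?r@q_q_r`p3p/@A`e`?A`_aaa?A@sOr`Ppdp`p`pO__eA@?A`pP
QQOOQpDp@p@sTpDsDp4s4sdrbr_r_t4t0s`tDt@Aqdq`pCp?p?crDr@pSpOpOpEpApApep```q@Vp3p/pAt0t0p5p0aQOO
`PQ?gaQUPPA@?A?@?u?A@p0Qp@pQpPas0s0p3p1p2pc_p1p1a___p0?r?r/PpUp0pAQPO`_OPqOt_gPPQQpA@d?A@?A@?A
?PT{5{0{A{AxAw@pAp@p@p@pA@?}`x5x0pQ@p@qV?QQOP?q_AqQPQ?{1{0x1w0A?vEv@p@Ap1qC@?Ap@wUUwi=POAwPq?A
qAA?A@?@??`Ap1p_p?p?pQpOpAp1`p1sQsPp1qep`p`OOP?A@A?t_p2PPQQPpQ@p4?A?PQOPQ@?A?Ps/d@rDq?OQQOyTyP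
x0OyOpRz3@A?p@Tx9?POAz1p@x_yAr@Op0p/qap1s`s0?rOp@s@sPs/s/pPpOpOt`Aq3q/@ApUpP?ApP__aa`T?qU@@A``
@@A";
"?UUWTVQB@CC??PCABD@AS??TVQBD@@PCFAesh7BSC?Ep4p0Ct88A@?@VVpfpdp`Cu8<AAQq1Bt88@Q?EE@?@fVpfpdp`Ct
h;AAQq1Bsh7@Q@A";
"?UUWTVQB@CC??PCABB??TVQBD@@PCFAetH8SB?EE@?@ffVFpdp`CAAQQRRORpgE@FApapaORp5p0FAPPOEGABqfqaBth:@
?A?@A@?@@Q@A";
"?UUWTVQB@CC??PCABB??TVQBD@@PCFAeth9SB?EE@?Vga?Tp6p1BqDq@CuH;A@@A@A"];
 ["?UEWQQp5evH<p5Up4D@CvH<ABv8;?p0CABB??p4DTevX;@CvH:ABv89?PCFA@R?E@?@AAp0CFASp4B?EA?GGA?T@AA@Abb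
_Ap2p/p/p5p0Ce`OOreuh:p6fVQQqDrdr`CvH<ABv8;?q@paQOOWWQq/RrTr6E@?@sDs@QpAR@q/PA@A?@?Ar1?@rPq?`A
@A?@?ArA?@OAAp1aa`pa@pRp?pBp?TPAp_cp4p0p_Sp3p/p0PVq3vdv`CxHDABwhB?aQQPbOD@_x@CwhB?EwXAA?OPAOPA
O_A_AQ";
"?UEsX7WVD@CFAAQQBROpEEp4p0`SvX<?@WvH;A@`FdvH;`Cv8:?@Wuh9AA@RpDv8:p@Cuh9?@WuX8A??TVQBDB?EGGGGTP
CT?E@Q?cD@_AAAAA@@PCFA@R?EGGGGp3c_pCU@WQQRO``e`r2r/A@r/Ap3aP`@QQRB?AU@?_@WGA?p7p1d`CCC?Fqbp5@Q
QRB?AU@?q_p/p@pA`a_fOq4p6r5q@qQQRB?AU@?p1@Ab___ePUApATqgqQ?@qaqaRPPp2OO@?QQ@?p5@WQ?@QQO`POQ?t`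
uTuPA?uPA?A?PA@?`p1p0qaqaRpAO`POOaaOq_pGQp5p0`Wx5w@wQpQa``_p0qA?rer`rPp4p0p5p0q5q0}dGqVqQq?p?p
?p?p?pApApApApArArApb_@pOp/qBqBU@pr@pqQQPrRq_r0PVu9DQQ@bOROPAp`Sp5p0p/OffpCp/pAQTz1?@A@?qAqAOO
pGPa`a`a`_AqQp@BpBy3poH`xOxOW~h^A`A?@?AaO?q?q?p/q/p/p1p/pAbpGpA@pDuiGp@CtiC?QP?p7p1gaaTPPSq4p@
A?q0pPASc_p1QTv1?@A@?@q?@QpGs3s/s1p1p0p1`_OP?Aq?q0pP`AgaqGqAq4q0epsF|_}1v?uQpApAp?pAp?p?_r/rU@
pG`p1QP?Aq1q1P?@A?p1rPPaaaBR|IDO`PVx9@QQ@b_p4@C{9k???psApr_}?}Q}Qw/p_p`papapOpQpQpQp0p0p0_aaOA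
tRrOrPp``___p1p0u/s_rUpPpVp1?p_pPpP`p1p1p/p1_pB@A@A?@?AOpQp0Ar_qAapAOOp1Q_AQQ@A?P?@?A@QP?@AsA@
?OA?@?q0pAQOOWGA?T@AO?@WWr2p/pDp@A?p@Pp7p1D@CC?@?gQQsadTpfpapa@bsFr?rQQO@A?A?PPQQ?@?@AsAsAr__`
?q?qB@A?PA?rOpDp/`pdPQ?A?@A?p/q?_OPP?APP?A?p/p@pA`OQ@ROA@?A?AAAAAAA";
"?UUWTVQB@CC??PCFABp6p1B@@AC?ABD@AS??TVQBDUtH8VQBDw8B@b_EADcw8B_GvhAA?TvX@@@@@@PCFA@p5sh7RcSOEp
FOE@@?@AqABDvXA@CvH@?Gv8?A?Tuh>@@OEE@?@A@qQB?q7TvH:PCv89?Guh8A?TuX7@q1q1p?__pDp@p@qDv89q@q@Suh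
8OOWuX7QQOOQQpTpPpPs4rdsDpTpP__q0p3wh9Uwh8POQQs@r?s0r_r_sPp3p/@Ap/p0PpEp@?Ap@p?p1p1p/pApAp@p1p
0p/A@t`tOsQaa_A@wPw@sDs@s0r`__s_uTuPr`r@__q5UtCt0?At?t@t/t5t0?At0s?s?pApApApAp@p@uOtOs?r`p0p0p
Ap@pQpApAp@pAp@sDs1pOp0p/p/p1p/p1P?AvTtOr_QQqZc4uOs1P?@Ap`p`?AtOr@p0P@@A";
"?UUWTVQB@CC??PCABD@AS??TVQBD@@PCFAetH8BSC?Ep4p0CtX9A@?FA?EE@?VA@A";
"EEGDFAB@CC??@CABB??DFABD@@@CFASB?EE@?VA@A";
"EEGDFAB@CC??@CABB??DFABD@@@CFASB?EE@?VA@A";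
"EEGDFAB@CC??@CABB??DFABD@@@CFASB?EE@?VA@A"];
 ["?UEWQQp5ewH>p5Up4D@CwH>ABw8=?p0CABB??p4DTewX=@CwH<ABw8;?PCFA@R?E@?@AAp0CFASp4B?EA?GGA?T@AA@RRO
ROUPCUPOOp6p1aa`pa@pRp?pBp?p/d`Aq/cpDp@p@q?cSOPPpSpOp1p1p1PbOD@Ap/csCs?s@PVQQPPu?pBp/sUsP?AsPs
ap0pAp3p/aQBqRqOp?qTqPAr_cpDp@p@q?c__`Aap@C?@?AOPAO?A@?Ap1_OPA?_PAOPAO_AOAQ";
"?UEt88WVD@CFAAQQBROpEEp4p0`SwX>?@WwH=A@`FdwH=`Cw8<?@Wvh;AA@RpDw8<p@Cvh;?@WvX:A??TVQBDB?EGGGGGT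
PCT?E@Q?cD@_AAAAAA@@PCFA@R?EGGGGGp3c_pCUGAB?Epbp_A@p_QQT@@@QQRB?AU@?_@WGAgaTPCC?@WfagarBpOp`p0
`___q?qB`gtetau4u0PS?@WAAq?pO_PPQ@ga?@?A?AAAAAAAA";
"?UUWTVQB@CC??PCFABp6p1B@@AC?ABD@AS??TVQBDUth9VQBDx8E@b_EADcx8E_GwhDA?TwXC@@@@@PCFA@p5tH8RcSOEp
FOE@@?@AqABDwXD@CwHC?Gw8BA?TvhA@@OEE@?@AqABpWDwH<@Cw8;?Gvh:A?TvX9@pQpQOOp4p0p0p4p0__pPep3p/@Ap
/p0PpEp@?Ap@aaapa?Tp@p@p0bOOpPeU?GA?T@`OA@`OAP@@A";
"?UUWTVQB@CC??PCABD@AS??TVQBD@@PCFAeth9BSC?Ep4p0Cu8:A@?FA?EE@?VA@A";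
"EEGDFAB@CC??@CABB??DFABD@@@CFASB?EE@?VA@A";
"EEGDFAB@CC??@CABB??DFABD@@@CFASB?EE@?VA@A";
"EEGDFAB@CC??@CABB??DFABD@@@CFASB?EE@?VA@A";
"EEGDFAB@CC??@CABB??DFABD@@@CFASB?EE@?VA@A"];
 ["?UEWQQp5exH@p5Up4D@CxH@ABx8??p0CABB??p4DTexX?@CxH>ABx8=?PCFA@R?E@?@AAp0CFASp4B?EA?GGA?T@AA@RRO
RE@CFA@R?AOAQ";
"?UEtX9WVD@CFAAQQBROpEEp4p0`SxX@?@WxH?A@`FdxH?`Cx8>?@Wwh=AA@RpDx8>p@Cwh=?@WwX<A??TVQBDB?EGGGGGG
TPCT?E@Q?cD@_AAAAAAA@@PCFA@R?EGGGGGGp3c_pCUGAB?Epbp_A@p_QQT@@@QQRB?AU@?_@WGAgD@CC?@WA?AAAAAAAA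
A";
"?UUWTVQB@CC??PCFABp6p1B@@AC?ABD@AS??TVQBDUuH:VQBDy8H@b_EADcy8H_GxhGA?TxXF@@@@@PCFA@p5th9RcSOEp
FOE@@?@AqABDxXG@CxHF?Gx8EA?TwhD@@OEE@?@AqABpWDxH>@Cx8=?Gwh<A?TwX;@pQpQOOp4p0p0p4p0__pPep3p/p0P
pEp@aaapa?Tp@p@p0bOOpPeU?GA?T@`OA@`OAP@@A";
"?UUWTVQB@CC??PCABD@AS??TVQBD@@PCFAeuH:BSC?Ep4p0CuX;A@?FA?EE@?VA@A";
"EEGDFAB@CC??@CABB??DFABD@@@CFASB?EE@?VA@A";
"EEGDFAB@CC??@CABB??DFABD@@@CFASB?EE@?VA@A";
"EEGDFAB@CC??@CABB??DFABD@@@CFASB?EE@?VA@A";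
"EEGDFAB@CC??@CABB??DFABD@@@CFASB?EE@?VA@A";
"EEGDFAB@CC??@CABB??DFABD@@@CFASB?EE@?VA@A"]].

Local Close Scope string_scope.

Require Import Defs.
From HB Require Import structures.
From mathcomp Require Import all_boot all_order all_algebra.
From mathcomp Require Import boolp classical_sets functions cardinality.
From mathcomp Require Import ssrZ zify.

Set Implicit Arguments.
Unset Strict Implicit.
Unset Printing Implicit Defensive.

Import Order.TTheory GRing.Theory Num.Theory.

Local Open Scope classical_set_scope.
Local Open Scope ring_scope.

(** * Cartan schemes as arrangements *)

Notation i0 := (inord 0 : 'I_3).
Notation i1 := (inord 1 : 'I_3).
Notation i2 := (inord 2 : 'I_3).

Lemma ord3P (P : 'I_3 -> Prop) : P i0 -> P i1 -> P i2 -> forall i, P i.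
Proof.
move=> P0 P1 P2 [[|[|[|//]]] lt_i3].
- by have -> : Ordinal lt_i3 = i0 by apply/val_inj; rewrite /= inordK.
- by have -> : Ordinal lt_i3 = i1 by apply/val_inj; rewrite /= inordK.
- by have -> : Ordinal lt_i3 = i2 by apply/val_inj; rewrite /= inordK.
Qed.

Lemma ord3_neq : ((i0 == i1) = false) * ((i0 == i2) = false) * ((i1 == i0) = false) *
  ((i1 == i2) = false) * ((i2 == i0) = false) * ((i2 == i1) = false).
Proof. by do !split; apply/eqP => /(congr1 val); rewrite /= !inordK. Qed.

Lemma sum3 (V : zmodType) (F : 'I_3 -> V) : \sum_i F i = F i0 + F i1 + F i2.
Proof.
rewrite !big_ord_recl big_ord0 addr0 addrA.
by do 2?congr (_ + _); congr F; apply/val_inj; rewrite /= inordK.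
Qed.

Definition toV (v : lattice 'I_3) : vec := (Z_of_int (v i0), Z_of_int (v i1), Z_of_int (v i2)).

Definition ofV (t : vec) : lattice 'I_3 :=
  let: (x, y, z) := t in
  [ffun k : 'I_3 => int_of_Z (if k == i0 then x else if k == i1 then y else z)].

Lemma toVK : cancel toV ofV.
Proof.
move=> v; apply/ffunP; apply: ord3P; rewrite ffunE ?ord3_neq ?eqxx Z_of_intK //.
Qed.

Lemma ofVK : cancel ofV toV.
Proof. by move=> [[x y] z]; rewrite /toV !ffunE !eqxx !ord3_neq !int_of_ZK. Qed.

Lemma toV_inj : injective toV. Proof. exact: can_inj toVK. Qed.

Lemma toVD u v : toV (u + v) = vadd (toV u) (toV v).
Proof. by rewrite /toV !ffunE !raddfD. Qed.

Lemma toVN u : toV (- u) = vopp (toV u).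
Proof. by rewrite /toV !ffunE !raddfN. Qed.

Lemma toVMz u n : toV (u *~ n) = vscal (Z_of_int n) (toV u).
Proof. by rewrite /toV !ffunMzE !mulrzz !rmorphM /= ![(_ * Z_of_int n)%R]mulrC. Qed.

Lemma toV_simple i : toV (simple_root i) = wall i std_basis.
Proof.
by elim/ord3P: i; rewrite /toV !ffunE !eqxx ?ord3_neq /wall /= inordK.
Qed.

Definition next1 (i : 'I_3) : 'I_3 := inord ((i + 1) %% 3).
Definition next2 (i : 'I_3) : 'I_3 := inord ((i + 2) %% 3).

Lemma next1E : (next1 i0 = i1) * (next1 i1 = i2) * (next1 i2 = i0).
Proof. by rewrite /next1 !inordK. Qed.

Lemma next2E : (next2 i0 = i2) * (next2 i1 = i0) * (next2 i2 = i1).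
Proof. by rewrite /next2 !inordK. Qed.

Ltac bcbv := cbv [cross_basis rotate unrotate wall std_basis e0 e1 e2 fst snd].

Definition map_basis (f : vec -> vec) (B : basis) : basis :=
  let: (x, y, z) := B in (f x, f y, f z).

Lemma comb_std v : comb std_basis v = v.
Proof. by move: v => [[x y] z]; bcbv; vring. Qed.

Lemma comb_map S B v : comb (map_basis (comb S) B) v = comb S (comb B v).
Proof. by move: B v => [[x y] z] v; rewrite comb_comb. Qed.

Lemma comb_cross_basis i m n B v :
  comb (cross_basis i B m n) v = comb B (comb (cross_basis i std_basis m n) v).
Proof.
by move: B => [[x y] z]; case: i => [|[|i]]; bcbv; clear; vring.
Qed.

Lemma map_cross_basis S i B m n :
  map_basis (comb S) (cross_basis i B m n) = cross_basis i (map_basis (comb S) B) m n.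
Proof.
move: B => [[x y] z]; case: i => [|[|i]]; bcbv; rewrite /map_basis.
all: by rewrite comb_opp !comb_addscal.
Qed.

Lemma map_comb_std B : map_basis (comb B) std_basis = B.
Proof.
by move: B => [[x y] z]; rewrite /map_basis; bcbv; congr (_, _, _); vring.
Qed.

Lemma comb_wall B i : comb B (wall i std_basis) = wall i B.
Proof.
by move: B => [[x y] z]; case: i => [|[|i]]; bcbv; vring.
Qed.

Section Scheme.
Variable C : cartan_scheme 'I_3.
Implicit Types a b : object C.

Definition entry b (i j : 'I_3) : Z := Z.opp (Z_of_int (cartan b i j)).

Definition step b (i : 'I_3) (B : basis) : basis :=
  cross_basis i B (entry b i (next1 i)) (entry b i (next2 i)).

(* chamber a b B: B lists the images of the simple roots under a morphism from b to a. *)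
Inductive chamber a : object C -> basis -> Prop :=
| chamber_id : chamber a a std_basis
| chamber_step b B i : chamber a b B -> chamber a (rho i b) (step b i B).

Lemma cartan_diag b i : cartan b i i = 2.
Proof. by have [] := cartan_gcm b. Qed.

Lemma entry_ge0 b i j : i != j -> Z.le 0 (entry b i j).
Proof.
move=> neq_ij; have [_ /(_ _ _ neq_ij) le0 _] := cartan_gcm b.
by rewrite /entry; lia.
Qed.

Lemma entry_rho b i j : entry (rho i b) i j = entry b i j.
Proof. by rewrite /entry -cartan_rho. Qed.

Lemma toV_sigma i a v : toV (sigma i a v) = comb (step a i std_basis) (toV v).
Proof.
rewrite /sigma sum3 {2}/toV !toVD !toVMz !toVD !toVN !toVMz !toV_simple.
rewrite /step /entry.
move: (Z_of_int (v i0)) (Z_of_int (v i1)) (Z_of_int (v i2)) => x y z.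
have Z2 : Z_of_int 2 = Zpos 2 by [].
elim/ord3P: i; rewrite cartan_diag ?next1E ?next2E Z2 !inordK //.
all: set p := Z_of_int (cartan _ _ _); set q := Z_of_int (cartan _ _ _).
all: cbv [cross_basis rotate unrotate wall std_basis e0 e1 e2 fst snd
  vadd vopp vscal comb]; apply: vec_eq; ring.
Qed.

Lemma comb_step b i B v : comb (step b i B) v = comb B (comb (step b i std_basis) v).
Proof. exact: comb_cross_basis. Qed.

(** Morphisms are built by composition on the left, galleries of chambers by composition on the
    right. This lemma and [chamber_left] translate between the two. *)
Lemma weyl_hom_right a b i w : weyl_hom b a w -> weyl_hom (rho i b) a (w \o sigma i (rho i b)).
Proof.
elim=> [|j c w' hom_w' IH].
  have := weyl_hom_sigma i (weyl_hom_id (rho i b)).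
  by rewrite (@rhoK _ C i b).
exact: (weyl_hom_sigma j IH).
Qed.

Lemma step_rho b i B : step (rho i b) i B = step b i B.
Proof. by rewrite /step !entry_rho. Qed.

Lemma chamber_hom a b B : chamber a b B ->
  exists2 w, weyl_hom b a w & forall v, toV (w v) = comb B (toV v).
Proof.
elim=> [|{}b {}B i _ [w hom_w wE]].
  exists id => [|v]; first exact: weyl_hom_id.
  by rewrite comb_std.
exists (w \o sigma i (rho i b)); first exact: weyl_hom_right.
by move=> v; rewrite /= wE toV_sigma step_rho -comb_step.
Qed.

Lemma chamber_left c b B i : chamber c b B ->
  chamber (rho i c) b (map_basis (comb (step c i std_basis)) B).
Proof.
elim=> [|{}b {}B j _ IH].
  rewrite map_comb_std; have := chamber_step i (chamber_id (rho i c)).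
  by rewrite rhoK step_rho.
by rewrite /step map_cross_basis; apply: chamber_step.
Qed.

Lemma hom_chamber a b w : weyl_hom b a w ->
  exists2 B, chamber a b B & forall v, toV (w v) = comb B (toV v).
Proof.
elim=> [|i {}a {}w _ [B chB wE]].
  exists std_basis => [|v]; first exact: chamber_id.
  by rewrite comb_std.
exists (map_basis (comb (step a i std_basis)) B); first exact: chamber_left.
by move=> v; rewrite /= toV_sigma wE comb_map.
Qed.

Lemma real_rootsP a v : real_roots a v <->
  exists b B (i : 'I_3), chamber a b B /\ toV v = wall i B.
Proof.
split=> [[b [w [i [/hom_chamber [B chB wE] ->]]]]|[b [B [i [/chamber_hom [w hom_w wE] vE]]]]].
  by exists b, B, i; split=> //; rewrite wE toV_simple comb_wall.
exists b, w, i; split=> //; apply: toV_inj.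
by rewrite wE toV_simple comb_wall.
Qed.
End Scheme.

(** * The six orders of the simple roots *)

Definition permb (p : nat) (B : basis) : basis :=
  let: (x, y, z) := B in
  match p with
  | 0%N => (x, y, z) | 1%N => (y, z, x) | 2%N => (z, x, y)
  | 3%N => (y, x, z) | 4%N => (x, z, y) | _ => (z, y, x)
  end.

(** The codes 1 and 2 are the two cyclic rotations, inverse to each other; all other permutations
    are their own inverses. *)
Definition permv_inv (p : nat) (v : vec) : vec :=
  permv (match p with 1%N => 2%N | 2%N => 1%N | q => q end) v.

Lemma permv_invK p : cancel (permv_inv p) (permv p).
Proof. by move=> [[x y] z]; case: p => [|[|[|[|[|p]]]]]. Qed.

Lemma permvK p : cancel (permv p) (permv_inv p).
Proof. by move=> [[x y] z]; case: p => [|[|[|[|[|p]]]]]. Qed.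

Lemma comb_permb p B v : comb (permb p B) v = comb B (permv_inv p v).
Proof.
move: B v => [[x y] z] v; case: p => [|[|[|[|[|p]]]]]; rewrite /permb /permv_inv /permv.
all: clear; vring.
Qed.

Lemma det_permb p B : det (permb p B) = det B \/ det (permb p B) = Z.opp (det B).
Proof.
move: B => [[x y] z]; case: p => [|[|[|[|[|p]]]]]; rewrite /permb.
1: by left.
1,2: by left; clear; vring.
all: by right; clear; vring.
Qed.

Lemma permb_swap p B : exists q, forall x y z, permb p B = (x, y, z) -> permb q B = (y, x, z).
Proof.
move: B => [[x y] z]; case: p => [|[|[|[|[|p]]]]].
- by exists 3%N => a b c [<- <- <-].
- by exists 5%N => a b c [<- <- <-].
- by exists 4%N => a b c [<- <- <-].
- by exists 0%N => a b c [<- <- <-].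
- by exists 2%N => a b c [<- <- <-].
- by exists 1%N => a b c [<- <- <-].
Qed.

Lemma permb_rot p B : exists q, forall x y z, permb p B = (x, y, z) -> permb q B = (y, z, x).
Proof.
move: B => [[x y] z]; case: p => [|[|[|[|[|p]]]]].
- by exists 1%N => a b c [<- <- <-].
- by exists 2%N => a b c [<- <- <-].
- by exists 0%N => a b c [<- <- <-].
- by exists 4%N => a b c [<- <- <-].
- by exists 5%N => a b c [<- <- <-].
- by exists 3%N => a b c [<- <- <-].
Qed.

(* x is the i-th vector of B, and y, z are the next two in one order or the other. *)
Lemma permb_cross p B : exists i : 'I_3, forall x y z, permb p B = (x, y, z) ->
  (forall m n, exists q, permb q (cross_basis i B m n) = (vopp x, vadd y (vscal m x), vadd z (vscal n x))) \/
  (forall m n, exists q, permb q (cross_basis i B n m) = (vopp x, vadd y (vscal m x), vadd z (vscal n x))).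
Proof.
move: B => [[x y] z]; case: p => [|[|[|[|[|p]]]]].
- by exists i0 => a b c [<- <- <-]; left=> m n; exists 0%N; rewrite inordK.
- by exists i1 => a b c [<- <- <-]; left=> m n; exists 1%N; rewrite inordK.
- by exists i2 => a b c [<- <- <-]; left=> m n; exists 2%N; rewrite inordK.
- by exists i1 => a b c [<- <- <-]; right=> m n; exists 3%N; rewrite inordK.
- by exists i0 => a b c [<- <- <-]; right=> m n; exists 4%N; rewrite inordK.
- by exists i2 => a b c [<- <- <-]; right=> m n; exists 5%N; rewrite inordK.
Qed.

(** * The arrangement seen from an object *)

Section RootSystem.
Variable C : cartan_scheme 'I_3.
Hypothesis rsC : is_root_system C.
Implicit Types a b : object C.

Definition Rt a (v : vec) : Prop := real_roots a (ofV v).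
Definition Ch a (x y z : vec) : Prop :=
  exists b B p, chamber a b B /\ permb p B = (x, y, z).

Lemma chamber_unimod a b B : chamber a b B -> unimodular B.
Proof.
rewrite /unimodular; elim=> [|{}b {}B i _ IH]; first by left.
by rewrite /step det_cross; case: IH => ->; [right | left].
Qed.

Lemma chamber_roots a b B : chamber a b B -> forall v, Rt a (comb B v) <-> Rt b v.
Proof.
elim=> [v|{}b {}B i chB IH v]; first by rewrite comb_std.
rewrite comb_step IH /Rt.
have [_ _ R3 _] := rsC (rho i b) i i; rewrite rhoK in R3; rewrite -R3.
split=> [[u Ru /(congr1 toV)]|Rv].
  rewrite toV_sigma ofVK step_rho => /comb_inj E.
  by rewrite -E ?toVK //; apply: chamber_unimod (chamber_step _ (chamber_id _)).
exists (ofV v) => //; apply: toV_inj.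
by rewrite toV_sigma !ofVK step_rho.
Qed.

Lemma Z_of_int_ge0 (x : int) : 0 <= x -> Z.le 0 (Z_of_int x).
Proof. lia. Qed.

Lemma Z_of_intN_le0 (x : int) : 0 <= x -> Z.le (Z_of_int (- x)) 0.
Proof. lia. Qed.

Lemma Rt_sign b v : Rt b v ->
  let: (x, y, z) := v in
  (Z.le 0 x /\ Z.le 0 y /\ Z.le 0 z) \/ (Z.le x 0 /\ Z.le y 0 /\ Z.le z 0).
Proof.
have [R1 _ _ _] := rsC b i0 i0.
rewrite /Rt R1 -{2}[v]ofVK => -[[_ pos]|[u [_ pos] <-]]; rewrite /toV /=.
  by left; split; [|split]; apply: Z_of_int_ge0; apply: pos.
by right; rewrite !ffunE; split; [|split]; apply: Z_of_intN_le0; apply: pos.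
Qed.

Lemma chamber_wall a b B (i : nat) : chamber a b B -> Rt a (wall i B).
Proof.
move=> chB.
have [j ->] : exists j : 'I_3, wall i B = wall j B.
  case: i => [|[|i]]; [exists i0 | exists i1 | exists i2]; rewrite inordK //.
by apply/real_rootsP; exists b, B, j; split; rewrite ?ofVK.
Qed.

Lemma Rt_wall a v : Rt a v -> exists b B (i : 'I_3), chamber a b B /\ v = wall i B.
Proof. by move=> /real_rootsP; rewrite ofVK. Qed.

Lemma wall_permb i B : exists p y z, permb p B = (wall i B, y, z).
Proof.
move: B => [[x y] z]; case: i => [|[|i]].
- by exists 0%N, y, z.
- by exists 1%N, z, x.
- by exists 2%N, x, y.
Qed.

Lemma permb_unimod p B : unimodular B -> unimodular (permb p B).
Proof. by rewrite /unimodular; case: (det_permb p B) => -> // [] ->; [right | left]. Qed.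

Lemma next1_neq (i : 'I_3) : i != next1 i.
Proof. by elim/ord3P: i; rewrite next1E ord3_neq. Qed.
Lemma next2_neq (i : 'I_3) : i != next2 i.
Proof. by elim/ord3P: i; rewrite next2E ord3_neq. Qed.

Lemma Ch_refl a x y z : Ch a x y z -> exists m n, Z.le 0 m /\ Z.le 0 n /\
  Ch a (vopp x) (vadd y (vscal m x)) (vadd z (vscal n x)) /\
  (irreducible_scheme C -> m <> Z0 \/ n <> Z0).
Proof.
move=> [b [B [p [chB E]]]]; have [i /(_ _ _ _ E) H] := permb_cross p B.
have chB' := chamber_step i chB.
have irr : irreducible_scheme C -> entry b i (next1 i) <> Z0 \/ entry b i (next2 i) <> Z0.
  move=> irrC; apply: contrapT => /not_orP [/contrapT e1 /contrapT e2].
  (* A zero row at i, with the column that vanishes along with it, separates i from the other two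
     indices. *)
  apply: (irrC b); exists [set i]%SET; split.
  - by exists i; rewrite inE.
  - by exists (next1 i); rewrite inE eq_sym next1_neq.
  move=> j k /set1P -> {j}; rewrite inE => neq_ki.
  have z_ik : cartan b i k = 0.
    have : k = next1 i \/ k = next2 i.
      move: neq_ki; elim/ord3P: i {H chB' e1 e2}; elim/ord3P: k;
      rewrite ?next1E ?next2E ?eqxx //; tauto.
    by move: e1 e2; rewrite /entry => e1 e2 [->|->]; lia.
  by split=> //; have [_ _ /(_ _ _ z_ik)] := cartan_gcm b.
have ge1 : Z.le 0 (entry b i (next1 i)) by exact/entry_ge0/next1_neq.
have ge2 : Z.le 0 (entry b i (next2 i)) by exact/entry_ge0/next2_neq.
case: H => H.
  have [q Eq] := H (entry b i (next1 i)) (entry b i (next2 i)).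
  by do 2 eexists; split; [exact: ge1 | split; [exact: ge2 | split=> //]]; exists (rho i b), (step b i B), q.
have [q Eq] := H (entry b i (next2 i)) (entry b i (next1 i)).
do 2 eexists; split; [exact: ge2 | split; [exact: ge1 | split; first by exists (rho i b), (step b i B), q]].
by move=> /irr; tauto.
Qed.

Lemma Ch_coherent a x y z v : Ch a x y z -> Rt a v -> coherent (dual_basis (x, y, z)) v = true.
Proof.
move=> [b [B [p [chB E]]]] Rv; have U := permb_unimod p (chamber_unimod chB).
apply/coherentE; first by rewrite -E.
have Ev := comb_coords _ v U; case Et: (coords (dual_basis (permb p B)) v) Ev => [[r s] t] Ev.
exists r, s, t; rewrite -E Ev; split=> //.
move: Rv; rewrite -Ev comb_permb (chamber_roots chB) => /Rt_sign.
by case: (p) => [|[|[|[|[|?]]]]] /=; lia.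
Qed.

(** Two chambers are connected through the standard one, so the property must also travel backwards:
    crossing the same wall again with the same entries undoes a step. [Q] collects all orders of a
    basis, which frees the steps from the position of the wall. *)
Lemma Ch_gallery a (P : vec -> vec -> vec -> Prop) :
  (forall x y z, P x y z -> P y x z) -> (forall x y z, P x y z -> P y z x) ->
  (forall x y z m n, Ch a x y z -> P x y z -> Z.le 0 m -> Z.le 0 n ->
     Ch a (vopp x) (vadd y (vscal m x)) (vadd z (vscal n x)) ->
     P (vopp x) (vadd y (vscal m x)) (vadd z (vscal n x))) ->
  forall x y z, Ch a x y z -> P x y z -> forall x' y' z', Ch a x' y' z' -> P x' y' z'.
Proof.
move=> Psw Prt Pst.
pose Q B := forall p, let: (x, y, z) := permb p B in P x y z.
have Q1 p B : (let: (x, y, z) := permb p B in P x y z) -> Q B.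
  have Q0 : (let: (x, y, z) := B in P x y z) -> Q B.
    move: B => [[x y] z] Pxyz q; case: q => [|[|[|[|[|q]]]]] /=; auto.
  move=> H; apply: Q0; move: B H => [[x y] z].
  by case: p => [|[|[|[|[|p]]]]] /=; auto.
have Qstep b B i : chamber a b B -> (Q B <-> Q (step b i B)).
  move=> chB.
  have [p [y [z Ep]]] := wall_permb i B.
  have /(_ i) step_eq : forall i : 'I_3, permb i (step b i B) =
      (vopp (wall i B), vadd (wall (next1 i) B) (vscal (entry b i (next1 i)) (wall i B)),
       vadd (wall (next2 i) B) (vscal (entry b i (next2 i)) (wall i B))).
    by apply: ord3P; rewrite ?next1E ?next2E /step ?next1E ?next2E !inordK //; case: (B) => [[? ?] ?].
  have /(_ i) B_eq : forall i : 'I_3, permb i B = (wall i B, wall (next1 i) B, wall (next2 i) B).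
    by apply: ord3P; rewrite ?next1E ?next2E !inordK //; case: (B) => [[? ?] ?].
  have ge1 : Z.le 0 (entry b i (next1 i)) by exact/entry_ge0/next1_neq.
  have ge2 : Z.le 0 (entry b i (next2 i)) by exact/entry_ge0/next2_neq.
  have chx : Ch a (wall i B) (wall (next1 i) B) (wall (next2 i) B) by exists b, B, (i : nat).
  have chx' : Ch a (vopp (wall i B)) (vadd (wall (next1 i) B) (vscal (entry b i (next1 i)) (wall i B)))
       (vadd (wall (next2 i) B) (vscal (entry b i (next2 i)) (wall i B))).
    by exists (rho i b), (step b i B), (i : nat); split=> //; exact: chamber_step.
  split=> HQ.
    apply: (Q1 i); rewrite step_eq; apply: Pst => //.
    by have := HQ i; rewrite B_eq.
  apply: (Q1 i); rewrite B_eq.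
  have inv u m x : vadd (vadd u (vscal m x)) (vscal m (vopp x)) = u by clear; vring.
  have := Pst _ _ _ _ _ chx' _ ge1 ge2; rewrite !inv.
  have -> u : vopp (vopp u) = u by clear; vring.
  by apply=> //; have := HQ i; rewrite step_eq.
have Qstd b B : chamber a b B -> (Q B <-> Q std_basis).
  by elim=> [|{}b {}B i chB IH]; [split | rewrite -IH -(Qstep _ _ _ chB)].
move=> x y z [b [B [p [chB E]]]] Pxyz x' y' z' [b' [B' [p' [chB' E']]]].
have : Q B by apply: (Q1 p); rewrite E.
rewrite (Qstd _ _ chB) -(Qstd _ _ chB') => /(_ p'); by rewrite E'.
Qed.

Lemma scheme_arrangement a : finite_set (real_roots a) -> arrangement (Rt a) (Ch a).
Proof.
move=> fin; split.
- move=> x y z [b [B [p [chB E]]]]; have [q /(_ _ _ _ E) Eq] := permb_swap p B.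
  by exists b, B, q.
- move=> x y z [b [B [p [chB E]]]]; have [q /(_ _ _ _ E) Eq] := permb_rot p B.
  by exists b, B, q.
- move=> x y z [b [B [p [chB E]]]].
  have [i ->] : exists i, x = wall i B.
    move: B E {chB} => [[r s] t]; case: p => [|[|[|[|[|p]]]]] [<- _ _].
    + by exists 0%N. + by exists 1%N. + by exists 2%N.
    + by exists 1%N. + by exists 0%N. + by exists 2%N.
  exact: chamber_wall chB.
- by move=> x y z [b [B [p [chB <-]]]]; apply/permb_unimod/(chamber_unimod chB).
- exact: Ch_coherent.
- by move=> x y z /Ch_refl [m [n [? [? [? _]]]]]; exists m, n.
- have /finite_seqP [s Es] := fin.
  exists (List.map toV s) => v; rewrite List.in_map_iff /Rt Es; split=> [|[u [<- us]]].
    move=> vs; exists (ofV v); split; first exact: ofVK.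
    by elim: (s) vs => //= u s' IH; rewrite inE => /predU1P [->|/IH]; [left | right].
  rewrite toVK /=; elim: (s) us => //= w s' IH [->|/IH]; rewrite inE ?eqxx // => ->.
  by rewrite orbT.
- move=> v /Rt_wall [b [B [i [chB ->]]]]; have [p [y [z E]]] := wall_permb i B.
  by exists y, z, b, B, p.
- exact: Ch_gallery.
- by exists e0, e1, e2, a, std_basis, 0%N; split=> //; exact: chamber_id.
Qed.

(** The given chamber across the wall is not assumed to be the reflected one. By [string_le] its
    entries are at least those of the reflection, and one of the latter is nonzero. *)
Lemma scheme_irreducible a x y z m n : finite_set (real_roots a) ->
  irreducible_scheme C -> Ch a x y z ->
  Ch a (vopp x) (vadd y (vscal m x)) (vadd z (vscal n x)) -> m <> Z0 \/ n <> Z0.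
Proof.
move=> fin irrC ch ch'; have arr := scheme_arrangement fin.
have [m' [n' [m'_ge0 [n'_ge0 [ch'' /(_ irrC) nz]]]]] := Ch_refl ch.
have := string_le _ _ arr _ _ _ _ _ _ ch ch' (Ch_root2 _ _ arr _ _ _ ch'').
have := string_le _ _ arr _ _ _ _ _ _ (Ch_swap23 _ _ arr _ _ _ ch)
  (Ch_swap23 _ _ arr _ _ _ ch') (Ch_root3 _ _ arr _ _ _ ch'').
by lia.
Qed.
End RootSystem.

(** * Normalization *)

Definition word_vec (t : nat * nat * nat) : vec :=
  let: (x, y, z) := t in (Z.of_nat z, Z.of_nat y, Z.of_nat x).
Definition targets : list (list vec) := List.map (List.map word_vec) root_list.

Lemma toVMn u n : toV (u *+ n) = vscal (Z.of_nat n) (toV u).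
Proof. by rewrite -[u *+ n]/(u *~ n%:Z) toVMz. Qed.

Lemma toV_word t : toV (word_root t) = word_vec t.
Proof.
move: t => [[x y] z]; rewrite /word_root !toVD !toVMn !toV_simple /word_vec.
rewrite !inordK //; bcbv; clear; cbn [vadd vscal]; apply: vec_eq; ring.
Qed.

Lemma mem_In (T : eqType) (x : T) (s : seq T) : x \in s <-> List.In x s.
Proof.
elim: s => [|y s IH] /=; first by rewrite in_nil.
rewrite inE; split=> [/predU1P [->|/IH]|[->|/IH ->]]; rewrite ?eqxx ?orbT //; tauto.
Qed.

Lemma listedP (R : set (lattice 'I_3)) : listed R <->
  exists2 l, List.In l targets & R = [set v | List.In (toV v) l].
Proof.
split=> [[l l_in ->]|[l' /List.in_map_iff [l [<- l_in]] ->]].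
  exists (List.map word_vec l); first exact/List.in_map_iff/(ex_intro _ l)/(conj erefl)/mem_In.
  apply/seteqP; split=> v /=.
    by move=> [t /mem_In t_in <-]; rewrite toV_word; apply: List.in_map.
  move=> /List.in_map_iff [t [E t_in]]; exists t; first exact/mem_In.
  by apply: toV_inj; rewrite toV_word.
exists l; first exact/mem_In.
apply/seteqP; split=> v /=.
  move=> /List.in_map_iff [t [E t_in]]; exists t; first exact/mem_In.
  by apply: toV_inj; rewrite toV_word.
by move=> [t /mem_In t_in <-]; rewrite toV_word; apply: List.in_map.
Qed.

(* Prevents tactics from computing with the 55 lists. *)
Opaque targets.

Definition targets_ok : Prop := forall l, List.In l targets ->
  list_ok l = true /\
  levels_ok l (List.filter (fun l' => same_length l l' && negb (veqs l l')) targets).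

Lemma targets_okP : List.forallb (check_list targets) targets = true -> targets_ok.
Proof.
move=> /List.forallb_forall H l /H /andP [ok /check_levels_ok lv]; by split.
Qed.

Lemma nneg_toV v : (nneg (toV v) = true) <-> (forall k, 0 <= v k).
Proof.
rewrite nnegE /toV; split=> [[h0 [h1 h2]]|H].
  by apply: ord3P; [move: h0|move: h1|move: h2]; lia.
by move: (H i0) (H i1) (H i2); lia.
Qed.

Lemma Rt_opp_root (C : cartan_scheme 'I_3) (a : object C) v :
  is_root_system C -> Rt a v -> Rt a (vopp v).
Proof.
move=> rsC; have [R1 _ _ _] := rsC a i0 i0.
have -> : Rt a (vopp v) = real_roots a (- ofV v).
  by rewrite /Rt; congr (real_roots a _); apply: toV_inj; rewrite toVN !ofVK.
rewrite /Rt R1 => -[[r p]|[u up <-]]; last by left; rewrite opprK.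
by right; exists (ofV v).
Qed.

Section Tau.
Variable tau : {additive lattice 'I_3 -> lattice 'I_3}.

Lemma toV_additive v : toV (tau v) =
  comb (toV (tau (simple_root i0)), toV (tau (simple_root i1)), toV (tau (simple_root i2))) (toV v).
Proof.
have E : v = simple_root i0 *~ v i0 + simple_root i1 *~ v i1 + simple_root i2 *~ v i2.
  apply: toV_inj; rewrite !toVD !toVMz !toV_simple !inordK // /toV.
  move: (Z_of_int (v i0)) (Z_of_int (v i1)) (Z_of_int (v i2)) => x y z; bcbv.
  by cbn [vadd vscal]; apply: vec_eq; ring.
by rewrite {1}E !raddfD /= !raddfMz !toVD !toVMz.
Qed.

Lemma normalizing_perm : injective tau ->
  (forall i : 'I_3, [\/ tau (simple_root i) = alpha1, tau (simple_root i) = alpha2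
     | tau (simple_root i) = alpha3]) ->
  exists p, forall v, toV (tau v) = permv p (toV v).
Proof.
move=> inj_tau H.
have ne i j : i != j -> tau (simple_root i) <> tau (simple_root j).
  move=> neq_ij /inj_tau /ffunP /(_ i); rewrite !ffunE eqxx (negPf neq_ij) => /eqP.
  by rewrite oner_eq0.
have n01 : i0 != i1 by rewrite ord3_neq.
have n02 : i0 != i2 by rewrite ord3_neq.
have n12 : i1 != i2 by rewrite ord3_neq.
move: (ne _ _ n01) (ne _ _ n02) (ne _ _ n12) => {ne}.
suff K p : forall x y z, (x, y, z) = permb (match p with 1%N => 2%N | 2%N => 1%N | q => q end) std_basis ->
    forall v, comb (x, y, z) v = permv p v.
  have W := toV_simple; rewrite /alpha1 /alpha2 /alpha3 in H.
  case: (H i0) (H i1) (H i2) => E0 [] E1 [] E2 //;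
    rewrite E0 E1 E2 // => _ _ _;
    [exists 0%N | exists 4%N | exists 3%N | exists 2%N | exists 1%N | exists 5%N] => v;
    rewrite toV_additive E0 E1 E2 !W !inordK //; exact: K.
move=> x y z -> [[r s] t]; case: p => [|[|[|[|[|p]]]]]; rewrite /permb; bcbv; clear.
all: by cbn [comb vadd vscal permv]; apply: vec_eq; ring.
Qed.
End Tau.

Lemma normalizes_perm (C : cartan_scheme 'I_3) (a : object C) tau :
  is_root_system C -> normalizes a tau -> exists p l, [/\ List.In l targets,
    forall v, Rt a v <-> within l (permv p v) &
    tau @` positive_roots a = [set v | List.In (toV v) l]].
Proof.
move=> rsC [bij simple /listedP [l l_in E]].
have inj_tau := bij_inj bij.
have [p tauE] := normalizing_perm inj_tau simple.
exists p, l; split=> // v.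
have pos u : positive_roots a u <-> List.In (permv p (toV u)) l.
  rewrite -tauE; have -> : List.In (toV (tau u)) l = (tau @` positive_roots a) (tau u) by rewrite E.
  by split=> [Hu|[w Hw /inj_tau <-//]]; exists u.
split.
  have [R1 _ _ _] := rsC a i0 i0; rewrite /Rt R1 => -[/pos|[u /pos Hu Eu]].
    by rewrite ofVK; left.
  right; move: Hu; rewrite -permv_opp.
  have -> : v = toV (- u) by rewrite Eu ofVK.
  by rewrite toVN vopp_opp.
move=> [H|H]; first by have /pos [] : List.In (permv p (toV (ofV v))) l by rewrite ofVK.
have : Rt a (vopp v).
  by rewrite -permv_opp in H; have /pos [] : List.In (permv p (toV (ofV (vopp v)))) l by rewrite ofVK.
by move=> /(Rt_opp_root rsC); rewrite vopp_opp.
Qed.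

Section Perm.
Variable p : nat.
Definition perm_lattice (v : lattice 'I_3) : lattice 'I_3 := ofV (permv p (toV v)).

Fact perm_lattice_is_zmod_morphism : zmod_morphism perm_lattice.
Proof.
move=> u v; apply: toV_inj; rewrite toVD toVN /perm_lattice !ofVK toVD toVN.
move: (toV u) (toV v) => [[x y] z] [[r s] t].
by case: p => [|[|[|[|[|q]]]]].
Qed.
HB.instance Definition _ := GRing.isZmodMorphism.Build _ _ perm_lattice
  perm_lattice_is_zmod_morphism.

End Perm.

Lemma perm_lattice_normalizes p (C : cartan_scheme 'I_3) (a : object C) l :
  list_ok l = true -> List.In l targets -> (forall v, Rt a v <-> within l (permv p v)) ->
  normalizes a (perm_lattice p).
Proof.
move=> ok l_in H; split.
- exists (fun v => ofV (permv_inv p (toV v))) => v; apply: toV_inj.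
    by rewrite /perm_lattice !ofVK permvK.
  by rewrite /perm_lattice !ofVK permv_invK.
- apply: ord3P; clear H; case: p => [|[|[|[|[|q]]]]];
  rewrite /= /perm_lattice toV_simple inordK //;
  solve [constructor 1; apply: toV_inj; rewrite /alpha1 ofVK toV_simple inordK //
    | constructor 2; apply: toV_inj; rewrite /alpha2 ofVK toV_simple inordK //
    | constructor 3; apply: toV_inj; rewrite /alpha3 ofVK toV_simple inordK //].
- apply/listedP; exists l => //.
  have nn v : nneg (permv p v) = nneg v.
    clear H.
    move: v => [[x y] z]; apply/idP/idP; rewrite -!/(is_true _) => /nnegE h; apply/nnegE;
    move: h; case: p => [|[|[|[|[|q]]]]] /=; tauto.
  apply/seteqP; split=> v /=.
    move=> [u [Ru /nneg_toV pos] <-]; rewrite /perm_lattice ofVK.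
    have /H [//|Hn] : Rt a (toV u) by rewrite /Rt toVK.
    have := within_sign l ok _ (or_introl Hn).
    by rewrite vopp_opp nn pos (list_root l ok _ Hn).1.
  move=> Hv; exists (ofV (permv_inv p (toV v))); last first.
    by apply: toV_inj; rewrite /perm_lattice !ofVK permv_invK.
  split; first by apply/H; rewrite permv_invK; left.
  by apply/nneg_toV; rewrite ofVK -nn permv_invK (list_root l ok _ Hv).1.
Qed.

Lemma within_coherent_perm p B v : unimodular B ->
  coherent (dual_basis (permb p B)) v = coherent (dual_basis B) v.
Proof.
move=> U; apply: Bool.eq_true_iff_eq; rewrite !coherentE //; last exact: permb_unimod.
have E : exists q, forall t, comb (permb p B) (permv q t) = comb B t.
  exists p => t; by rewrite comb_permb permvK.
have E' : exists q, forall t, comb (permb p B) t = comb B (permv q t).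
  by eexists => t; rewrite comb_permb.
split=> [[x [y [z [-> H]]]]|[x [y [z [-> H]]]]].
  have [q Eq] := E'; rewrite Eq; case Ev: (permv q (x, y, z)) => [[r s] t].
  by exists r, s, t; split=> //; move: Ev H; case: (q) => [|[|[|[|[|?]]]]] [<- <- <-]; lia.
have [q Eq] := E; rewrite -Eq; case Ev: (permv q (x, y, z)) => [[r s] t].
by exists r, s, t; split=> //; move: Ev H; case: (q) => [|[|[|[|[|?]]]]] [<- <- <-]; lia.
Qed.

Lemma wall_of_permb p B k : exists j, wall k B = wall j (permb p B).
Proof.
move: B => [[x y] z]; case: p => [|[|[|[|[|p]]]]]; case: k => [|[|k]];
by [exists 0%N | exists 1%N | exists 2%N].
Qed.

(** Induction along galleries: across each wall [reflection_unique] leaves a single candidate, so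
    the roots determine the chambers. *)
Lemma list_chambers Rt Ch l others : arrangement Rt Ch ->
  list_ok l = true -> levels_ok l others ->
  (forall v, Rt v <-> within l v) -> Ch e0 e1 e2 ->
  forall x y z, Ch x y z -> exists q B, reached l B /\ permb q B = (x, y, z).
Proof.
move=> arr ok lv RtE Ch0.
apply: (ch_gallery _ _ arr (fun x y z => exists q B, reached l B /\ permb q B = (x, y, z)) _ _ _ _ _ _ Ch0).
- move=> x y z [q [B [rB E]]]; have [q' /(_ _ _ _ E) Eq] := permb_swap q B.
  by exists q', B.
- move=> x y z [q [B [rB E]]]; have [q' /(_ _ _ _ E) Eq] := permb_rot q B.
  by exists q', B.
- move=> x y z m n ch [q [B [rB E]]] m0 n0 ch'.
  have [i /(_ _ _ _ E) H] := permb_cross q B.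
  suff K m' n' q' : permb q' (cross_basis i B m' n') =
    (vopp x, vadd y (vscal m x), vadd z (vscal n x)) -> exists q0 B0, reached l B0 /\
      permb q0 B0 = (vopp x, vadd y (vscal m x), vadd z (vscal n x)).
    by case: H => /(_ m n) [q' Eq']; apply: K Eq'.
  move=> Eq'; exists q', (cross_basis i B m' n'); split=> //.
  have U : unimodular (cross_basis i B m' n').
    have := reached_unimodular _ _ rB; rewrite /unimodular det_cross.
    by case=> ->; [right | left].
  have [-> _] : cross_basis i B m' n' = list_refl l i B /\
      (let '(a, b, c) := rotate i B in m' = climbs l a b /\ n' = climbs l a c).
    apply: (reflection_unique _ _ ok lv) => // [v /RtE Rv | k].
      have := ch_coherent _ _ arr _ _ _ _ ch' Rv.
      by rewrite -Eq' within_coherent_perm.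
    apply/RtE; have [j ->] := wall_of_permb q' (cross_basis i B m' n') k.
    rewrite Eq'; case: j => [|[|j]].
    - exact: ch_root _ _ arr _ _ _ ch'.
    - exact: ch_root _ _ arr _ _ _ (ch_rot _ _ arr _ _ _ ch').
    - exact: ch_root _ _ arr _ _ _ (ch_rot _ _ arr _ _ _ (ch_rot _ _ arr _ _ _ ch')).
  exact: (reached_refl _ _ lv).
- by exists 0%N, std_basis; split=> //; exact: reached_std.
Qed.

(** * Uniqueness of the normalized root set *)

Section Uniqueness.
Variables (C : cartan_scheme 'I_3) (a a' : object C) (l l' : list vec) (p p' : nat).
Variable others : list (list vec).
Hypotheses (rsC : is_root_system C) (connC : connected_scheme C).
Hypothesis fin : finite_set (real_roots a).
Hypotheses (ok : list_ok l = true) (lv : levels_ok l others).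
Hypothesis Rta : forall v, Rt a v <-> within l (permv p v).
Hypothesis Rta' : forall v, Rt a' v <-> within l' (permv p' v).

(** By connectedness a' is attached to a chamber seen from a. In the coordinates of l this chamber
    is a reordered reached basis B, and l' is l read in B. *)
Lemma lists_related : exists q B, reached l B /\
  forall v, within l v <-> within l' (permv q (coords (dual_basis B) v)).
Proof.
pose B0 := permb p std_basis.
have U0 : unimodular B0 by apply: permb_unimod; left.
have B0E v : comb B0 v = permv_inv p v by rewrite /B0 comb_permb comb_std.
have arr := base_change _ _ (scheme_arrangement rsC fin) _ U0.
have RtE v : base_Rt (Rt a) B0 v <-> within l v.
  by rewrite /base_Rt B0E Rta permv_invK.
have Ch0 : base_Ch (Ch a) B0 e0 e1 e2.
  exists a, std_basis, p; split; first exact: chamber_id.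
  have := map_comb_std B0; rewrite /map_basis; bcbv => ->.
  by [].
have [w hom_w] := connC a' a.
have [X chX _] := hom_chamber hom_w.
have UX := chamber_unimod chX.
move: (chX) UX; case EX: X => [[x y] z] chX' UX; rewrite -EX in chX' UX.
have chY : base_Ch (Ch a) B0 (permv p x) (permv p y) (permv p z).
  by rewrite /base_Ch !B0E !permvK; exists a', X, 0%N; rewrite EX in chX' *.
have [q [B [rB EB]]] := list_chambers arr ok lv RtE Ch0 chY.
have UB := reached_unimodular _ _ rB.
have [r Er] := permv_comp p' q.
exists r, B; split=> // v; rewrite -Er -Rta' -(chamber_roots rsC chX) -RtE /base_Rt.
have -> : comb B0 v = comb X (permv q (coords (dual_basis B) v)); last by [].
rewrite -{1}(comb_coords _ v UB); move: (coords _ _) => t.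
rewrite -{1}[t](permvK q) -comb_permb EB B0E EX.
move: (permv q t) => [[r0 s0] t0]; clear; move: x y z => [[x0 x1] x2] [[y0 y1] y2] [[z0 z1] z2].
case: p => [|[|[|[|[|k]]]]]; rewrite /permv_inv; cbn [permv comb vadd vscal permv_inv]; apply: vec_eq; ring.
Qed.
End Uniqueness.

(** The check only compares lists of the same length. That the lengths agree follows by mapping each
    list injectively into the other one. *)
Lemma normalizes_unique (C : cartan_scheme 'I_3) (a a' : object C) tau tau' :
  targets_ok ->
  is_root_system C -> (forall a : object C, finite_set (real_roots a)) -> connected_scheme C ->
  normalizes a tau -> normalizes a' tau' ->
  tau @` positive_roots a = tau' @` positive_roots a'.
Proof.
move=> checked rsC fin connC /(normalizes_perm rsC) [p [l [l_in Rta ->]]].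
move=> /(normalizes_perm rsC) [p' [l' [l'_in Rta' ->]]].
have [ok lv] := checked _ l_in; have [ok' lv'] := checked _ l'_in.
have [q [B [rB H]]] := lists_related rsC connC (fin a) ok lv Rta Rta'.
have [q' [B' [rB' H']]] := lists_related rsC connC (fin a') ok' lv' Rta' Rta.
have le := map_length_le l l' ok ok' B q (reached_unimodular _ _ rB) (fun v => proj1 (H v)).
have le' := map_length_le l' l ok' ok B' q' (reached_unimodular _ _ rB') (fun v => proj1 (H' v)).
have E := check_list_unique l l' ok ok' targets B q l'_in lv rB (PeanoNat.Nat.le_antisymm _ _ le le')
  (fun v => proj1 (H v)).
by apply/seteqP; split=> v /=; rewrite E.
Qed.

(** The classification is applied at an arbitrary object a. The chamber that it returns belongs to
    some object b, which is the one to normalize, and the order of its walls supplies tau. *)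
Lemma normalizes_exists (C : cartan_scheme 'I_3) :
  targets_ok ->
  (forall Rt Ch, arrangement Rt Ch ->
    (forall a b c m n, Ch a b c -> Ch (vopp a) (vadd b (vscal m a)) (vadd c (vscal n a)) ->
     m <> Z0 \/ n <> Z0) -> realized Rt Ch targets) ->
  is_root_system C -> (forall a : object C, finite_set (real_roots a)) -> irreducible_scheme C ->
  exists (a : object C) (tau : {additive lattice 'I_3 -> lattice 'I_3}), normalizes a tau.
Proof.
move=> checked classif rsC fin irr; have [a] := object_nonempty C.
have arr := scheme_arrangement rsC (fin a).
have [x [y [z [l [[b [B [p [chB E]]]] [l_in H]]]]]] := classif _ _ arr
  (fun x y z m n => @scheme_irreducible _ rsC a x y z m n (fin a) irr).
have [ok lv] := checked _ l_in.
exists b, (perm_lattice p); apply: (perm_lattice_normalizes ok l_in) => v.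
rewrite -(chamber_roots rsC chB) /within.
have U := permb_unimod p (chamber_unimod chB).
have -> : comb B v = comb (permb p B) (permv p v) by rewrite comb_permb permvK.
by rewrite H -E coords_comb.
Qed.

(** * The scheme of a root list *)

Section Involutions.
Variable T : Type.

(** The alternating product of n factors in which f is applied first. *)
Fixpoint alt (f g : T -> T) (n : nat) (x : T) : T :=
  if n is n'.+1 then alt g f n' (f x) else x.

Lemma alt_last f g n x : alt f g n.+1 x = (if odd n then g else f) (alt f g n x).
Proof. by elim: n f g x => // n IH f g x; rewrite -[LHS]/(alt g f n.+1 (f x)) IH /=; case: (odd n). Qed.

Lemma iter_alt f g n x : iter n (f \o g) x = alt g f n.*2 x.
Proof.
elim: n x => // n IH x; rewrite iterSr IH doubleS //=.
Qed.

Variables f g : T -> T.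
Hypotheses (fK : involutive f) (gK : involutive g).

(** The braid form of the relation: a closed walk of 2 n steps is the same as two walks of n steps
    with a common end, since involutions can be moved to the other side one at a time. *)
Lemma alt_half n x : alt f g n x = alt g f n x <-> iter n (f \o g) x = x.
Proof.
rewrite iter_alt; split=> E.
  suff K k : (k <= n)%N -> alt g f (n + k) x = alt f g (n - k) x.
    by have := K n (leqnn n); rewrite subnn addnn.
  elim: k => [|k IH] lt_kn; first by rewrite addn0 subn0 E.
  rewrite addnS alt_last IH ?(ltnW lt_kn) // -[(n - k)%N]prednK ?subn_gt0 // alt_last.
  rewrite -subnS oddB // oddS oddD; case: (odd n); case: (odd k) => /=; rewrite ?fK ?gK //.
suff K k : (k <= n)%N -> alt g f (n.*2 - k) x = alt f g k x.
  by rewrite -(K n) // -addnn addnK.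
elim: k => [|k IH] lt_kn; first by rewrite subn0.
have lt_k2n : (k < n.*2)%N by rewrite -addnn (leq_trans lt_kn) // leq_addr.
rewrite alt_last -IH ?(ltnW lt_kn) // -[(n.*2 - k)%N]prednK ?subn_gt0 // alt_last -subnS.
rewrite oddB // odd_double oddS; case: (odd k) => /=; rewrite ?fK ?gK //.
Qed.

(** Conjugation by f or g inverts f g. The relation at one point of a dihedral orbit therefore holds
    at the adjacent points. *)
Lemma iter_invol h n x : h = f \/ h = g -> iter n (f \o g) x = x -> iter n (f \o g) (h x) = h x.
Proof.
move=> hE; have swap y : (f \o g) (h ((f \o g) y)) = h y.
  by case: hE => -> /=; rewrite ?fK gK ?fK.
have swapn y : iter n (f \o g) (h (iter n (f \o g) y)) = h y.
  by elim: n y => // n IH y; rewrite iterSr (iterS n _ y) swap IH.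
by move=> E; rewrite -{1}E swapn.
Qed.
End Involutions.

Section Homs.
Variables (I : finType) (C : cartan_scheme I).
Implicit Types a b c : object C.

Lemma weyl_hom_comp a b c w w' : weyl_hom a b w -> weyl_hom b c w' -> weyl_hom a c (w' \o w).
Proof. by move=> hw; elim=> // i d v _; apply: weyl_hom_sigma. Qed.
End Homs.

Lemma weyl_hom_inv (C : cartan_scheme 'I_3) (a b : object C) w :
  weyl_hom a b w -> exists w', weyl_hom b a w'.
Proof.
elim=> [|i c v _ [v' hv']]; first by exists id; exact: weyl_hom_id.
by exists (v' \o sigma i (rho i c)); apply: weyl_hom_right.
Qed.

Lemma cross_basisK i B m n : cross_basis i (cross_basis i B m n) m n = B.
Proof.
move: B => [[x y] z]; case: i => [|[|i]]; bcbv; clear; congr (_, _, _); vring.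
Qed.

Lemma wall_map i A X : comb A (wall i X) = wall i (map_basis (comb A) X).
Proof. by move: X => [[x y] z]; case: i => [|[|i]]. Qed.

Lemma wall_ord i B : exists j : 'I_3, wall i B = wall j B.
Proof.
by case: i => [|[|i]]; [exists i0 | exists i1 | exists i2]; rewrite inordK.
Qed.

Lemma rotateE (i : 'I_3) B : rotate i B = (wall i B, wall (next1 i) B, wall (next2 i) B).
Proof.
by elim/ord3P: i; rewrite ?next1E ?next2E !inordK //; case: B => [[x y] z].
Qed.

Lemma next_cases (i j : 'I_3) : j != i -> j = next1 i \/ j = next2 i.
Proof.
elim/ord3P: i; elim/ord3P: j; rewrite ?next1E ?next2E ?eqxx //; tauto.
Qed.

Lemma content_within l v : list_ok l = true -> within l v -> content v = Zpos 1.
Proof.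
move=> ok [/(list_root l ok) [] //|/(list_root l ok) [_ E]].
have E' : vopp v = vscal (Zneg 1) v by clear; vring.
by move: E; rewrite E' content_vscal; lia.
Qed.

Section ListScheme.
Variables (l : list vec) (others : list (list vec)).
Hypotheses (ok : list_ok l = true) (lv : levels_ok l others).

Definition vertex : Type := {B | reached l B}.
Implicit Types u : vertex.

Lemma vertex_eq u u' : sval u = sval u' -> u = u'.
Proof. by move: u u' => [B rB] [B' rB'] /= E; subst B'; congr exist; exact: Prop_irrelevance. Qed.

Definition list_rho (i : 'I_3) u : vertex :=
  exist _ (list_refl l i (sval u)) (reached_refl l others lv i _ (svalP u)).

Definition list_entry u (i j : 'I_3) : Z := climbs l (wall i (sval u)) (wall j (sval u)).
Definition list_cartan u (i j : 'I_3) : int := if i == j then 2 else - int_of_Z (list_entry u i j).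

Lemma list_reflE (i : 'I_3) B : list_refl l i B =
  cross_basis i B (climbs l (wall i B) (wall (next1 i) B)) (climbs l (wall i B) (wall (next2 i) B)).
Proof. by have [m [n [_ [_ [-> [-> ->]]]]]] := list_refl_cross l i B; rewrite rotateE. Qed.

Lemma wall_cross (i : 'I_3) B m n :
  [/\ wall i (cross_basis i B m n) = vopp (wall i B),
      wall (next1 i) (cross_basis i B m n) = vadd (wall (next1 i) B) (vscal m (wall i B)) &
      wall (next2 i) (cross_basis i B m n) = vadd (wall (next2 i) B) (vscal n (wall i B))].
Proof.
by elim/ord3P: i; rewrite ?next1E ?next2E !inordK //; case: B => [[x y] z].
Qed.

Lemma climbs_vadd a b : vadd b (vscal (climbs l a b) a) = snd (climb 20 l a b).
Proof. by rewrite /climbs; have := climb_spec 20 l a b; case: climb => k r [-> _]. Qed.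

Lemma list_cartan_rho u i j : list_cartan u i j = list_cartan (list_rho i u) i j.
Proof.
rewrite /list_cartan; case: (eqVneq i j) => // neq_ij; congr (- int_of_Z _).
have := climbs_sym l others ok lv i (sval u) (svalP u); rewrite rotateE => -[H1 H2].
have [w0 w1 w2] := wall_cross i (sval u)
  (climbs l (wall i (sval u)) (wall (next1 i) (sval u)))
  (climbs l (wall i (sval u)) (wall (next2 i) (sval u))).
rewrite -list_reflE !climbs_vadd in w0 w1 w2.
rewrite eq_sym in neq_ij.
rewrite /list_entry /= w0.
by case: (next_cases neq_ij) => ->; rewrite ?w1 ?w2 {2}/climbs ?H1 ?H2.
Qed.

Lemma list_gcm u : generalized_cartan_matrix (list_cartan u).
Proof.
split=> [i|i j /negPf neq_ij|i j]; rewrite /list_cartan.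
- by rewrite eqxx.
- by rewrite neq_ij; have := climbs_ge0 l (wall i (sval u)) (wall j (sval u)); rewrite /list_entry; lia.
rewrite eq_sym; case: eqP => // _ E.
have : list_entry u i j = Z0.
  by have := climbs_ge0 l (wall i (sval u)) (wall j (sval u)); move: E; rewrite /list_entry; lia.
rewrite /list_entry => /climbs_eq0 E'; suff -> : climbs l (wall j (sval u)) (wall i (sval u)) = Z0 by [].
apply/climbs_eq0; rewrite -E'; congr (rmem _ _); move: (wall i _) (wall j _) => x y; clear; vring.
Qed.

Lemma list_rhoK i : involutive (list_rho i).
Proof. by move=> u; apply: vertex_eq; rewrite /= (list_reflK _ _ ok lv) //; exact: svalP. Qed.

Definition std_vertex : vertex := exist _ std_basis (reached_std l).

Fact ord3_nonempty : (0 < #|'I_3|)%N. Proof. by rewrite card_ord. Qed.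

Definition list_scheme : cartan_scheme 'I_3 :=
  CartanScheme ord3_nonempty (inhabits std_vertex) list_gcm list_rhoK list_cartan_rho.

Implicit Types a b : object list_scheme.

Lemma entryE a i j : i != j -> entry a i j = list_entry a i j.
Proof.
move=> /negPf neq_ij; rewrite /entry /= /list_cartan neq_ij.
have := climbs_ge0 l (wall i (sval a)) (wall j (sval a)); rewrite /list_entry; lia.
Qed.

Lemma list_step a i : step a i (sval a) = list_refl l i (sval a).
Proof. by rewrite /step !entryE ?next1_neq ?next2_neq // list_reflE. Qed.

(** X is the change of basis from the chamber a to the chamber b and depends on nothing else. For a
    = b it is the standard basis, whence simple connectedness. *)
Lemma list_chamber a b X : chamber a b X -> map_basis (comb (sval a)) X = sval b.
Proof.
elim=> [|{}b {}X i _ IH]; first exact: map_comb_std.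
by rewrite /step map_cross_basis IH -[cross_basis _ _ _ _]/(step b i (sval b)) list_step.
Qed.

Lemma list_connected : connected_scheme list_scheme.
Proof.
have H b : exists w, weyl_hom (std_vertex : object list_scheme) b w.
  have [u Eu Hu] : exists2 u : object list_scheme, sval u = sval b &
      exists w, weyl_hom (std_vertex : object list_scheme) u w.
    apply: (reached_ind l (fun B => exists2 u : object list_scheme, sval u = B &
      exists w, weyl_hom (std_vertex : object list_scheme) u w) _ _ _ (svalP b)).
      by exists std_vertex => //; exists id; exact: weyl_hom_id.
    move=> i B [u uE [w hw]].
    have [j Ej] : exists j : 'I_3, list_refl l i B = list_refl l j B.
      by case: (i) => [|[|k]]; [exists i0 | exists i1 | exists i2]; rewrite inordK.
    exists (rho j u); first by rewrite /= uE Ej.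
    by exists (sigma j u \o w); exact: weyl_hom_sigma.
  by rewrite -(vertex_eq Eu).
move=> a b; have [w /weyl_hom_inv [w' hw']] := H a; have [v hv] := H b.
by exists (v \o w'); exact: weyl_hom_comp hw' hv.
Qed.

Lemma unimod a : unimodular (sval a).
Proof. exact: reached_unimodular (svalP a). Qed.

Lemma list_simply_connected : simply_connected_scheme list_scheme.
Proof.
move=> a w /hom_chamber [X /list_chamber E wE] v; apply: toV_inj; rewrite wE.
suff -> : X = std_basis by rewrite comb_std.
move: E; rewrite -{2}(map_comb_std (sval a)); case: X {wE} => [[x y] z].
by rewrite /map_basis /std_basis => -[] /(comb_inj _ _ _ (unimod a)) ->
  /(comb_inj _ _ _ (unimod a)) -> /(comb_inj _ _ _ (unimod a)) ->.
Qed.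

Lemma list_roots a v : real_roots a v <-> within l (comb (sval a) (toV v)).
Proof.
rewrite real_rootsP; split=> [[b [X [i [chX ->]]]]|].
  by rewrite wall_map (list_chamber chX); apply: (reached_wall _ ok); exact: svalP.
move=> /(reached_root _ _ lv) [B [i [rB E]]].
have [w hw] := list_connected (exist _ B rB : object list_scheme) a.
have [X chX _] := hom_chamber hw.
have [j Ej] := wall_ord i X; exists (exist _ B rB), X, j; split=> //.
apply: (comb_inj _ _ _ (unimod a)).
by rewrite E -Ej wall_map (list_chamber chX).
Qed.

Lemma list_roots_finite a : finite_set (real_roots a).
Proof.
pose f := ofV \o coords (dual_basis (sval a)).
apply: (@sub_finite_set _ _ [set` (List.map f (l ++ List.map vopp l))]) => [v /list_roots H|]; last first.
  exact: finite_seq.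
apply/mem_In/List.in_map_iff; exists (comb (sval a) (toV v)); split.
  by rewrite /f /= coords_comb ?toVK //; exact: unimod.
apply/List.in_app_iff; case: H => H; [by left | right].
by apply/List.in_map_iff; eexists; split; last exact: H; rewrite vopp_opp.
Qed.

Lemma list_R1 a : real_roots a = positive_roots a `|` -%R @` positive_roots a.
Proof.
have opp v : real_roots a (- v) <-> real_roots a v.
  by rewrite !list_roots toVN comb_opp within_opp.
apply/seteqP; split=> v /=; last first.
  by move=> [[]//|[u [Ru _] <-]]; exact/opp.
move=> Rv; have /list_roots Wv := Rv.
have := reached_coherent _ _ lv _ _ (svalP a) Wv.
rewrite /coherent coords_comb; last exact: unimod.
move=> /orP [/nneg_toV pos|]; first by left.
rewrite -toVN => /nneg_toV pos; right; exists (- v); last by rewrite opprK.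
by split=> //; apply/opp.
Qed.

Lemma list_R2 a i : real_roots a `&` [set simple_root i *~ n | n in [set: int]] =
  [set simple_root i; - simple_root i].
Proof.
have R0 : real_roots a (simple_root i).
  by apply/list_roots; rewrite toV_simple comb_wall; apply: (reached_wall _ ok); exact: svalP.
apply/seteqP; split=> v /=.
  move=> [Rv [n _ En]]; move: Rv; rewrite -{v}En => /list_roots; rewrite toVMz toV_simple => W.
  have E : comb (sval a) (vscal (Z_of_int n) (wall i std_basis)) =
      vscal (Z_of_int n) (wall i (sval a)).
    rewrite -(comb_wall (sval a)); move: (wall i _) (sval a) (Z_of_int n) => w [[x y] z] k.
    by clear; vring.
  move: W; rewrite E => /(content_within ok); rewrite content_vscal => En.
  have := content_within ok (reached_wall _ ok i _ (svalP a)); move: En => /[swap] -> En.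
  have [->|->] : n = 1 \/ n = -1 by lia.
  - by left; rewrite mulr1z.
  - by right; rewrite mulrN1z.
case=> ->; split=> //.
- by exists 1 => //; rewrite mulr1z.
- by apply/list_roots; rewrite toVN comb_opp within_opp; apply/list_roots.
- by exists (-1) => //; rewrite mulrN1z.
Qed.

Lemma list_R3 a i : sigma i a @` real_roots a = real_roots (rho i a).
Proof.
have sigmaK b v : sigma i b (sigma i b v) = v.
  apply: toV_inj; rewrite !toV_sigma -comb_step.
  by rewrite /step cross_basisK comb_std.
have combE b v : comb (sval (rho i b)) (toV v) = comb (sval b) (toV (sigma i b v)).
  by rewrite toV_sigma -comb_step list_step.
apply/seteqP; split=> v /=.
  by move=> [u /list_roots Ru <-]; apply/list_roots; rewrite combE sigmaK.
move=> /list_roots Rv; exists (sigma i a v); last exact: sigmaK.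
by apply/list_roots; rewrite -combE.
Qed.
End ListScheme.

(** * Roots in a rank two cone and axiom (R4) *)

Definition third (i j : 'I_3) : nat := (3 - i - j)%N.

Lemma thirdE : (third i0 i1 = 2%N) * (third i1 i0 = 2%N) * (third i0 i2 = 1%N) *
  (third i2 i0 = 1%N) * (third i1 i2 = 0%N) * (third i2 i1 = 0%N).
Proof. by rewrite /third !inordK. Qed.

Lemma absZ (x : int) : 0 <= x -> Z.of_nat `|x| = Z_of_int x.
Proof. by case: x. Qed.

Lemma rank2_coneP (i j : 'I_3) v : i != j ->
  rank2_cone i j v <-> vcoord (third i j) (toV v) = Z0 /\ nneg (toV v) = true.
Proof.
move=> neq_ij; rewrite nneg_toV; split=> [[m [n ->]]|[v0 pos]].
  split; last by move=> k; rewrite !ffunE !ffunMnE !ffunE -!mulrnA; lia.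
  move: neq_ij; rewrite toVD !toVMn !toV_simple.
  elim/ord3P: i; elim/ord3P: j; rewrite ?eqxx // => _;
    rewrite thirdE !inordK //; bcbv; cbn [vscal vadd vcoord]; lia.
exists `|v i|%N, `|v j|%N; apply: toV_inj.
rewrite toVD !toVMn !toV_simple; move: (pos i0) (pos i1) (pos i2) v0 neq_ij.
elim/ord3P: i; elim/ord3P: j; rewrite ?eqxx // => p0 p1 p2 + _;
rewrite thirdE !inordK // /toV; bcbv; cbn [vscal vadd vcoord] => v0;
rewrite ?absZ //; apply: vec_eq; rewrite ?v0 ?Z.mul_1_r ?Z.mul_0_r ?Z.add_0_r ?Z.add_0_l //.
Qed.

Lemma cone_card (C : cartan_scheme 'I_3) (b : object C) l others B (i j : 'I_3) (m : nat) :
  list_ok l = true -> levels_ok l others -> reached l B ->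
  (forall v, real_roots b v <-> within l (comb B (toV v))) -> i != j ->
  (real_roots b `&` rank2_cone i j #= `I_m)%card <-> m = plane_count l (third i j) B.
Proof.
move=> ok lv rB H neq_ij.
have nd := plane_list_nodup l (third i j) B ok (reached_unimodular _ _ rB).
rewrite -plane_list_length.
suff E : (real_roots b `&` rank2_cone i j #= `I_(length (plane_list l (third i j) B)))%card.
  split=> [E'|->//].
  by apply/eqP; rewrite eq_sym; apply/eqP/card_eq_II; rewrite -(card_eql E) E'.
set t := plane_list _ _ _ in nd *.
have -> : real_roots b `&` rank2_cone i j = (fun k => ofV (List.nth k t e0)) @` `I_(length t).
  apply/seteqP; split=> v /=.
    move=> [/H W /(rank2_coneP _ neq_ij) [v0 pos]].
    have /(List.In_nth _ _ e0) [k [/ssrnat.ltP lt_k Ek]] : List.In (toV v) t.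
      by apply/(plane_listP _ _ _ _ _ ok lv rB).
    by exists k; rewrite //= Ek toVK.
  move=> [k /ssrnat.ltP lt_k <-].
  have /(plane_listP _ _ _ _ _ ok lv rB) [v0 [pos W]] := List.nth_In t e0 lt_k.
  split; first by apply/H; rewrite ofVK.
  by apply/rank2_coneP; rewrite ?ofVK.
apply: inj_card_eq => x y; rewrite !inE /= => /ssrnat.ltP ltx /ssrnat.ltP lty /(can_inj ofVK).
exact: (proj1 (List.NoDup_nth t e0) nd).
Qed.

Section ListScheme.
Variables (l : list vec) (others : list (list vec)).
Hypotheses (ok : list_ok l = true) (lv : levels_ok l others).
Let S := list_scheme ok lv.
Implicit Types a b : object S.

Lemma third_min (i j : 'I_3) : i != j ->
  Nat.min i 2 <> Nat.min (third i j) 2 /\ Nat.min j 2 <> Nat.min (third i j) 2.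
Proof. by rewrite /third; elim/ord3P: i; elim/ord3P: j; rewrite ?eqxx ?inordK. Qed.

Lemma descend_alt (i j : 'I_3) n a X : descend l n i j (sval a) = Some X ->
  X = sval (alt (@rho _ S i) (@rho _ S j) n a).
Proof.
by elim: n i j a => [|n IH] i j a /=; [case | case: nneg => // /(IH j i (rho i a))].
Qed.

(** Induction from the top. If wall i or wall j is positive, the relation is carried over from the
    higher neighbour, where m_ij is the same. If both are negative, the two halves of the closed
    walk are the descending walks compared by [diamond]. *)
Lemma list_R4 a (i j : 'I_3) : i != j ->
  iter (plane_count l (third i j) (sval a)) (@rho _ S i \o @rho _ S j) a = a.
Proof.
move=> neq_ij; have [ti tj] := third_min neq_ij.
have fK k : involutive (@rho _ S k) by exact: rhoK.
suff K B : reached l B -> forall a, sval a = B ->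
    iter (plane_count l (third i j) (sval a)) (@rho _ S i \o @rho _ S j) a = a.
  exact: (K _ (svalP a)).
move: B; apply: (reached_up_ind _ _ lv) => B rB IH {}a aE; subst B.
have spread (k : 'I_3) : k = i \/ k = j -> nneg (wall k (sval a)) = true ->
    iter (plane_count l (third i j) (sval a)) (@rho _ S i \o @rho _ S j) a = a.
  move=> kE /IH /(_ (rho k a) erefl); rewrite /= plane_count_refl; last 1 first.
  - by case: kE => ->.
  - move=> E; have := iter_invol (fK i) (fK j) (h := @rho _ S k) _ E.
    rewrite fK; apply; by case: kE => ->; [left | right].
  exact: svalP.
case Ei: (nneg (wall i (sval a))); first by apply: (spread i) => //; left.
case Ej: (nneg (wall j (sval a))); first by apply: (spread j) => //; right.
have lt3 (k : 'I_3) : (k < 3)%coq_nat by apply/ssrnat.ltP.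
have neq : nat_of_ord i <> j by move=> /val_inj E; move: neq_ij; rewrite E eqxx.
have [m [X [-> [/descend_alt E /descend_alt E']]]] :=
  diamond_descend _ _ lv i j _ _ rB (lt3 i) (lt3 j) neq erefl Ei Ej.
by apply/(alt_half (fK i) (fK j)); apply: vertex_eq; rewrite -E -E'.
Qed.

Lemma list_root_system : is_root_system S.
Proof.
move=> a i j; split.
- exact: list_R1.
- exact: list_R2.
- exact: list_R3.
move=> neq_ij m /(cone_card _ ok lv (svalP a) (@list_roots _ _ ok lv a) neq_ij) ->.
exact: list_R4.
Qed.

Lemma list_irreducible : irreducible_scheme S.
Proof.
move=> a [J [[p pJ] [q qJ] Z]].
(* One of the two parts of a set with three elements is a singleton; its row would vanish, against
   [row_ok]. *)
have [i iJ] : exists i : 'I_3, forall j, i != j -> (i \in J) (+) (j \in J).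
  case J0: (i0 \in J); case J1: (i1 \in J); case J2: (i2 \in J);
  solve [by move: qJ; elim/ord3P: q; rewrite ?J0 ?J1 ?J2
    | by move: pJ; elim/ord3P: p; rewrite ?J0 ?J1 ?J2
    | by exists i0; apply: ord3P; rewrite ?J0 ?J1 ?J2 ?eqxx
    | by exists i1; apply: ord3P; rewrite ?J0 ?J1 ?J2 ?eqxx
    | by exists i2; apply: ord3P; rewrite ?J0 ?J1 ?J2 ?eqxx].
have Hi j : i != j -> list_entry a i j = Z0.
  move=> neq_ij; rewrite -(@entryE _ _ ok lv a) // /entry.
  case Ei: (i \in J) (iJ _ neq_ij); rewrite ?addTb ?addFb => jJ; first by have [-> _] := Z i j Ei jJ.
  by have [_ ->] := Z j i jJ (negbT Ei).
have := reached_row _ _ lv i _ (svalP a); rewrite rotateE.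
case E1: climb => [m b']; case E2: climb => [n c'] [[] nz _].
  by apply: nz; have := Hi _ (next1_neq i); rewrite /list_entry /climbs E1.
by apply: nz; have := Hi _ (next2_neq i); rewrite /list_entry /climbs E2.
Qed.
End ListScheme.

(** * Uniqueness of the scheme *)

Section SchemeUniqueness.
Variables (l : list vec) (others : list (list vec)).
Hypotheses (ok : list_ok l = true) (lv : levels_ok l others).
Let S := list_scheme ok lv.

Lemma descend_reached i j n B X : reached l B -> descend l n i j B = Some X -> reached l X.
Proof.
elim: n i j B => [|n IH] i j B rB /=; first by case=> <-.
by case: nneg => //; apply: IH; exact: reached_refl lv _ _ rB.
Qed.

Variables (C : cartan_scheme 'I_3) (o : object C).
Hypotheses (connC : connected_scheme C) (scC : simply_connected_scheme C).
Hypothesis rsC : is_root_system C.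
Hypothesis rootsC : forall v, Rt o v <-> within l v.
Implicit Types b : object C.

Lemma chamber_step_refl b B i : chamber o b B -> reached l B ->
  step b i B = list_refl l i B /\
  forall j, i != j -> entry b i j = climbs l (wall i B) (wall j B).
Proof.
move=> chB rB; have chB' := chamber_step i chB.
have coh v : within l v -> coherent (dual_basis (step b i B)) v = true.
  move=> /rootsC Rv; move: (chB'); case E: (step b i B) => [[x y] z] chB''.
  by apply: (Ch_coherent rsC _ Rv); exists (rho i b), (x, y, z), 0%N.
have walls k : within l (wall k (step b i B)) by apply/rootsC; exact: chamber_wall chB'.
have [E] := reflection_unique _ _ ok lv i B _ _ rB coh walls; rewrite /step E.
rewrite rotateE => -[E1 E2]; split=> // j; rewrite eq_sym => /next_cases [->|->] //.
Qed.

Lemma chamber_reached b B : chamber o b B -> reached l B.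
Proof.
elim=> [|{}b {}B i chB rB]; first exact: reached_std.
by rewrite (chamber_step_refl i chB rB).1; exact: reached_refl lv _ _ rB.
Qed.

Lemma chamber_refl b B i : chamber o b B -> chamber o (rho i b) (list_refl l i B).
Proof.
move=> chB; rewrite -(chamber_step_refl i chB (chamber_reached chB)).1.
exact: chamber_step.
Qed.

(* The objects reached along galleries from the standard chamber that cross
   each wall from its positive side. *)
Inductive asc : object C -> basis -> Prop :=
| asc_std : asc o std_basis
| asc_refl (i : 'I_3) b B : asc b B -> nneg (wall i B) = true ->
    asc (rho i b) (list_refl l i B).

Lemma asc_chamber b B : asc b B -> chamber o b B.
Proof. by elim=> [|i {}b {}B _ chB _]; [exact: chamber_id | exact: chamber_refl]. Qed.

Lemma asc_reached b B : asc b B -> reached l B.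
Proof. by move=> /asc_chamber /chamber_reached. Qed.

Lemma refl_ord i B : exists j : 'I_3, list_refl l i B = list_refl l j B /\ wall i B = wall j B.
Proof. by case: i => [|[|k]]; [exists i0 | exists i1 | exists i2]; rewrite inordK. Qed.

Lemma asc_exists B : reached l B -> exists b, asc b B.
Proof.
case=> n; elim: n B => [|n IH] B; first by move=> [<-|[]]; exists o; exact: asc_std.
move=> /level_succ [i [B0 [/IH [b ab] [pos ->]]]]; have [j [-> Ew]] := refl_ord i B0.
by exists (rho j b); apply: asc_refl; rewrite // -Ew.
Qed.

Lemma asc_down b B : asc b B -> B = std_basis /\ b = o \/
  exists (i : 'I_3) b1, [/\ b = rho i b1, asc b1 (list_refl l i B) & nneg (wall i B) = false].
Proof.
case=> [|i {}b {}B ab pos]; [by left | right; exists i, b].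
have rB := asc_reached ab.
by rewrite (list_reflK _ _ ok lv) // (nneg_wall_refl _ ok) // pos.
Qed.

(** Read backwards a descending walk ascends, so it carries an object over its end up to one over B.
    The last clause exposes the object just before the final step, to which the induction in
    [asc_unique] applies. *)
Lemma descend_asc (i j : 'I_3) n x B X : descend l n i j B = Some X -> reached l B -> asc x X ->
  exists y, [/\ asc y B, alt (rho i) (rho j) n y = x &
    (0 < n)%N -> exists2 y1, asc y1 (list_refl l i B) & y = rho i y1].
Proof.
elim: n i j B => [|n IH] i j B /=; first by case=> <- _ ax; exists x.
case E: nneg => // D rB ax; have rB' := reached_refl _ _ lv i _ rB.
have [y [ay yE _]] := IH _ _ _ D rB' ax.
exists (rho i y); rewrite rhoK yE; split=> //; last by exists y.
by rewrite -[B](list_reflK _ _ ok lv i) //; apply: asc_refl; rewrite // (nneg_wall_refl _ ok) // E.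
Qed.

Lemma alt_inj (f g : object C -> object C) n : injective f -> injective g -> injective (alt f g n).
Proof. by elim: n f g => [|n IH] f g If Ig x y //= /(IH _ _ Ig If) /If. Qed.

Lemma chamber_real_roots b B : chamber o b B ->
  forall v, real_roots b v <-> within l (comb B (toV v)).
Proof. by move=> chB v; rewrite -rootsC (chamber_roots rsC chB) /Rt toVK. Qed.

(** If the two galleries end with the same wall, induction applies at once. Otherwise an object x
    over the bottom X of the diamond is carried up along both sides to objects y and z over B;
    comparing them with b and b' one level lower gives b = y and b' = z. *)
Lemma asc_unique b b' B : asc b B -> asc b' B -> b = b'.
Proof.
move=> ab; have [n Bn] := asc_reached ab.
elim: n B b b' Bn ab => [|n IH] B b b' Bn ab ab'.
  have [EB _] : B = std_basis /\ True by case: Bn => [<-|[]].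
  subst B; have neg (i : 'I_3) : nneg (wall i std_basis) = true.
    by elim/ord3P: i; rewrite inordK.
  case: (asc_down ab) => [[_ ->]|[i [b1 [_ _]]]]; last by rewrite neg.
  by case: (asc_down ab') => [[_ ->]|[i [b1 [_ _]]]] //; rewrite neg.
have notstd : B <> std_basis.
  move=> E; rewrite E in Bn.
  have Bn0 : List.In std_basis (level l 0) by left.
  by have := level_inj _ _ ok lv _ _ _ Bn Bn0.
case: (asc_down ab) => [[]//|[i [b1 [bE ab1 negi]]]].
case: (asc_down ab') => [[]//|[j [b2 [bE' ab2 negj]]]].
have lvl k : nneg (wall k B) = false -> List.In (list_refl l k B) (level l n).
  by move=> neg; apply: (levels_down _ _ lv).
have [eq_ij|neq_ij] := eqVneq i j.
  by subst j; rewrite bE bE' (IH _ _ _ (lvl _ negi) ab1 ab2).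
have rB := asc_reached ab.
have lt3 (k : 'I_3) : (k < 3)%coq_nat by apply/ssrnat.ltP.
have neq : nat_of_ord i <> j by move=> /val_inj E; move: neq_ij; rewrite E eqxx.
have [m [X [cnt [D D']]]] := diamond_descend _ _ lv i j _ _ rB (lt3 i) (lt3 j) neq erefl negi negj.
have [x ax] := asc_exists (descend_reached rB D).
have [y [_ yE /(_ isT) [y1 ay1 Ey]]] := descend_asc D rB ax.
have [z [_ zE /(_ isT) [z1 az1 Ez]]] := descend_asc D' rB ax.
have Eb : b = y by rewrite bE Ey (IH _ _ _ (lvl _ negi) ab1 ay1).
have Eb' : b' = z by rewrite bE' Ez (IH _ _ _ (lvl _ negj) ab2 az1).
(* By (R4) the two descending walks from y end in the same object, which is x. As the walk from z
   that starts with j also ends in x and walks are injective, y = z. *)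
rewrite Eb Eb'; have [_ _ _ R4] := rsC b i j.
have := R4 neq_ij m.+1 ((cone_card _ ok lv rB (chamber_real_roots (asc_chamber ab)) neq_ij).2 (esym cnt)).
move=> /(alt_half (@rhoK _ C i) (@rhoK _ C j)); rewrite Eb yE -zE.
have ri k : injective (@rho _ C k) by apply: inv_inj; exact: rhoK.
by move=> /(alt_inj (ri _) (ri _)) ->.
Qed.

(** A gallery may also descend. If it goes from B down to a lower chamber, an object b0 over the
    latter has its reflection over B, and by uniqueness this is b; so the gallery arrives at b0. *)
Lemma chamber_asc b B : chamber o b B -> asc b B.
Proof.
elim=> [|{}b {}B i chB ab]; first exact: asc_std.
have rB := asc_reached ab; rewrite (chamber_step_refl i chB rB).1.
case E: (nneg (wall i B)); first exact: asc_refl.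
have rB' := reached_refl _ _ lv i _ rB.
have [b0 ab0] := asc_exists rB'.
have ab1 : asc (rho i b0) B.
  rewrite -[B](list_reflK _ _ ok lv i) //; apply: asc_refl => //.
  by rewrite (nneg_wall_refl _ ok) // E.
by rewrite (asc_unique ab ab1) rhoK.
Qed.

(** Two morphisms from b to o are both inverse to any morphism back, because Hom(b, b) and Hom(o, o)
    are trivial. *)
Lemma chamber_inj b B B' : chamber o b B -> chamber o b B' -> B = B'.
Proof.
move=> /chamber_hom [w hw wE] /chamber_hom [w' hw' wE'].
have [v hv] := weyl_hom_inv hw.
have vw x : v (w' x) = x by exact: (scC (weyl_hom_comp hw' hv)).
have wv x : w (v x) = x by exact: (scC (weyl_hom_comp hv hw)).
have E x : comb B x = comb B' x.
  by rewrite -[x]ofVK -wE -wE' -[in LHS](vw (ofV x)) wv.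
rewrite -(map_comb_std B) -(map_comb_std B') /map_basis; bcbv.
by rewrite !E.
Qed.

(** The equivalence sends a chamber to the object over it. By [asc_unique] the choice of that object
    does not matter; the map is injective by simple connectedness and surjective by connectedness,
    and the index set stays fixed. *)
Lemma list_scheme_unique : equivalent_schemes S C.
Proof.
pose f (u : object S) : object C := projT1 (cid (asc_exists (svalP u))).
have fP u : asc (f u) (sval u) by rewrite /f; case: cid.
have f_inj : injective f.
  move=> u u' E; apply: vertex_eq; apply: (@chamber_inj (f u)); first exact: asc_chamber.
  by rewrite E; exact: asc_chamber.
have f_surj b : exists u, f u = b.
  have [w hw] := connC b o; have [B chB _] := hom_chamber hw.
  exists (exist _ B (chamber_reached chB)); apply: asc_unique (fP _) _.
  exact: chamber_asc.
pose g b := projT1 (cid (f_surj b)).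
have gK : cancel g f by move=> b; rewrite /g; case: cid.
exists id, f; split.
- by exists id.
- by exists g => // u; apply: f_inj; rewrite gK.
- move=> i u; apply: asc_unique (fP _) _; apply: chamber_asc.
  exact: chamber_refl (asc_chamber (fP u)).
move=> i j u; have [->|neq_ij] := eqVneq i j; first by rewrite !cartan_diag.
have := (chamber_step_refl i (asc_chamber (fP u)) (svalP u)).2 j neq_ij.
rewrite -[RHS](@entryE _ _ ok lv u) // /entry; by move=> /Z.opp_inj /(can_inj Z_of_intK).
Qed.
End SchemeUniqueness.

Definition certs : list (list (list positive)) :=
  List.map (List.map (decode 0)) cert_rows.

Lemma level2_checked : refuted 1000 None [::] (start_roots 4 0) (level2 5) (decode 0 cert_level2) = true.
Proof. vm_cast_no_check (erefl true). Qed.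

Lemma certs_checked : all_rows (fun q n : nat =>
  refuted 1000 (Some (Z.of_nat q, Z.of_nat n)) targets
    (start_roots q n) (start_nonroots q n) (List.nth n (List.nth q certs [::]) [::])) = true.
Proof. vm_cast_no_check (erefl true). Qed.

Lemma targets_checked : targets_ok.
Proof. apply: targets_okP; vm_cast_no_check (erefl true). Qed.

Theorem theorem4p1 :
  (forall C : cartan_scheme 'I_3,
     connected_scheme C -> finite_root_system C -> irreducible_scheme C ->
     (exists (a : object C)
             (tau : {additive lattice 'I_3 -> lattice 'I_3}),
        normalizes a tau) /\
     (forall (a a' : object C)
             (tau tau' : {additive lattice 'I_3 -> lattice 'I_3}),
        normalizes a tau -> normalizes a' tau' ->
        tau @` positive_roots a = tau' @` positive_roots a')) /\
  (forall R : set (lattice 'I_3), listed R ->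
     exists C : cartan_scheme 'I_3,
       [/\ connected_scheme C,
           simply_connected_scheme C,
           exists a : object C, real_roots a = R `|` -%R @` R,
           finite_root_system C /\ irreducible_scheme C &
           forall C' : cartan_scheme 'I_3,
             connected_scheme C' -> simply_connected_scheme C' ->
             is_root_system C' ->
             (exists a' : object C', real_roots a' = R `|` -%R @` R) ->
             equivalent_schemes C C']).
Proof.
split=> [C connC [rsC finC] irrC|R /listedP [l l_in ->]].
  split; last by move=> a a' tau tau'; exact: normalizes_unique targets_checked rsC finC connC.
  apply: (normalizes_exists targets_checked _ rsC finC irrC) => Rt Ch arr irr.
  exact: (classification _ _ _ level2_checked
    certs_checked _ _ arr irr).
have [ok lv] := targets_checked l_in.
have RE (C : cartan_scheme 'I_3) (a : object C) :
    real_roots a = [set v | List.In (toV v) l] `|` -%R @` [set v | List.In (toV v) l] <->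
    forall v, real_roots a v <-> within l (toV v).
  split=> [-> v|H]; first split.
  - by case=> [Hv|[u Hu <-]]; [left | right; rewrite toVN vopp_opp].
  - by case=> Hv; [left | right; exists (- v); rewrite /= ?opprK ?toVN].
  apply/seteqP; split=> v /=.
  - by move=> /H [Hv|Hv]; [left | right; exists (- v); rewrite /= ?opprK ?toVN].
  - by move=> Hv; apply/H; case: Hv => [Hv|[u Hu <-]]; [left | right; rewrite toVN vopp_opp].
exists (list_scheme ok lv); split.
- exact: list_connected.
- exact: list_simply_connected.
- by exists (std_vertex l); apply/RE => v; rewrite list_roots comb_std.
- by split; [split; [exact: list_root_system | exact: list_roots_finite] | exact: list_irreducible].
move=> C' connC' scC' rsC' [o /RE H].
apply: (list_scheme_unique ok lv (o := o) connC' scC' rsC') => v.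
by rewrite /Rt H ofVK.
Qed.
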